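(* Let $k\ge2$ and $\alpha,\beta>0$, and consider the dihedral group $I_{2k}$ with multiplicity $\kappa=(\alpha,\beta)$. For $z=|z|e^{i\phi_1}$, $w=|w|e^{i\phi_2}$, $u,v\in[-1,1]$ put $q=q_{u,v}(k\phi_1,k\phi_2)$ and $$a_j^+=|zw|\cos\Big(\frac{q-2j\pi}{k}\Big),\qquad a_j^-=|zw|\cos\Big(\frac{\pi-q-2j\pi}{k}\Big),\qquad j=0,\dots,k-1.$$ Then $$\mathcal J_\kappa(z,w)=\frac{\Gamma(k(\alpha+\beta))}{2\Gamma(\alpha+\beta)^k}\int_{-1}^1\int_{-1}^1\int_{T^{k-1}}\Big(e^{\sum_{j=0}^{k-1}a_j^+t_j}+e^{\sum_{j=0}^{k-1}a_j^-t_j}\Big)\prod_{j=0}^{k-1}t_j^{\alpha+\beta-1}\,dt_1\cdots dt_{k-1}\,d\nu^\alpha(u)\,d\nu^\beta(v),$$ where $(t_1,\dots,t_{k-1})$ ranges over $T^{k-1}$ and $t_0=1-\sum_{j=1}^{k-1}t_j$.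
   Context: Identify $\mathbb{R}^2$ with $\mathbb{C}$, with inner product $\langle z,w\rangle=\mathrm{Re}(z\bar w)$, and write $z=|z|e^{i\phi_1}$, $w=|w|e^{i\phi_2}$. The dihedral group $I_{2k}$ (order $4k$) contains the reflections $z\mapsto\bar ze^{ij\pi/k}$, $j=0,\dots,2k-1$, which form two conjugacy classes ($j$ even, containing $z\mapsto\bar z$; and $j$ odd); the multiplicity $\kappa=(\alpha,\beta)$ takes the value $\alpha$ on the roots of the class with $j$ even and $\beta$ on the class with $j$ odd. Dunkl operators: $T_jf(x)=\partial_jf(x)+\sum_{\alpha\in R_+}\kappa(\alpha)\alpha_j\frac{f(x)-f(\sigma_\alpha x)}{\langle\alpha,x\rangle}$; the Dunkl kernel $E_\kappa(x,y)$ is the joint eigenfunction $T_j^{(x)}E_\kappa=y_jE_\kappa$, $E_\kappa(0,y)=1$; the generalized Bessel function is $\mathcal J_\kappa(x,y)=\frac1{|G|}\sum_{g\in G}E_\kappa(x,gy)$. Measures on $[-1,1]$: $d\nu^\alpha(u)=\frac{\Gamma(\alpha+1/2)}{\sqrt\pi\,\Gamma(\alpha)}(1-u^2)^{\alpha-1}du$. Notation: $\xi_{u,v}(\theta_1,\theta_2)=v\cos\theta_1\cos\theta_2+u\sin\theta_1\sin\theta_2$ and $q_{u,v}(\theta_1,\theta_2)=\arccos\xi_{u,v}(\theta_1,\theta_2)\in[0,\pi]$. $T^{n}=\{(t_1,\dots,t_n):t_j>0,\ \sum t_j<1\}$ is the open unit simplex in $\mathbb{R}^n$. *)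

(* Defs.v *)
From HB Require Import structures.
From mathcomp Require Import all_boot all_order all_algebra.
From mathcomp Require Import all_classical all_reals all_analysis.
Set Implicit Arguments. Unset Strict Implicit. Unset Printing Implicit Defensive.
Import Order.TTheory GRing.Theory Num.Theory.
Import numFieldNormedType.Exports.
Local Open Scope ring_scope.

Section Defs.
Variable R : realType.

(* R^2 = C, points as pairs (Re, Im) *)
Definition dot (x y : R * R) : R := x.1 * y.1 + x.2 * y.2.

Definition coord (i : bool) (v : R * R) : R := if i then v.2 else v.1.
Definition unitv (i : bool) : R * R := if i then (0, 1) else (1, 0).

Definition polar (r phi : R) : R * R := (r * cos phi, r * sin phi).

Definition refl_root (al x : R * R) : R * R :=
  let c := 2 * dot al x / dot al al in (x.1 - c * al.1, x.2 - c * al.2).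

(* Root of the reflection z |-> conj z e^{i j pi/k}, j = 0..2k-1 : it fixes
   the line of angle j pi/(2k), so a root is i e^{i j pi/(2k)}.  These 2k
   roots form a positive system R_+. *)
Definition dih_root (k j : nat) : R * R :=
  (- sin (j%:R * pi / (2 * k)%:R), cos (j%:R * pi / (2 * k)%:R)).

Definition dih_mult (al be : R) (j : nat) : R := if odd j then be else al.

Definition dunkl (k : nat) (al be : R) (i : bool) (f : R * R -> R)
    (x : R * R) : R :=
  'D_(unitv i) f x +
  \sum_(j < 2 * k) dih_mult al be j * coord i (dih_root k j) *
     (f x - f (refl_root (dih_root k j) x)) / dot (dih_root k j) x.

Definition dih_regular (k : nat) (x : R * R) : Prop :=
  forall j : 'I_(2 * k), dot (dih_root k j) x != 0.

(* E is the Dunkl kernel: for each y, x |-> E x y is differentiable,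
   satisfies T_i E(.,y) = y_i E(.,y) (i = 1,2) and E(0,y) = 1.  The
   eigen-equations are imposed on the regular set, where the difference
   quotients are literally defined (on the walls they are removable
   singularities, determined by continuity). *)
Definition is_dunkl_kernel (k : nat) (al be : R) (E : R * R -> R * R -> R)
  : Prop :=
  forall y : R * R,
    (forall x : R * R, differentiable (fun x' => E x' y) x) /\
    E (0, 0) y = 1 /\
    (forall x : R * R, dih_regular k x -> forall i : bool,
        dunkl k al be i (fun x' => E x' y) x = coord i y * E x y).

(* elements of I_{2k}: z |-> z e^{i j pi/k} and z |-> conj z e^{i j pi/k} *)
Definition dih_rot (k j : nat) (y : R * R) : R * R :=
  let c := cos (j%:R * pi / k%:R) in let s := sin (j%:R * pi / k%:R) in
  (y.1 * c - y.2 * s, y.1 * s + y.2 * c).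
Definition dih_refl (k j : nat) (y : R * R) : R * R :=
  let c := cos (j%:R * pi / k%:R) in let s := sin (j%:R * pi / k%:R) in
  (y.1 * c + y.2 * s, y.1 * s - y.2 * c).

(* generalized Bessel function J(x,y) = 1/|G| sum_g E(x, g y), |G| = 4k *)
Definition gen_bessel (k : nat) (E : R * R -> R * R -> R) (x y : R * R) : R :=
  (4 * k)%:R^-1 *
  \sum_(j < 2 * k) (E x (dih_rot k j y) + E x (dih_refl k j y)).

Local Open Scope ereal_scope.

Definition Gamma (s : R) : R :=
  fine (\int[@lebesgue_measure R]_(t in `]0%R, +oo[)
          ((t `^ (s - 1)) * expR (- t))%:E).

Definition nu_int (a : R) (f : R -> \bar R) : \bar R :=
  \int[@lebesgue_measure R]_(u in `[(-1)%R, 1%R])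
     ((Gamma (a + 2^-1) / (Num.sqrt pi * Gamma a) *
        (1 - u ^+ 2) `^ (a - 1))%:E * f u).

(* iterated Lebesgue integral over {t_1,...,t_n > 0, sum t_j < c};
   simplex_int n 1 F = int_{T^n} F(t_1,...,t_n) dt_1...dt_n *)
Fixpoint simplex_int (n : nat) (c : R) (F : seq R -> \bar R) : \bar R :=
  match n with
  | 0%N => F [::]
  | n'.+1 => \int[@lebesgue_measure R]_(t in `]0%R, c[)
               simplex_int n' (c - t) (fun s => F (t :: s))
  end.

End Defs.

Local Open Scope ring_scope.

Definition xi_uv {R : realType} (u v th1 th2 : R) : R :=
  v * cos th1 * cos th2 + u * sin th1 * sin th2.
Definition q_uv {R : realType} (u v th1 th2 : R) : R := acos (xi_uv u v th1 th2).

(* Main.v *)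
Require Import Defs.
From HB Require Import structures.
From mathcomp Require Import all_boot all_order all_algebra.
From mathcomp Require Import all_classical all_reals all_analysis.
From mathcomp Require Import measurable_realfun ring lra.
Set Implicit Arguments. Unset Strict Implicit. Unset Printing Implicit Defensive.
Import Order.TTheory GRing.Theory Num.Theory.
Import numFieldNormedType.Exports.
Local Open Scope classical_set_scope.
Local Open Scope ring_scope.

(* Contracting the eigenvalue equations T_j E = y_j E with x leaves, along each
   ray, the radial derivative of E plus (1/t) times the operator
   sum_j kappa_j (1 - sigma_j) acting on the values of E on the dihedral orbit.
   That operator is positive on the (finite) orbit, so a Gronwall estimate for
   the sum of squares over the orbit shows that the equations have only one
   solution with E(0, y) = 1, and that it is the sum of any power series in |x|
   whose coefficients satisfy the corresponding recursion.  It suffices to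
   exhibit such a series.

   Put rho = |x||y|, lambda = alpha + beta.  By the Chebyshev factorization,
   prod_j (1 - s (1 + cos ((q - 2 pi j) / k))) = U(s) - V(s) cos q with
   V(s) = 2 (s/2)^k.  The coefficients h_m(xi) of (U - V xi)^(-lambda) are
   polynomials in xi, and the series of e^rho J(x, y) is
   sum_m <h_m> rho^m / (k lambda)_m, where <.> is the average over
   xi = xi_{u,v}(k phi_1, k phi_2) against nu^alpha and nu^beta.  The recursion
   for the kernel comes from averaging h_m against (1 +- u)(1 +- v) and
   integrating by parts in u and v, i.e. from the rank one case.

   On the other side, expanding the exponentials under the simplex integral
   (after multiplication by e^rho, so that all terms are nonnegative) and using
   Dirichlet's integral gives h_m(cos q) + h_m(- cos q), since the generating
   function prod_j (1 - s (1 + cos ((q - 2 pi j) / k)))^(-lambda) is the same. *)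

(** * Gamma and Beta integrals *)

(** The eigenvalue equations hold off the walls, so the comparison is made along rays of regular
    angle and carried to the remaining angles by continuity ([sin_dense]); the same device handles
    the angles at which the roots in the Chebyshev factorization collide. The kernel is compared
    with partial sums rather than with the series itself: nothing has to be differentiated termwise,
    and the equation for the difference is disturbed by a single term of degree [M]. The candidate
    is found as follows. The sum over the reflections in the recursion depends on the angles only
    through the products S and C of the sines and of the cosines of [k] times the two angles. Once
    its value is prescribed, the recursion is of first order and is solved by a geometric sum. It
    remains to verify that the coefficients so obtained do have the prescribed reflection sum; this
    is a partial fraction identity, in which integration by parts against the two measures supplies
    the cancellation. *)

Section AffineChange.
Variable R : realType.
Notation mu := (@lebesgue_measure R).
Local Open Scope ereal_scope.

Lemma measurable_affine (a c : R) : measurable_fun [set: R] (fun x => a * x + c)%R.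
Proof. by apply: measurable_funD => //; apply: measurable_funM. Qed.

(** [a] times the pushforward of [mu] by the affine map gives half-open intervals their length,
    hence is Lebesgue measure. *)
Lemma ge0_integral_affine (a c : R) (f : R -> \bar R) : (0 < a)%R ->
  measurable_fun setT f -> (forall x, 0 <= f x) ->
  \int[mu]_x f x = a%:E * \int[mu]_x f (a * x + c)%R.
Proof.
move=> a0 mf f0.
pose phi := (fun x : measurableTypeR R => a * x + c : measurableTypeR R)%R.
have mphi : measurable_fun [set: measurableTypeR R] phi by exact: measurable_affine.
pose pm : {measure set (measurableTypeR R) -> \bar R} :=
  measure_function_pushforward__canonical__measure_function_Measure mu mphi.
pose m := mscale (NngNum (ltW a0)) pm.
have mE X : measurable X -> mu X = m X.
  apply: lebesgue_measure_unique => _ [[x y] _ <-] /=.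
  rewrite /m /mscale /= /pm /= /pushforward.
  have -> : phi @^-1` `]x, y] = `]((x - c) / a)%R, ((y - c) / a)%R]%classic :> set R.
    apply/seteqP; split => t /=; rewrite !in_itv /= /phi.
      by move=> /andP[h1 h2]; rewrite ltr_pdivrMr// ler_pdivlMr// ltrBlDr lerBrDr mulrC h1 h2.
    by rewrite ltr_pdivrMr// ler_pdivlMr// ltrBlDr lerBrDr mulrC.
  rewrite !lebesgue_measure_itv /= !lte_fin ltr_pM2r ?invr_gt0// ltrD2r.
  case: ifPn => _; last by rewrite mule0.
  rewrite -!EFinB -EFinM; congr EFin.
  by field; rewrite gt_eqF.
rewrite (eq_measure_integral m); last by move=> A mA _; exact: mE.
by rewrite ge0_integral_mscale// ge0_integral_pushforward.
Qed.

End AffineChange.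

Section PowerIntegral.
Variable R : realType.
Notation mu := (@lebesgue_measure R).

Lemma continuous_powRl (s x : R) : 0 < x -> {for x, continuous (fun t : R => t `^ s)}.
Proof.
move=> x0; apply: differentiable_continuous; apply/derivable1_diffP.
by apply: derivable_powR; rewrite in_itv/= x0.
Qed.

(** For [s < 1] the integrand is unbounded at 0, hence the fundamental theorem on intervals away
    from 0, followed by monotone convergence. *)
Lemma integral_powR_01 (s : R) : 0 < s ->
  (\int[mu]_(t in `]0%R, 1%R[) (t `^ (s - 1))%:E = (s^-1)%:E)%E.
Proof.
move=> s0.
have mp (A : set R) : measurable_fun A (fun t : R => (t `^ (s - 1))%:E).
  by apply/measurable_EFinP; apply: measurable_funTS; exact: measurable_powR.
rewrite integral_itv_bndo_bndc//.
(* [n.+2] keeps the interval nondegenerate at [n = 0]. *)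
pose F (n : nat) := `[(n.+2%:R^-1 : R), 1]%classic.
have -> : `]0%R, 1%R]%classic = \bigcup_n F n.
  apply/seteqP; split => [t|t [n _]]; rewrite /F /= !in_itv /=.
    move=> /andP[t0 t1]; exists (Num.truncn (t^-1)) => //=.
    rewrite in_itv/= t1 andbT invf_ple ?posrE//.
    have ti : 0 <= t^-1 by rewrite invr_ge0 ltW.
    have /andP[_ /ltW h] := truncn_itv ti.
    by rewrite (le_trans h)// ler_nat.
  by move=> /andP[h ->]; rewrite andbT (lt_le_trans _ h)// invr_gt0.
have cvg1 : (\int[mu]_(x in F i) (x `^ (s - 1))%:E @[i --> \oo] -->
   \int[mu]_(x in \bigcup_i F i) (x `^ (s - 1))%:E)%E.
  apply: (@ge0_nondecreasing_set_cvg_integral _ (measurableTypeR R) R F) => //.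
  - apply/nondecreasing_seqP => n; rewrite subsetEset /F => t /=.
    rewrite !in_itv/= => /andP[h ->]; rewrite andbT (le_trans _ h)//.
    by rewrite lef_pV2 ?posrE// ler_nat.
  - by move=> n; exact: measurable_itv.
  - by move=> n; exact: mp.
  - by move=> n x _; rewrite lee_fin powR_ge0.
have FE n : (\int[mu]_(x in F n) (x `^ (s - 1))%:E = (s^-1 - s^-1 * (n.+2%:R^-1) `^ s)%:E)%E.
  have n1 : n.+2%:R^-1 < 1 :> R by rewrite invf_lt1// ltr1n.
  have n0 : 0 < n.+2%:R^-1 :> R by rewrite invr_gt0.
  have pos (x : R) : n.+2%:R^-1 <= x -> 0 < x by exact: lt_le_trans.
  have dF (x : R) : 0 < x -> derivable (fun x : R => s^-1 * x `^ s) x 1.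
    by move=> x0; apply: derivableM => //; apply: derivable_powR; rewrite in_itv/= x0.
  rewrite (@continuous_FTC2 _ _ (fun x => s^-1 * x `^ s))//.
  - by rewrite powR1 mulr1.
  - apply: continuous_in_subspaceT => x; rewrite inE/= in_itv/= => /andP[/pos x0 _].
    exact: continuous_powRl.
  - split.
    + by move=> x; rewrite in_itv/= => /andP[/ltW /pos x0 _]; exact: dF.
    + apply: cvg_at_right_filter.
      by apply: cvgM; [exact: cvg_cst|exact: continuous_powRl].
    + apply: cvg_at_left_filter.
      by apply: cvgM; [exact: cvg_cst|exact: continuous_powRl].
  - move=> x; rewrite in_itv/= => /andP[/ltW /pos x0 _].
    rewrite derive1Ml; last by apply: derivable_powR; rewrite in_itv/= x0.
    rewrite powR_derive1 ?in_itv/= ?x0// mulrA mulVf ?gt_eqF// mul1r.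
    by [].
apply: (cvg_unique _ cvg1) => //.
rewrite (_ : (fun i => _) = (fun n => (s^-1 - s^-1 * (n.+2%:R^-1) `^ s)%:E)); last first.
  exact/funext.
apply: cvg_EFin; first by near=> n.
rewrite [X in _ --> X](_ : _ = s^-1 - s^-1 * 0); last by rewrite mulr0 subr0.
apply: cvgB; first exact: cvg_cst.
apply: cvgM; first exact: cvg_cst.
have h := @powR_cvg0 R _ s0.
have hh : (n.+2%:R^-1 : R) @[n --> \oo] --> (0 : R).
  by have := @cvg_harmonic R; rewrite -(cvg_shiftS (@harmonic R)).
apply: ((cvg_at_rightP _ _ _).1 h); split => //.
Unshelve. all: by end_near. Qed.

End PowerIntegral.

Section GammaConvolution.
Variable R : realType.
Notation mu := (@lebesgue_measure R).

(* Cut off at [0], so that Gamma and Beta integrals run over the whole line and Tonelli applies without domains. *)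
Definition pos_powR (s t : R) : R := (0 < t)%R%:R * t `^ (s - 1).

Lemma pos_powR_gt0E s t : 0 < t -> pos_powR s t = t `^ (s - 1).
Proof. by move=> t0; rewrite /pos_powR t0 mul1r. Qed.

Lemma pos_powR_le0E s t : t <= 0 -> pos_powR s t = 0.
Proof. by move=> t0; rewrite /pos_powR ltNge t0 mul0r. Qed.

Lemma pos_powR_ge0 s t : 0 <= pos_powR s t.
Proof. by rewrite mulr_ge0// powR_ge0. Qed.

Lemma measurable_pos_powR s : measurable_fun setT (pos_powR s).
Proof.
apply: measurable_funM; last exact: measurable_powR.
rewrite (_ : (fun x => _) = \1_(`]0%R, +oo[%classic)).
  by apply: measurable_indic; exact: measurable_itv.
by apply/funext => x; rewrite indicE mem_setE in_itv/= andbT.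
Qed.

Lemma pos_powRZ s c t : 0 < c -> pos_powR s (c * t) = c `^ (s - 1) * pos_powR s t.
Proof.
move=> c0; case: (ltP 0 t) => t0.
  by rewrite !pos_powR_gt0E ?mulr_gt0// powRM ?ltW.
by rewrite !pos_powR_le0E ?mulr0// mulr_ge0_le0// ltW.
Qed.

Lemma integral_pos_powR s (f : R -> \bar R) : 
  (\int[mu]_(t in `]0%R, +oo[) ((t `^ (s - 1))%:E * f t) = \int[mu]_t ((pos_powR s t)%:E * f t))%E.
Proof.
rewrite integral_mkcond; apply: eq_integral => t _.
rewrite patchE mem_setE in_itv/= andbT /pos_powR; case: ifPn => _; first by rewrite mul1r.
by rewrite mul0r mul0e.
Qed.

Lemma tonelli (f : R -> R -> \bar R) :
  measurable_fun setT (fun z : R * R => f z.1 z.2) -> (forall x y, 0 <= f x y)%E ->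
  (\int[mu]_x \int[mu]_y f x y = \int[mu]_y \int[mu]_x f x y)%E.
Proof.
move=> mf f0.
exact: (@fubini_tonelli _ _ (measurableTypeR R) (measurableTypeR R) R mu mu (fun z => f z.1 z.2)).
Qed.

Definition eGamma (s : R) : \bar R := (\int[mu]_t (pos_powR s t * expR (- t))%:E)%E.

Lemma fine_eGamma s : fine (eGamma s) = Gamma s.
Proof.
rewrite /eGamma /Gamma; congr fine.
under eq_integral do rewrite EFinM.
by rewrite -integral_pos_powR.
Qed.

Lemma eGamma_ge0 s : (0 <= eGamma s)%E.
Proof. by apply: integral_ge0 => t _; rewrite lee_fin mulr_ge0 ?pos_powR_ge0 ?expR_ge0. Qed.

(* Euler's Beta integral is [pow_conv a b 1]. *)
Definition pow_conv (a b z : R) : \bar R := (\int[mu]_x (pos_powR a x * pos_powR b (z - x))%:E)%E.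

Lemma pow_conv_ge0 a b z : (0 <= pow_conv a b z)%E.
Proof. by apply: integral_ge0 => t _; rewrite lee_fin mulr_ge0 ?pos_powR_ge0. Qed.

Lemma measurable_pow_conv_fun a b z : measurable_fun setT (fun x => pos_powR a x * pos_powR b (z - x)).
Proof.
apply: measurable_funM; first exact: measurable_pos_powR.
apply: (measurableT_comp (measurable_pos_powR b)).
by apply: measurable_funB.
Qed.

Lemma pow_convE a b z : 0 < z -> (pow_conv a b z = (z `^ (a + b - 1))%:E * pow_conv a b 1)%E.
Proof.
move=> z0; rewrite [LHS](@ge0_integral_affine _ z 0 (fun x => (pos_powR a x * pos_powR b (z - x))%:E)); last 3 first.
- by [].
- by apply/measurable_EFinP; exact: measurable_pow_conv_fun.
- by move=> x; rewrite lee_fin mulr_ge0 ?pos_powR_ge0.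
under eq_integral => x _.
  rewrite addr0 (_ : z - z * x = z * (1 - x)); last by ring.
  rewrite !pos_powRZ// mulrACA EFinM.
  over.
rewrite ge0_integralZl_EFin//; last 3 first.
- by move=> x _; rewrite lee_fin mulr_ge0 ?pos_powR_ge0.
- by apply/measurable_EFinP; exact: measurable_pow_conv_fun.
- by rewrite mulr_ge0 ?powR_ge0.
rewrite muleA -EFinM; congr (_%:E * _)%E.
rewrite -powRD; last by rewrite (gt_eqF z0) implybT.
rewrite -[X in X * _]powRr1 ?ltW// -powRD; last by rewrite (gt_eqF z0) implybT.
by congr (_ `^ _); ring.
Qed.

Lemma pow_conv_le0 a b z : z <= 0 -> pow_conv a b z = 0%E.
Proof.
move=> z0; rewrite /pow_conv integral0_eq// => x _.
case: (ltP 0 x) => x0; last by rewrite pos_powR_le0E// mul0r.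
by rewrite [X in _ * X]pos_powR_le0E ?mulr0// subr_le0 (le_trans z0)// ltW.
Qed.

(** The product is the integral of exp (- z) against the convolution of the two powers, and
    homogeneity of that convolution separates [z]. The identity is stated in [0, +oo] because
    finiteness of Gamma is derived from it. *)
Lemma eGammaM a b : (eGamma a * eGamma b = pow_conv a b 1 * eGamma (a + b))%E.
Proof.
have me : measurable_fun setT (fun x : R => expR (- x)).
  by apply: (measurableT_comp (@measurable_expR R)).
have mpe c : measurable_fun setT (fun x => (pos_powR c x * expR (- x))%:E).
  by apply/measurable_EFinP; apply: measurable_funM => //; exact: measurable_pos_powR.
have pe0 c x : (0 <= (pos_powR c x * expR (- x))%:E)%E.
  by rewrite lee_fin mulr_ge0 ?pos_powR_ge0 ?expR_ge0.
rewrite muleC -ge0_integralZl//; [|exact: mpe|exact: eGamma_ge0].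
transitivity (\int[mu]_x \int[mu]_z (pos_powR a x * pos_powR b (z - x) * expR (- z))%:E)%E.
  apply: eq_integral => x _.
  rewrite muleC /eGamma (@ge0_integral_affine _ 1 (- x) (fun t => (pos_powR b t * expR (- t))%:E))//.
  rewrite mul1e -ge0_integralZl//; last 1 first.
  - apply/measurable_EFinP; apply: measurable_funM.
      by apply: (measurableT_comp (measurable_pos_powR b)); exact: measurable_affine.
    by apply: (measurableT_comp me); exact: measurable_affine.
  apply: eq_integral => z _; rewrite -EFinM mul1r; congr EFin.
  rewrite mulrACA -expRD mulrA; congr (_ * expR _); ring.
rewrite tonelli; last 2 first.
- apply/measurable_EFinP; apply: measurable_funM; first apply: measurable_funM.
  + exact: (measurableT_comp (measurable_pos_powR a)).
  + apply: (measurableT_comp (measurable_pos_powR b)).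
    exact: measurable_funB.
  + exact: (measurableT_comp me).
- by move=> x y; rewrite lee_fin; apply: mulr_ge0; [apply: mulr_ge0; exact: pos_powR_ge0|exact: expR_ge0].
rewrite /eGamma -ge0_integralZl//; [|exact: mpe|exact: pow_conv_ge0].
apply: eq_integral => z _.
rewrite (_ : (\int[mu]_x (pos_powR a x * pos_powR b (z - x) * expR (- z))%:E)%E =
   (pow_conv a b z * (expR (- z))%:E)%E); last first.
  rewrite /pow_conv muleC -ge0_integralZl//.
  - by apply: eq_integral => x _; rewrite mulrC EFinM.
  - by apply/measurable_EFinP; exact: measurable_pow_conv_fun.
  - by move=> x _; rewrite lee_fin mulr_ge0 ?pos_powR_ge0.
case: (ltP 0 z) => z0.
  by rewrite pow_convE// pos_powR_gt0E// EFinM muleAC muleC muleA.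
by rewrite pow_conv_le0// pos_powR_le0E// mul0r mul0e mule0.
Qed.

End GammaConvolution.

Section GammaFunction.
Variable R : realType.
Notation mu := (@lebesgue_measure R).

Lemma pow_conv1 (s : R) : 0 < s -> pow_conv s 1 1 = (s^-1)%:E.
Proof.
move=> s0; rewrite -integral_powR_01// integral_mkcond; apply: eq_integral => t _.
rewrite patchE mem_setE in_itv/=; case: ifPn => [/andP[t0 t1]|].
  by rewrite !pos_powR_gt0E ?subr_gt0// subrr powRr0 mulr1.
rewrite negb_and -!leNgt => /orP[t0|t1]; first by rewrite pos_powR_le0E// mul0r.
by rewrite [X in _ * X]pos_powR_le0E ?mulr0// subr_le0.
Qed.

Lemma eGamma1 : eGamma (1 : R) = 1%E.
Proof.
rewrite /eGamma.
transitivity (\int[mu]_(t in `]0%R, +oo[) (expR (- t))%:E)%E.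
  rewrite [RHS]integral_mkcond; apply: eq_integral => t _.
  rewrite patchE mem_setE in_itv/= andbT /pos_powR; case: ifPn => _; last by rewrite mul0r mul0r.
  by rewrite mul1r subrr powRr0 mul1r.
have ce : continuous (fun t : R => expR (- t)).
  by move=> x; apply: continuous_comp; [exact: opp_continuous|exact: continuous_expR].
have me A : measurable_fun A (fun t : R => (expR (- t))%:E).
  by apply/measurable_EFinP; apply: measurable_funTS; exact: continuous_measurable_fun.
rewrite integral_itv_obnd_cbnd//.
have dF (x : R) : is_derive x 1 (fun t : R => - expR (- t)) (expR (- x)).
  rewrite (_ : (fun t : R => _) = - (expR \o -%R)); last by apply/funext.
  by apply: is_derive_eq; rewrite mulrN1 opprK.
rewrite (@ge0_continuous_FTC2y _ _ (fun t => - expR (- t)) 0 0)//.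
- by rewrite oppr0 expR0 -EFinB sub0r opprK.
- exact: continuous_subspaceT.
- rewrite -[X in _ --> X]oppr0; apply: cvgN; exact: cvgr_expR.
- by apply: cvg_at_right_filter; apply: cvgN; exact: ce.
- by move=> x _; rewrite derive1E derive_val.
Qed.

Lemma eGammaS (s : R) : 0 < s -> eGamma s = ((s^-1)%:E * eGamma (s + 1))%E.
Proof. by move=> s0; have := eGammaM s 1; rewrite eGamma1 mule1 pow_conv1. Qed.

(** Integers are reached by the recursion from [eGamma1]; at [s + 1] the bound t^s <= 1 + t^(n+1)
    with [s <= n.+1] compares with two integers; one more step of the recursion returns to [s]. *)
Lemma eGamma_fin_num (s : R) : 0 < s -> eGamma s \is a fin_num.
Proof.
have mpe c : measurable_fun setT (fun x : R => (pos_powR c x * expR (- x))%:E).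
  apply/measurable_EFinP; apply: measurable_funM; first exact: measurable_pos_powR.
  exact: (measurableT_comp (@measurable_expR R)).
have pe0 (c x : R) : (0 <= (pos_powR c x * expR (- x))%:E)%E.
  by rewrite lee_fin mulr_ge0 ?pos_powR_ge0 ?expR_ge0.
have natfin n : eGamma (n.+1%:R : R) \is a fin_num.
  elim: n => [|n IH]; first by rewrite eGamma1.
  have := @eGammaS n.+1%:R (ltr0Sn _ _); rewrite natr1 => H.
  have : (n.+1%:R%:E * eGamma n.+1%:R)%E = eGamma (n.+2%:R : R).
    by rewrite H muleA -EFinM divff// mul1e.
  by move=> <-; rewrite fin_numM.
move=> s0.
have ge1 : eGamma (s + 1) \is a fin_num.
  pose n := (Num.truncn s).
  have sn : s <= n.+1%:R by have /andP[_ /ltW] := truncn_itv (ltW s0).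
  rewrite ge0_fin_numE ?eGamma_ge0//.
  apply: (@le_lt_trans _ _ (eGamma 1 + eGamma (n.+2%:R : R))%E); last first.
    apply: lte_add_pinfty; first by rewrite eGamma1 ltry.
    by rewrite ltey_eq (natfin n.+1).
  rewrite /eGamma -ge0_integralD//; try exact: mpe.
  apply: ge0_le_integral => //; first exact: mpe.
    by apply: emeasurable_funD; exact: mpe.
  move=> x _; rewrite -EFinD lee_fin -mulrDl ler_wpM2r ?expR_ge0//.
  case: (ltP 0 x) => x0; last by rewrite !pos_powR_le0E// addr0.
  rewrite !pos_powR_gt0E// subrr powRr0 addrK -natr1 addrK.
  case: (lerP x 1) => x1.
    rewrite -[leLHS]addr0 lerD ?powR_ge0//.
    by rewrite -(powRr0 x) ger_powR ?x0// ltW.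
  by rewrite -[leLHS]add0r lerD// ler_powR// ltW.
by rewrite eGammaS//; apply: fin_numM.
Qed.

Lemma eGammaE (s : R) : 0 < s -> eGamma s = (Gamma s)%:E.
Proof. by move=> s0; rewrite -fine_eGamma fineK// eGamma_fin_num. Qed.

(** On (0, 1) the integrand is at least exp (-1) t^(s-1), with integral exp (-1) / s. *)
Lemma Gamma_gt0 (s : R) : 0 < s -> 0 < Gamma s.
Proof.
move=> s0; rewrite -lte_fin -eGammaE//.
apply: (@lt_le_trans _ _ ((expR (-1))%:E * pow_conv s 1 1)%E).
  by rewrite pow_conv1// -EFinM lte_fin mulr_gt0 ?expR_gt0 ?invr_gt0.
rewrite /pow_conv -ge0_integralZl//; last 2 first.
- by apply/measurable_EFinP; exact: measurable_pow_conv_fun.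
- by move=> x _; rewrite lee_fin mulr_ge0 ?pos_powR_ge0.
apply: ge0_le_integral => //.
- by move=> x _; rewrite -EFinM lee_fin; apply: mulr_ge0; [exact: expR_ge0|apply: mulr_ge0; exact: pos_powR_ge0].
- apply/measurable_EFinP; apply: measurable_funM => //.
  exact: measurable_pow_conv_fun.
- apply/measurable_EFinP; apply: measurable_funM; first exact: measurable_pos_powR.
  exact: (measurableT_comp (@measurable_expR R)).
- move=> x _; rewrite -EFinM lee_fin mulrC.
  case: (ltP x 1) => x1.
    rewrite [X in _ * X * _]pos_powR_gt0E ?subr_gt0// subrr powRr0 mulr1.
    by rewrite ler_wpM2l ?pos_powR_ge0// ler_expR lerN2 ltW.
  rewrite [X in _ * X * _]pos_powR_le0E ?subr_le0// mulr0 mul0r.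
  by rewrite mulr_ge0 ?pos_powR_ge0 ?expR_ge0.
Qed.

Lemma GammaS (s : R) : 0 < s -> Gamma (s + 1) = s * Gamma s.
Proof.
move=> s0; have := eGammaS s0; rewrite !eGammaE ?addr_gt0// -EFinM => -[->].
by rewrite mulrA divff ?gt_eqF// mul1r.
Qed.

Lemma pow_conv_Gamma (a b : R) : 0 < a -> 0 < b ->
  pow_conv a b 1 = (Gamma a * Gamma b / Gamma (a + b))%:E.
Proof.
move=> a0 b0; have G0 := Gamma_gt0 (addr_gt0 a0 b0).
have := eGammaM a b; rewrite !eGammaE ?addr_gt0// -EFinM => H.
rewrite EFinM H -muleA -EFinM divff ?gt_eqF// mule1//.
Qed.

End GammaFunction.

(** * The measures nu *)

Section NuMeasure.
Variable R : realType.
Notation mu := (@lebesgue_measure R).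

Definition jacobi_weight (a u : R) : R := pos_powR a (1 - u ^+ 2).

Lemma jacobi_weight_ge0 a u : 0 <= jacobi_weight a u.
Proof. exact: pos_powR_ge0. Qed.

Lemma measurable_jacobi_weight a : measurable_fun setT (jacobi_weight a).
Proof.
apply: (measurableT_comp (measurable_pos_powR a)).
apply: measurable_funB => //; exact: measurable_funX.
Qed.

(** As for [eGammaM], with the Gaussian in place of one Gamma integral: substituting t = z - x^2
    makes the exponential depend on [z] alone, and scaling [x] by the root of [z] extracts z^(a -
    1/2). *)
Lemma integral_jacobi_weight (a : R) : 0 < a ->
  (\int[mu]_u (jacobi_weight a u)%:E = (Num.sqrt pi * Gamma a / Gamma (a + 2^-1))%:E)%E.
Proof.
move=> a0; have a20 : 0 < a + 2^-1 by rewrite addr_gt0.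
have me : measurable_fun setT (fun x : R => expR (- x)).
  exact: (measurableT_comp (@measurable_expR R)).
have mpe c : measurable_fun setT (fun x : R => (pos_powR c x * expR (- x))%:E).
  by apply/measurable_EFinP; apply: measurable_funM => //; exact: measurable_pos_powR.
have pe0 (c x : R) : (0 <= (pos_powR c x * expR (- x))%:E)%E.
  by rewrite lee_fin mulr_ge0 ?pos_powR_ge0 ?expR_ge0.
have J0 : (0 <= \int[mu]_u (jacobi_weight a u)%:E)%E.
  by apply: integral_ge0 => u _; rewrite lee_fin jacobi_weight_ge0.
have mjz (z : R) : measurable_fun setT (fun x : R => pos_powR a (z - x ^+ 2)).
  apply: (measurableT_comp (measurable_pos_powR a)).
  apply: measurable_funB => //; exact: measurable_funX.
suff H : ((Num.sqrt pi : R)%:E * eGamma a = \int[mu]_u (jacobi_weight a u)%:E * eGamma (a + 2^-1))%E.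
  move: H; rewrite !eGammaE// -EFinM => H.
  rewrite EFinM H -muleA -EFinM divff ?mule1// gt_eqF//; exact: Gamma_gt0.
rewrite -integralT_gauss muleC -ge0_integralZl//; last 3 first.
- by apply/measurable_EFinP; exact: measurable_gauss_fun.
- by move=> x _; rewrite lee_fin gauss_fun_ge0.
- exact: eGamma_ge0.
transitivity (\int[mu]_x \int[mu]_z (pos_powR a (z - x ^+ 2) * expR (- z))%:E)%E.
  apply: eq_integral => x _.
  rewrite muleC /eGamma (@ge0_integral_affine _ 1 (- x ^+ 2) (fun t => (pos_powR a t * expR (- t))%:E))//.
  rewrite mul1e -ge0_integralZl//; last 2 first.
  - apply/measurable_EFinP; apply: measurable_funM.
      by apply: (measurableT_comp (measurable_pos_powR a)); exact: measurable_affine.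
    by apply: (measurableT_comp me); exact: measurable_affine.
  - by rewrite lee_fin gauss_fun_ge0.
  apply: eq_integral => z _; rewrite -EFinM mul1r; congr EFin.
  rewrite /gauss_fun mulrCA -expRD; congr (_ * expR _); ring.
rewrite tonelli; last 2 first.
- apply/measurable_EFinP; apply: measurable_funM.
  + apply: (measurableT_comp (measurable_pos_powR a)).
    apply: measurable_funB => //; exact: measurable_funX.
  + exact: (measurableT_comp me).
- by move=> x y; rewrite lee_fin; apply: mulr_ge0; [exact: pos_powR_ge0|exact: expR_ge0].
rewrite /eGamma -ge0_integralZl//; last exact: mpe.
apply: eq_integral => z _.
transitivity ((\int[mu]_x (pos_powR a (z - x ^+ 2))%:E) * (expR (- z))%:E)%E.
  rewrite muleC -ge0_integralZl//.
  - by apply: eq_integral => x _; rewrite mulrC EFinM.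
  - by apply/measurable_EFinP; exact: mjz.
  - by move=> x _; rewrite lee_fin pos_powR_ge0.
case: (ltP 0 z) => z0; last first.
  rewrite pos_powR_le0E// mul0r mule0 integral0_eq ?mul0e// => x _.
  by rewrite pos_powR_le0E// subr_le0 (le_trans z0)// sqr_ge0.
have s0 : 0 < Num.sqrt z by rewrite sqrtr_gt0.
rewrite [X in (X * _)%E](@ge0_integral_affine _ (Num.sqrt z) 0 (fun x => (pos_powR a (z - x ^+ 2))%:E)); last 3 first.
- by [].
- by apply/measurable_EFinP; exact: mjz.
- by move=> x; rewrite lee_fin pos_powR_ge0.
under eq_integral => x _.
  rewrite addr0 exprMn sqr_sqrtr ?ltW// (_ : z - z * x ^+ 2 = z * (1 - x ^+ 2)); last by ring.
  rewrite pos_powRZ// EFinM.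
  over.
rewrite ge0_integralZl_EFin//; last 3 first.
- by move=> x _; rewrite lee_fin jacobi_weight_ge0.
- by apply/measurable_EFinP; exact: measurable_jacobi_weight.
- exact: powR_ge0.
rewrite pos_powR_gt0E// muleA -EFinM -powR12_sqrt ?ltW// -powRD; last by rewrite (gt_eqF z0) implybT.
rewrite (_ : 2^-1 + (a - 1) = a + 2^-1 - 1); last by ring.
by rewrite muleAC -EFinM muleC.
Qed.

(** With u = 2 x - 1 one has 1 - u^2 = 4 x (1 - x) and 1 + u = 2 x, which gives Euler's integral
    with parameters a + n and a. *)
Lemma integral_jacobi_weight_moment (a : R) n : 0 < a ->
  (\int[mu]_u (jacobi_weight a u * (1 + u) ^+ n)%:E =
   (2 * 4 `^ (a - 1) * 2 ^+ n * (Gamma (a + n%:R) * Gamma a / Gamma (a + n%:R + a)))%:E)%E.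
Proof.
move=> a0; have an0 : 0 < a + n%:R by rewrite ltr_wpDr.
rewrite (@ge0_integral_affine _ 2 (-1) (fun u => (jacobi_weight a u * (1 + u) ^+ n)%:E)); last 3 first.
- by [].
- apply/measurable_EFinP; apply: measurable_funM; first exact: measurable_jacobi_weight.
  by apply: measurable_funX; apply: measurable_funD.
- move=> x; rewrite lee_fin; case: (lerP (-1) x) => x1.
    by rewrite mulr_ge0 ?jacobi_weight_ge0// exprn_ge0// -lerBlDl sub0r.
  by rewrite /jacobi_weight pos_powR_le0E ?mul0r// subr_le0; nra.
under eq_integral => x _.
  rewrite (_ : jacobi_weight a (2 * x - 1) * (1 + (2 * x - 1)) ^+ n =
     4 `^ (a - 1) * 2 ^+ n * (pos_powR (a + n%:R) x * pos_powR a (1 - x))); last first.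
    rewrite /jacobi_weight (_ : 1 - (2 * x - 1) ^+ 2 = 4 * (x * (1 - x))); last by ring.
    rewrite (_ : 1 + (2 * x - 1) = 2 * x); last by ring.
    rewrite pos_powRZ// exprMn.
    case: (ltP 0 x) => x0; last first.
      rewrite [in RHS]pos_powR_le0E// pos_powR_le0E ?mulr0 ?mul0r ?mulr0//.
      by nra.
    case: (ltP x 1) => x1; last first.
      rewrite [in RHS](@pos_powR_le0E _ _ (1 - x)) ?subr_le0// pos_powR_le0E ?mulr0 ?mul0r ?mulr0//.
      by nra.
    have x10 : 0 < 1 - x by rewrite subr_gt0.
    rewrite !pos_powR_gt0E ?mulr_gt0// powRM ?ltW//.
    rewrite (_ : a + n%:R - 1 = (a - 1) + n%:R); last by ring.
    rewrite [x `^ (a - 1 + n%:R)]powRD; last by rewrite (gt_eqF x0) implybT.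
    by rewrite powR_mulrn ?ltW//; ring.
  rewrite EFinM.
  over.
rewrite ge0_integralZl_EFin//; last 2 first.
- by move=> x _; rewrite lee_fin mulr_ge0 ?pos_powR_ge0.
- by apply/measurable_EFinP; exact: measurable_pow_conv_fun.
rewrite -/(pow_conv (a + n%:R) a 1) (pow_conv_Gamma an0 a0).
by rewrite -!EFinM !mulrA.
Qed.

Definition nu_cst (a : R) : R := Gamma (a + 2^-1) / (Num.sqrt pi * Gamma a).

Lemma nu_cst_ge0 a : 0 < a -> 0 <= nu_cst a.
Proof.
move=> a0; rewrite divr_ge0 ?mulr_ge0 ?sqrtr_ge0//; apply/ltW/Gamma_gt0 => //.
by rewrite addr_gt0.
Qed.

(* The moments of [1 + u] against nu; unlike those of [u] they have a single product formula. *)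
Definition nu_shifted_moment (a : R) (n : nat) : R := \prod_(i < n) (2 * (a + i%:R) / (2 * a + i%:R)).

Lemma nu_shifted_momentS a n : 0 < a -> (2 * a + n%:R) * nu_shifted_moment a n.+1 = 2 * (a + n%:R) * nu_shifted_moment a n.
Proof.
move=> a0; rewrite /nu_shifted_moment big_ord_recr/=.
have h : 2 * a + n%:R != 0 by rewrite gt_eqF// ltr_wpDr// mulr_gt0.
by field.
Qed.

Lemma nu_moment (a : R) n : 0 < a ->
  (\int[mu]_u (nu_cst a * (jacobi_weight a u * (1 + u) ^+ n))%:E = (nu_shifted_moment a n)%:E)%E.
Proof.
move=> a0.
under eq_integral do rewrite EFinM.
rewrite ge0_integralZl_EFin//; last 3 first.
- move=> x; rewrite lee_fin; case: (lerP (-1) x) => x1.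
    by rewrite mulr_ge0 ?jacobi_weight_ge0// exprn_ge0// -lerBlDl sub0r.
  by rewrite /jacobi_weight pos_powR_le0E ?mul0r// subr_le0; nra.
- apply/measurable_EFinP; apply: measurable_funM; first exact: measurable_jacobi_weight.
  by apply: measurable_funX; apply: measurable_funD.
- exact: nu_cst_ge0.
rewrite integral_jacobi_weight_moment// -EFinM; congr EFin.
elim: n => [|n IH].
  rewrite /nu_shifted_moment big_ord0 addr0 expr0.
  (* The total mass is now known twice, from the Gaussian and from Euler's integral. Equating the
     two, which amounts to the duplication formula, replaces the Beta value by the one that [nu_cst]
     cancels. *)
  have := integral_jacobi_weight_moment 0 a0.
  under eq_integral do rewrite expr0 mulr1.
  rewrite integral_jacobi_weight// expr0 addr0 => -[<-].
  rewrite /nu_cst; field.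
  rewrite !gt_eqF ?Gamma_gt0 ?sqrtr_gt0 ?pi_gt0// addr_gt0//.
have h : 0 < 2 * a + n%:R by rewrite ltr_wpDr// mulr_gt0.
apply: (mulfI (lt0r_neq0 h)); rewrite nu_shifted_momentS// -IH.
have an0 : 0 < a + n%:R by rewrite ltr_wpDr.
have an1 : 0 < a + n%:R + a by rewrite addr_gt0.
rewrite -[n.+1%:R]natr1 addrA GammaS// (_ : a + n%:R + 1 + a = a + n%:R + a + 1); last by ring.
rewrite GammaS// exprS; field.
by rewrite !gt_eqF ?Gamma_gt0.
Qed.

End NuMeasure.

Section MomentFunctional.
Variable R : realType.
Notation mu := (@lebesgue_measure R).

Definition coef_pairing (m : nat -> R) (p : {poly R}) : R := \sum_(i < size p) p`_i * m i.

Lemma coef_pairingE m n (p : {poly R}) : (size p <= n)%N -> coef_pairing m p = \sum_(i < n) p`_i * m i.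
Proof.
move=> pn; rewrite /coef_pairing (big_ord_widen n (fun i => p`_i * m i))// big_mkcond/=.
apply: eq_bigr => i _; case: ltnP => // h.
by rewrite nth_default ?mul0r.
Qed.

(* Integration against nu is used algebraically, as a functional on polynomials. *)
Definition nu_mom (a : R) (p : {poly R}) : R := coef_pairing (nu_shifted_moment a) (p \Po ('X - 1)).

Lemma nu_mom_is_linear a : linear_for *%R (nu_mom a).
Proof.
move=> c p q; rewrite /nu_mom comp_polyD comp_polyZ.
set p' := p \Po _; set q' := q \Po _.
pose n := maxn (size p') (size q').
have hp : (size p' <= n)%N by rewrite leq_maxl.
have hq : (size q' <= n)%N by rewrite leq_maxr.
have hpq : (size (c *: p' + q')%R <= n)%N.
  rewrite (leq_trans (size_polyD _ _))// geq_max hq andbT.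
  by rewrite (leq_trans (size_scale_leq _ _)).
rewrite !(coef_pairingE _ (n := n))// mulr_sumr -big_split/=; apply: eq_bigr => i _.
by rewrite coefD coefZ; ring.
Qed.

HB.instance Definition _ a :=
  GRing.isLinear.Build R {poly R} R *%R (nu_mom a) (nu_mom_is_linear a).

Lemma nu_mom_XD1 a n : nu_mom a (('X + 1) ^+ n) = nu_shifted_moment a n.
Proof.
rewrite /nu_mom rmorphXn/= comp_polyD comp_polyX comp_polyC subrK.
rewrite (coef_pairingE _ (n := n.+1)) ?size_polyXn// big_ord_recr/= coefXn eqxx mul1r.
by rewrite big1 ?add0r// => i _; rewrite coefXn ltn_eqF ?mul0r.
Qed.

Lemma nu_mom1 a : nu_mom a 1 = 1.
Proof. by rewrite -(expr0 ('X + 1)) nu_mom_XD1 /nu_shifted_moment big_ord0. Qed.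

Lemma polyXD1_ind (p : {poly R}) :
  p = \sum_(i < size (p \Po ('X - 1))) (p \Po ('X - 1))`_i *: ('X + 1) ^+ i.
Proof.
rewrite -comp_polyE -comp_polyA comp_polyB comp_polyX -polyC1 comp_polyC.
by rewrite addrK comp_polyXr.
Qed.

(** Integration by parts, as 2 a u (1 - u^2)^(a-1) is minus the derivative of (1 - u^2)^a. On the
    basis of powers of 1 + u it is the recurrence of the moments. *)
Lemma nu_mom_ibp a (p : {poly R}) : 0 < a ->
  nu_mom a ((2 * a) *: ('X * p)) = nu_mom a ((1 - 'X^2) * p^`()).
Proof.
move=> a0; rewrite (polyXD1_ind p); set q := p \Po _.
rewrite mulr_sumr scaler_sumr !linear_sum/= mulr_sumr [RHS]linear_sum/=.
apply: eq_bigr => i _; set c := q`_i.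
rewrite derivZ -!scalerAr !linearZ/= mulrCA; congr (c * _); move: {c} (i : nat) => {}i.
rewrite (_ : 'X * ('X + 1) ^+ i = ('X + 1) ^+ i.+1 - ('X + 1) ^+ i); last first.
  by rewrite exprS; ring.
have -> : (1 - 'X^2) * (('X + 1) ^+ i)^`() = i%:R *: (2 *: ('X + 1) ^+ i - ('X + 1) ^+ i.+1 : {poly R}).
  rewrite deriv_exp derivD derivX derivC addr0 mul1r -scaler_nat.
  case: i => [|i] /=; first by rewrite !scale0r mulr0.
  rewrite -scalerAr; congr (_ *: _); rewrite !exprS -!mul_polyC.
  rewrite polyCD polyC1; ring.
rewrite !linearZ/= !raddfB/= linearZ/= !nu_mom_XD1.
have := nu_shifted_momentS i a0; set m1 := nu_shifted_moment a _; set m0 := nu_shifted_moment a _; move=> H.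
apply/eqP; rewrite -subr_eq0; apply/eqP.
transitivity ((2 * a + i%:R) * m1 - 2 * (a + i%:R) * m0); first by ring.
by rewrite H subrr.
Qed.

(** The moments of 1 + u hide the symmetry of the measure; it is recovered from parts, which link
    the moments of u in steps of two. *)
Lemma nu_mom_Xodd a n : 0 < a -> odd n -> nu_mom a ('X^n) = 0.
Proof.
move=> a0; elim/ltn_ind: n => -[//|n IH] /= en.
have := nu_mom_ibp 'X^n a0; rewrite -exprS linearZ/= derivXn.
case: n IH en => [|n IH en].
  move=> _ _; rewrite mulr0n mulr0 linear0 => /eqP.
  by rewrite mulf_eq0 (gt_eqF (mulr_gt0 _ _))//= => /eqP.
rewrite /= mulrnAr raddfMn/= mulrBl mul1r -exprD raddfB/=.
have -> : nu_mom a 'X^n = 0 by apply: IH => //; move: en; rewrite /= negbK.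
rewrite sub0r add2n -[_ *+ n.+1]mulr_natl mulrN => /eqP; rewrite -subr_eq0 opprK -mulrDl mulf_eq0.
by rewrite gt_eqF ?ltr_wpDr ?mulr_gt0//= => /eqP.
Qed.

Lemma nu_mom_compN a (p : {poly R}) : 0 < a -> nu_mom a (p \Po (- 'X)) = nu_mom a p.
Proof.
move=> a0; rewrite -[p in RHS]coefK poly_def comp_polyE.
rewrite !linear_sum; apply: eq_bigr => i _; rewrite !linearZ/=; congr (_ * _).
rewrite exprNn -signr_odd; case: (boolP (odd i)) => oi /=; last by rewrite expr0 mul1r.
by rewrite expr1 mulN1r raddfN/= nu_mom_Xodd// oppr0.
Qed.

Lemma nu_intE (a : R) (f : R -> \bar R) : measurable_fun setT f ->
  nu_int a f = (\int[mu]_u ((nu_cst a * jacobi_weight a u)%:E * f u))%E.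
Proof.
move=> mf; rewrite /nu_int -/(nu_cst a).
have mw : measurable_fun setT (fun u : R => (1 - u ^+ 2) `^ (a - 1)).
  apply: (measurableT_comp (measurable_powR (a - 1))).
  by apply: measurable_funB => //; exact: measurable_funX.
(* The endpoints must go: for [a = 1] the power of 0 in [nu_int] is 1 there, whereas [jacobi_weight]
   vanishes. *)
rewrite integral_itv_bndoo; last first.
  apply: emeasurable_funM; last exact: measurable_funTS.
  apply/measurable_EFinP; apply: measurable_funTS.
  by apply: measurable_funM.
rewrite integral_mkcond; apply: eq_integral => u _.
rewrite patchE mem_setE in_itv/=; case: ifPn => [/andP[u1 u2]|].
  by rewrite /jacobi_weight pos_powR_gt0E// subr_gt0; nra.
rewrite negb_and -!leNgt /jacobi_weight => /orP[u1|u1].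
  by rewrite pos_powR_le0E ?mulr0 ?mul0e// subr_le0; nra.
by rewrite pos_powR_le0E ?mulr0 ?mul0e// subr_le0; nra.
Qed.

(** Powers of 1 + u are nonnegative on the support, so their finite moments already give the
    integrability needed for linearity. *)
Lemma nu_int_poly (a : R) (p : {poly R}) : 0 < a ->
  nu_int a (fun u => (p.[u])%:E) = (nu_mom a p)%:E.
Proof.
move=> a0; rewrite nu_intE; last first.
  by apply/measurable_EFinP; apply: continuous_measurable_fun; exact: continuous_horner.
pose q := p \Po ('X - 1).
pose g (i : 'I_(size q)) u := (nu_cst a * (jacobi_weight a u * (1 + u) ^+ i))%:E.
have gi i : mu.-integrable setT (g i).
  have mg : measurable_fun setT (g i).
    apply/measurable_EFinP; apply: measurable_funM => //; apply: measurable_funM.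
      exact: measurable_jacobi_weight.
    by apply: measurable_funX; apply: measurable_funD.
  apply/integrableP; split => //.
  under eq_integral => u _.
    rewrite gee0_abs; last first.
      rewrite lee_fin mulr_ge0 ?nu_cst_ge0//; case: (lerP (-1) u) => u1.
        by rewrite mulr_ge0 ?jacobi_weight_ge0// exprn_ge0// -lerBlDl sub0r.
      by rewrite /jacobi_weight pos_powR_le0E ?mul0r// subr_le0; nra.
    over.
  by rewrite nu_moment// ltry.
transitivity (\int[mu]_u \sum_(i < size q) ((q`_i)%:E * g i u))%E.
  apply: eq_integral => u _; rewrite /g.
  rewrite (eq_bigr (fun i : 'I_(size q) => (q`_i * (nu_cst a * (jacobi_weight a u * (1 + u) ^+ i)))%:E)); last first.
    by move=> i _; rewrite -EFinM.
  rewrite sumEFin -EFinM; congr EFin.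
  rewrite {1}(polyXD1_ind p) -/q horner_sum mulr_sumr; apply: eq_bigr => i _.
  by rewrite hornerZ horner_exp hornerD hornerX hornerC (addrC u); ring.
rewrite integral_sum//; last by move=> i; apply: integrableZl => //; exact: gi.
rewrite /nu_mom /coef_pairing -/q -sumEFin; apply: eq_bigr => i _.
by rewrite integralZl ?nu_moment -?EFinM//; exact: gi.
Qed.

End MomentFunctional.

(** * Exponential integrals over the simplex *)

Section GammaSeries.
Variable R : realType.
Notation mu := (@lebesgue_measure R).

Lemma nneseries_diag (F : nat -> nat -> \bar R) : (forall i j, 0 <= F i j)%E ->
  (\sum_(i <oo) \sum_(j <oo) F i j = \sum_(m <oo) \sum_(i < m.+1) F i (m - i)%N)%E.
Proof.
move=> F0; pose G i m := if (i <= m)%N then F i (m - i)%N else 0%E.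
have G0 i m : (0 <= G i m)%E by rewrite /G; case: ifP.
transitivity (\sum_(i <oo) \sum_(m <oo) G i m)%E.
  apply: eq_eseriesr => i _.
  rewrite [RHS](@nneseries_split _ _ 0%N i); last by [].
  rewrite add0n big_nat_cond big1 ?add0e; last first.
    by move=> j /andP[/andP[_ ji] _]; rewrite /G leqNgt ji.
  rewrite -[RHS]nneseries_addn; last by [].
  by apply: eq_eseriesr => j _; rewrite /G leq_addl addnK.
rewrite nneseries_interchange//; apply: eq_eseriesr => m _.
rewrite (@nneseries_split _ _ 0%N m.+1); last by [].
rewrite add0n big_mkord [X in (_ + X)%E]eseries0 ?adde0; last first.
  by move=> i mi _; rewrite /G leqNgt mi.
by apply: eq_bigr => i _; rewrite /G -ltnS ltn_ord.
Qed.

Lemma expR_eseries (x : R) : 0 <= x ->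
  ((expR x)%:E = \sum_(n <oo) (x ^+ n / n`!%:R)%:E)%E.
Proof.
move=> x0; rewrite /expR -EFin_lim; last exact: is_cvg_series_exp_coeff.
by apply/congr_lim/funext => n; rewrite /= /series/= -sumEFin.
Qed.

Implicit Types (a b c lam be t : R) (x y : nat -> R) (m : nat).

Definition cauchy_prod (x y : nat -> R) (m : nat) : R := \sum_(i < m.+1) x i * y (m - i)%N.

Lemma cauchy_prod_ge0 x y : (forall i, 0 <= x i) -> (forall i, 0 <= y i) -> forall i, 0 <= cauchy_prod x y i.
Proof. by move=> x0 y0 i; apply: sumr_ge0 => j _; rewrite mulr_ge0. Qed.

(** The function of [c] whose Laplace transform at s is the sum of y_m s^(-b-m). With this
    normalization convolution becomes the Cauchy product of coefficients. *)
Definition gamma_series (b : R) (y : nat -> R) (c : R) : \bar R :=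
  (\sum_(m <oo) (y m / Gamma (b + m%:R) * pos_powR (b + m%:R) c)%:E)%E.

Definition gamma_exp_coef (lam be : R) (m : nat) : R := Gamma (lam + m%:R) * be ^+ m / m`!%:R.

Lemma Gamma_addn_gt0 (b : R) m : 0 < b -> 0 < Gamma (b + m%:R).
Proof. by move=> b0; apply: Gamma_gt0; rewrite ltr_wpDr. Qed.

Lemma gamma_exp_coef_ge0 lam be m : 0 < lam -> 0 <= be -> 0 <= gamma_exp_coef lam be m.
Proof.
move=> l0 b0; rewrite mulr_ge0 ?invr_ge0// mulr_ge0 ?exprn_ge0//.
by rewrite ltW// Gamma_addn_gt0.
Qed.

Lemma gamma_series_term_ge0 b y c m : 0 < b -> (forall i, 0 <= y i) ->
  0 <= y m / Gamma (b + m%:R) * pos_powR (b + m%:R) c.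
Proof.
by move=> b0 y0; rewrite mulr_ge0 ?pos_powR_ge0// divr_ge0// ltW// Gamma_addn_gt0.
Qed.

Lemma pos_powRDn (b : R) m c : pos_powR (b + m%:R) c = pos_powR b c * c ^+ m.
Proof.
case: (ltP 0 c) => c0; last by rewrite !pos_powR_le0E// mul0r.
rewrite !pos_powR_gt0E// addrAC [c `^ (b - 1 + m%:R)]powRD; last by rewrite (gt_eqF c0) implybT.
by rewrite powR_mulrn// ltW.
Qed.

Lemma gamma_series_exp lam be t : 0 < lam -> 0 <= be ->
  gamma_series lam (gamma_exp_coef lam be) t = (pos_powR lam t * expR (be * t))%:E.
Proof.
move=> l0 b0; rewrite /gamma_series.
case: (ltP 0 t) => t0; last first.
  by rewrite eseries0 ?pos_powR_le0E ?mul0r// => i _ _; rewrite pos_powR_le0E// mulr0.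
rewrite EFinM expR_eseries ?mulr_ge0 ?(ltW t0)// -nneseriesZl; last first.
  by move=> i _; rewrite lee_fin divr_ge0// exprn_ge0// mulr_ge0// ltW.
apply: eq_eseriesr => m _; rewrite -EFinM; congr EFin.
rewrite pos_powRDn /gamma_exp_coef exprMn; field.
by rewrite (gt_eqF (Gamma_addn_gt0 _ l0)) gt_eqF// ltr0n fact_gt0.
Qed.

Lemma measurable_gamma_series b y c : 0 < b -> (forall i, 0 <= y i) ->
  measurable_fun setT (fun t => gamma_series b y (c - t)).
Proof.
move=> b0 y0; rewrite /gamma_series.
apply: (@ge0_emeasurable_sum _ (measurableTypeR R) R setT (fun m t => (y m / Gamma (b + m%:R) * pos_powR (b + m%:R) (c - t))%:E) xpredT).
  by move=> k x _ _; rewrite lee_fin gamma_series_term_ge0.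
move=> k _; apply/measurable_EFinP; apply: measurable_funM => //.
apply: (measurableT_comp (measurable_pos_powR _)).
exact: measurable_funB.
Qed.

(** One step of Dirichlet's integral: expand both factors, integrate termwise by nonnegativity, and
    evaluate each term by Euler's integral, whose Gamma factors cancel the normalization. *)
Lemma gamma_series_conv lam be b y c : 0 < lam -> 0 <= be -> 0 < b -> (forall i, 0 <= y i) -> 0 < c ->
  (\int[mu]_t ((pos_powR lam t * expR (be * t))%:E * gamma_series b y (c - t)) =
   gamma_series (lam + b) (cauchy_prod (gamma_exp_coef lam be) y) c)%E.
Proof.
move=> l0 be0 b0 y0 c0.
have mp d t0 : measurable_fun setT (fun t => pos_powR d (t0 - t)).
  by apply: (measurableT_comp (measurable_pos_powR _)); exact: measurable_funB.
have mg : measurable_fun setT (fun t => pos_powR lam t * expR (be * t)).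
  apply: measurable_funM; first exact: measurable_pos_powR.
  by apply: (measurableT_comp (@measurable_expR R)); apply: measurable_funM.
have g0 t : 0 <= pos_powR lam t * expR (be * t) by rewrite mulr_ge0 ?pos_powR_ge0 ?expR_ge0.
have x0 := fun m => gamma_exp_coef_ge0 m l0 be0.
under eq_integral => t _.
  rewrite /gamma_series -nneseriesZl; last by move=> i _; rewrite lee_fin gamma_series_term_ge0.
  over.
rewrite integral_nneseries//; last 2 first.
- move=> n; apply/measurable_EFinP; apply: measurable_funM => //.
  by apply: measurable_funM => //; exact: mp.
- by move=> n x _; rewrite -EFinM lee_fin mulr_ge0// gamma_series_term_ge0.
pose T j i := (gamma_exp_coef lam be i * y j / Gamma (lam + b + (i + j)%:R) * pos_powR (lam + b + (i + j)%:R) c)%:E.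
transitivity (\sum_(j <oo) \sum_(i <oo) T j i)%E.
  apply: eq_eseriesr => j _.
  under eq_integral => t _.
    rewrite -gamma_series_exp// muleC /gamma_series -nneseriesZl; last by move=> i _; rewrite lee_fin gamma_series_term_ge0.
    over.
  rewrite integral_nneseries//; last 2 first.
  - move=> n; apply/measurable_EFinP; apply: measurable_funM; apply: measurable_funM => //.
      exact: mp.
    exact: measurable_pos_powR.
  - by move=> n x _; rewrite -EFinM lee_fin mulr_ge0// gamma_series_term_ge0.
  apply: eq_eseriesr => i _.
  set A := gamma_exp_coef _ _ _; set GA := Gamma _; set GB := Gamma _.
  transitivity (\int[mu]_t ((y j / GB * (A / GA))%:E * (pos_powR (lam + i%:R) t * pos_powR (b + j%:R) (c - t))%:E))%E.
    by apply: eq_integral => t _; rewrite -!EFinM; congr EFin; ring.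
  have GA0 : 0 < GA by rewrite Gamma_addn_gt0.
  have GB0 : 0 < GB by rewrite Gamma_addn_gt0.
  rewrite ge0_integralZl_EFin//; last 3 first.
  - by move=> x _; rewrite lee_fin mulr_ge0 ?pos_powR_ge0.
  - by apply/measurable_EFinP; exact: measurable_pow_conv_fun.
  - by apply: mulr_ge0; apply: divr_ge0; rewrite ?(ltW GA0) ?(ltW GB0)//; exact: x0.
  rewrite -/(pow_conv (lam + i%:R) (b + j%:R) c) pow_convE//.
  rewrite pow_conv_Gamma ?ltr_wpDr// -!EFinM /T; congr EFin.
  rewrite -/GA -/GB -/A (_ : lam + i%:R + (b + j%:R) = lam + b + (i + j)%:R); last by rewrite natrD; ring.
  rewrite pos_powR_gt0E//; field.
  by rewrite !gt_eqF// Gamma_addn_gt0// addr_gt0.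
rewrite nneseries_diag; last first.
  move=> i j; rewrite lee_fin; apply: mulr_ge0; last exact: pos_powR_ge0.
  apply: divr_ge0; first by apply: mulr_ge0; [exact: x0|exact: y0].
  by apply/ltW/Gamma_addn_gt0; exact: addr_gt0.
apply: eq_eseriesr => m _; rewrite sumEFin; congr EFin.
rewrite /cauchy_prod (reindex_inj rev_ord_inj)/= mulr_suml mulr_suml; apply: eq_bigr => i _.
have im : (i <= m)%N by rewrite -ltnS.
by rewrite subSS subKn// subnKC.
Qed.

End GammaSeries.

Section SimplexIntegral.
Variable R : realType.
Notation mu := (@lebesgue_measure R).
Implicit Types (a b c lam be t : R) (x y : nat -> R) (m : nat) (bs : seq R).

Lemma eq_simplex_int n c (F G : seq R -> \bar R) :
  (forall s, size s = n -> all (fun t => 0 < t) s -> \sum_(t <- s) t < c -> F s = G s) ->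
  0 < c -> simplex_int n c F = simplex_int n c G.
Proof.
elim: n c F G => [|n IH] c F G FG c0 /=; first by apply: FG => //; rewrite big_nil.
apply: eq_integral => t; rewrite inE/= in_itv/= => /andP[t0 tc].
apply: IH; last by rewrite subr_gt0.
move=> s sn s0 sc; apply: FG => /=; first by rewrite sn.
  by rewrite t0.
by rewrite big_cons -ltrBrDl.
Qed.

(** [b0] belongs to the dependent coordinate, namely what remains of [c] once the list is
    exhausted. *)
Fixpoint simplex_prod lam b0 bs c (s : seq R) : R :=
  match bs, s with
  | b :: bs', t :: s' => pos_powR lam t * expR (b * t) * simplex_prod lam b0 bs' (c - t) s'
  | _, _ => pos_powR lam c * expR (b0 * c)
  end.

Definition simplex_coef lam b0 bs : nat -> R := foldr (fun b y => cauchy_prod (gamma_exp_coef lam b) y) (gamma_exp_coef lam b0) bs.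

Lemma simplex_coef_ge0 lam b0 bs m : 0 < lam -> 0 <= b0 -> all (fun b => 0 <= b) bs -> 0 <= simplex_coef lam b0 bs m.
Proof.
move=> l0 b00; elim: bs m => [|b bs IH] m /=; first by move=> _; exact: gamma_exp_coef_ge0.
by move=> /andP[bb /IH h]; apply: cauchy_prod_ge0 => // i; exact: gamma_exp_coef_ge0.
Qed.

Lemma gamma_series_ge0 b y c : 0 < b -> (forall i, 0 <= y i) -> (0 <= gamma_series b y c)%E.
Proof. by move=> b0 y0; apply: nneseries_ge0 => i _ _; rewrite lee_fin gamma_series_term_ge0. Qed.

(** Two products are integrated together because the integrand of the theorem is a sum of two
    exponentials; the weights [z], [z'] collect the factors of the variables already fixed, so that
    the induction closes. *)
Lemma simplex_int_prod lam b0 b0' bs bs' c (z z' : R) :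
  0 < lam -> 0 <= b0 -> 0 <= b0' -> all (fun b => 0 <= b) bs -> all (fun b => 0 <= b) bs' ->
  size bs = size bs' -> 0 < c -> 0 <= z -> 0 <= z' ->
  (simplex_int (size bs) c (fun s => (z * simplex_prod lam b0 bs c s + z' * simplex_prod lam b0' bs' c s)%:E) =
   z%:E * gamma_series ((size bs).+1%:R * lam) (simplex_coef lam b0 bs) c
   + z'%:E * gamma_series ((size bs).+1%:R * lam) (simplex_coef lam b0' bs') c)%E.
Proof.
move=> l0 b00 b0'0.
elim: bs bs' c z z' => [|b bs IH] [|b' bs']//= c z z'.
  by move=> _ _ _ c0 z0 z'0; rewrite mul1r !gamma_series_exp// -!EFinM -EFinD.
move=> /andP[bp bsp] /andP[b'p bs'p] [ss] c0 z0 z'0.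
have sl : 0 < (size bs).+1%:R * lam by rewrite mulr_gt0.
have h0 m := @simplex_coef_ge0 lam b0 bs m l0 b00 bsp.
have h0' m := @simplex_coef_ge0 lam b0' bs' m l0 b0'0 bs'p.
pose g t := pos_powR lam t * expR (b * t); pose g' t := pos_powR lam t * expR (b' * t).
have g0 t : 0 <= g t by rewrite mulr_ge0 ?pos_powR_ge0 ?expR_ge0.
have g0' t : 0 <= g' t by rewrite mulr_ge0 ?pos_powR_ge0 ?expR_ge0.
pose S := gamma_series ((size bs).+1%:R * lam) (simplex_coef lam b0 bs).
pose S' := gamma_series ((size bs).+1%:R * lam) (simplex_coef lam b0' bs').
have S0 t : (0 <= S t)%E by exact: gamma_series_ge0.
have S0' t : (0 <= S' t)%E by exact: gamma_series_ge0.
have mS : measurable_fun setT (fun t => S (c - t)%R) by exact: measurable_gamma_series.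
have mS' : measurable_fun setT (fun t => S' (c - t)%R) by exact: measurable_gamma_series.
have mg (d : R) : measurable_fun setT (fun t => pos_powR lam t * expR (d * t)).
  apply: measurable_funM; first exact: measurable_pos_powR.
  by apply: (measurableT_comp (@measurable_expR R)); apply: measurable_funM.
have mgS : measurable_fun setT (fun t => (g t)%:E * S (c - t)%R)%E.
  by apply: emeasurable_funM => //; apply/measurable_EFinP; exact: mg.
have mgS' : measurable_fun setT (fun t => (g' t)%:E * S' (c - t)%R)%E.
  by apply: emeasurable_funM => //; apply/measurable_EFinP; exact: mg.
have Sle (d t : R) (y : nat -> R) : t <= 0 -> gamma_series d y t = 0%E.
  by move=> t0; rewrite /gamma_series eseries0// => i _ _; rewrite pos_powR_le0E// mulr0.
transitivity (\int[mu]_(t in `]0%R, c[) (z%:E * ((g t)%:E * S (c - t)%R) + z'%:E * ((g' t)%:E * S' (c - t)%R)))%E.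
  apply: eq_integral => t; rewrite inE/= in_itv/= => /andP[t0 tc].
  have ct : 0 < c - t by rewrite subr_gt0.
  rewrite (eq_simplex_int (G := fun s => (z * g t * simplex_prod lam b0 bs (c - t) s +
    z' * g' t * simplex_prod lam b0' bs' (c - t) s)%:E))//; last by move=> s _ _ _; rewrite !mulrA.
  rewrite (IH bs' (c - t) (z * g t) (z' * g' t) bsp bs'p ss ct (mulr_ge0 z0 (g0 t)) (mulr_ge0 z'0 (g0' t))).
  by rewrite !EFinM !muleA.
transitivity (\int[mu]_t (z%:E * ((g t)%:E * S (c - t)%R) + z'%:E * ((g' t)%:E * S' (c - t)%R)))%E.
  rewrite integral_mkcond; apply: eq_integral => t _.
  rewrite patchE mem_setE in_itv/=; case: ifPn => //.
  rewrite negb_and -!leNgt => /orP[t0|tc].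
    by rewrite /g /g' pos_powR_le0E// !mul0r !mul0e !mule0 adde0.
  by rewrite /S /S' !Sle ?subr_le0// !mule0 adde0.
have gS0 t : (0 <= (g t)%:E * S (c - t)%R)%E by apply: mule_ge0; rewrite ?lee_fin.
have gS0' t : (0 <= (g' t)%:E * S' (c - t)%R)%E by apply: mule_ge0; rewrite ?lee_fin.
rewrite ge0_integralD//; last 4 first.
- by move=> t _; apply: mule_ge0.
- exact: measurable_funeM.
- by move=> t _; apply: mule_ge0.
- exact: measurable_funeM.
rewrite !ge0_integralZl_EFin//.
rewrite /g /g' /S /S' !gamma_series_conv//.
by rewrite (_ : lam + _ = (size bs).+2%:R * lam)// -[(size bs).+2%:R]nat1r mulrDl mul1r.
Qed.

End SimplexIntegral.

(** * Formal negative powers *)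

Section FormalPowerSeries.

(** A record, since the bare function type would carry pointwise operations. *)
Record fps (A : Type) := Fps { fcoef : nat -> A }.

Variable A : comNzRingType.
Implicit Types f g h : fps A.

HB.instance Definition _ := gen_eqMixin (fps A).
HB.instance Definition _ := gen_choiceMixin (fps A).

Lemma fpsP f g : fcoef f =1 fcoef g -> f = g.
Proof. by case: f g => f [g] /= /funext ->. Qed.

Definition fps0 : fps A := Fps (fun=> 0).
Definition fps1 : fps A := Fps (fun m => (m == 0)%:R).
Definition fps_add f g : fps A := Fps (fun m => fcoef f m + fcoef g m).
Definition fps_opp f : fps A := Fps (fun m => - fcoef f m).
Definition fps_mul f g : fps A := Fps (fun m => \sum_(i < m.+1) fcoef f i * fcoef g (m - i)%N).

Lemma fps_addA : associative fps_add.
Proof. by move=> f g h; apply: fpsP => m /=; rewrite addrA. Qed.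
Lemma fps_addC : commutative fps_add.
Proof. by move=> f g; apply: fpsP => m /=; rewrite addrC. Qed.
Lemma fps_add0 : left_id fps0 fps_add.
Proof. by move=> f; apply: fpsP => m /=; rewrite add0r. Qed.
Lemma fps_addN : left_inverse fps0 fps_opp fps_add.
Proof. by move=> f; apply: fpsP => m /=; rewrite addNr. Qed.

HB.instance Definition _ := GRing.isZmodule.Build (fps A) fps_addA fps_addC fps_add0 fps_addN.

Let tr n f : {poly A} := \poly_(i < n.+1) fcoef f i.

(** A coefficient of a product sees only truncations, so associativity and commutativity are
    inherited from polynomials. *)
Lemma fps_mul_poly f g n m : (m <= n)%N -> fcoef (fps_mul f g) m = (tr n f * tr n g)`_m.
Proof.
move=> mn; rewrite coefM /=; apply: eq_bigr => i _; rewrite !coef_poly.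
by rewrite !ltnS (leq_trans _ mn) 1?(leq_trans (leq_subr _ _) mn)// -ltnS.
Qed.

Lemma fps_mulA : associative fps_mul.
Proof.
move=> f g h; apply: fpsP => m.
have -> : fcoef (fps_mul f (fps_mul g h)) m = (tr m f * (tr m g * tr m h))`_m.
  rewrite coefM /=; apply: eq_bigr => i _; rewrite coef_poly ltn_ord.
  by rewrite -(fps_mul_poly _ _ (leq_subr _ _)).
rewrite mulrA coefM /=; apply: eq_bigr => i _.
by rewrite coef_poly ltnS leq_subr -(@fps_mul_poly f g m i)// -ltnS.
Qed.

Lemma fps_mulC : commutative fps_mul.
Proof. by move=> f g; apply: fpsP => m; rewrite !(fps_mul_poly _ _ (leqnn m)) mulrC. Qed.

Lemma fps_mul1 : left_id fps1 fps_mul.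
Proof.
move=> f; apply: fpsP => m /=; rewrite big_ord_recl/= mul1r subn0 big1 ?addr0//.
by move=> i _; rewrite mul0r.
Qed.

Lemma fps_mulDl : left_distributive fps_mul fps_add.
Proof.
by move=> f g h; apply: fpsP => m /=; rewrite -big_split; apply: eq_bigr => i _; rewrite mulrDl.
Qed.

Lemma fps_1neq0 : fps1 != 0.
Proof. by apply/eqP => /(congr1 (fun f => fcoef f 0)) /= /eqP; rewrite oner_eq0. Qed.

HB.instance Definition _ := GRing.Zmodule_isComNzRing.Build (fps A)
  fps_mulA fps_mulC fps_mul1 fps_mulDl fps_1neq0.

Lemma fcoefD f g m : fcoef (f + g) m = fcoef f m + fcoef g m. Proof. by []. Qed.
Lemma fcoefN f m : fcoef (- f) m = - fcoef f m. Proof. by []. Qed.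
Lemma fcoefB f g m : fcoef (f - g) m = fcoef f m - fcoef g m. Proof. by []. Qed.
Lemma fcoefM f g m : fcoef (f * g) m = \sum_(i < m.+1) fcoef f i * fcoef g (m - i)%N.
Proof. by []. Qed.
Lemma fcoef0 m : fcoef (0 : fps A) m = 0. Proof. by []. Qed.
Lemma fcoef1 m : fcoef (1 : fps A) m = (m == 0)%:R. Proof. by []. Qed.
Lemma fcoef_sum I (r : seq I) (P : pred I) (F : I -> fps A) m :
  fcoef (\sum_(i <- r | P i) F i) m = \sum_(i <- r | P i) fcoef (F i) m.
Proof. by elim/big_rec2: _ => // i x y _ <-. Qed.

Definition fpsC (a : A) : fps A := Fps (fun m => a *+ (m == 0)).
Lemma fcoefC a m : fcoef (fpsC a) m = a *+ (m == 0). Proof. by []. Qed.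

Lemma fcoefCM a f m : fcoef (fpsC a * f) m = a * fcoef f m.
Proof.
rewrite fcoefM big_ord_recl/= mulr1n subn0 big1 ?addr0// => i _.
by rewrite mulr0n mul0r.
Qed.

(** The Euler derivation s d/ds, which shifts no index. *)
Definition theta f : fps A := Fps (fun m => m%:R * fcoef f m).
Lemma fcoef_theta f m : fcoef (theta f) m = m%:R * fcoef f m. Proof. by []. Qed.

Lemma thetaD f g : theta (f + g) = theta f + theta g.
Proof. by apply: fpsP => m; rewrite !(fcoefD, fcoef_theta) mulrDr. Qed.
Lemma thetaN f : theta (- f) = - theta f.
Proof. by apply: fpsP => m; rewrite !(fcoefN, fcoef_theta) mulrN. Qed.
Lemma thetaC a : theta (fpsC a) = 0.
Proof. by apply: fpsP => -[|m]; rewrite fcoef_theta fcoefC ?mul0r// mulr0n mulr0. Qed.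
Lemma theta1 : theta 1 = 0.
Proof. by apply: fpsP => -[|m]; rewrite fcoef_theta fcoef1 ?mul0r// mulr0. Qed.
Lemma thetaM f g : theta (f * g) = theta f * g + f * theta g.
Proof.
apply: fpsP => m; rewrite fcoef_theta fcoefD !fcoefM mulr_sumr -big_split/=.
apply: eq_bigr => i _; rewrite natrB; last by rewrite -ltnS.
by ring.
Qed.

Lemma fps_cancel f g : fcoef f 0 = 1 -> f * g = 0 -> g = 0.
Proof.
move=> f1 fg; apply: fpsP => m; rewrite fcoef0.
elim/ltn_ind: m => m IH.
have := congr1 (fun x => fcoef x m) fg; rewrite fcoef0 fcoefM big_ord_recl/= subn0 f1 mul1r.
rewrite big1 ?addr0// => i _; rewrite IH ?mulr0// /bump/= add1n.
by case: m i {IH} => [[]//|m i]; rewrite subSS ltnS leq_subr.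
Qed.

Lemma fps_inj f g h : fcoef f 0 = 1 -> f * g = f * h -> g = h.
Proof.
move=> f1 e; apply/eqP; rewrite -subr_eq0; apply/eqP; apply: (fps_cancel f1).
by rewrite mulrBr e subrr.
Qed.

(** Course-of-values recursion: the list stores all earlier coefficients, from which [G] computes
    the next. *)
Fixpoint course_rec_seq (G : nat -> (nat -> A) -> A) n : seq A :=
  if n is n'.+1 then rcons (course_rec_seq G n') (G n' (nth 0 (course_rec_seq G n'))) else [::].

Definition course_rec (G : nat -> (nat -> A) -> A) m : A := G m (nth 0 (course_rec_seq G m)).

Lemma course_recE G : (forall m x y, (forall i, (i < m)%N -> x i = y i) -> G m x = G m y) ->
  forall m, course_rec G m = G m (course_rec G).
Proof.
move=> even_coef m; rewrite {1}/course_rec; apply: even_coef => i.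
have sz n : size (course_rec_seq G n) = n by elim: n => //= n IH; rewrite size_rcons IH.
elim: m => // m IH; rewrite ltnS leq_eqVlt => /predU1P[->|im] /=.
  by rewrite nth_rcons sz ltnn eqxx.
by rewrite nth_rcons sz im IH.
Qed.

End FormalPowerSeries.

Section NegativePower.
Variable A : idomainType.
Hypothesis char0 : forall m, (m.+1%:R : A) != 0.

(* [pow_ode Y l F] says that [F] is, up to a constant, the formal power [Y ^ (- l)]. *)
Definition pow_ode (Y : fps A) (l : A) (F : fps A) : Prop :=
  Y * theta F + fpsC l * theta Y * F = 0.

(** In degree m + 1 the equation reads (m + 1) F_(m+1) plus multiples of lower coefficients of F,
    and [char0] permits division. *)
Lemma pow_ode_unique Y l F : fcoef Y 0 = 1 -> fcoef F 0 = 0 -> pow_ode Y l F -> F = 0.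
Proof.
move=> Y1 F0 odeF; apply: fpsP => m; rewrite fcoef0.
elim/ltn_ind: m => -[//|m] IH.
have := congr1 (fun x => fcoef x m.+1) odeF; rewrite fcoef0 fcoefD.
have lt i : (bump 0 i <= m.+1)%N -> (m.+1 - bump 0 i < m.+1)%N.
  by move=> h; rewrite /bump add1n ltn_subrL.
rewrite fcoefM big_ord_recl/= subn0 Y1 mul1r big1 ?addr0; last first.
  by move=> i _; rewrite IH ?mulr0// lt// /bump/= add1n ltn_ord.
rewrite big_ord_recl/= big_ord_recl/= big_ord0 mulr0n mulr1n addr0 mul0r mulr0.
rewrite mul0r add0r big1 ?addr0; last first.
  by move=> i _; rewrite IH ?mulr0// lt// /bump/= add1n ltn_ord.
by move/eqP; rewrite mulf_eq0 (negbTE (char0 m)) => /eqP.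
Qed.

Lemma pow_ode_eq Y l F G : fcoef Y 0 = 1 -> fcoef F 0 = fcoef G 0 ->
  pow_ode Y l F -> pow_ode Y l G -> F = G.
Proof.
move=> Y1 FG0 oF oG; apply/eqP; rewrite -subr_eq0; apply/eqP.
apply: (pow_ode_unique Y1 (l := l)); first by rewrite fcoefB FG0 subrr.
rewrite /pow_ode thetaD thetaN.
transitivity ((Y * theta F + fpsC l * theta Y * F) - (Y * theta G + fpsC l * theta Y * G)).
  by ring.
by rewrite oF oG subrr.
Qed.

Lemma pow_ode1 l : pow_ode 1 l 1.
Proof. by rewrite /pow_ode !theta1 mulr0 mulr0 mul0r addr0. Qed.

(** Additivity of logarithmic derivatives, cleared of denominators. *)
Lemma pow_odeM Y Z l F G : pow_ode Y l F -> pow_ode Z l G -> pow_ode (Y * Z) l (F * G).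
Proof.
rewrite /pow_ode => oF oG; rewrite !thetaM.
transitivity ((Y * theta F + fpsC l * theta Y * F) * (Z * G)
   + (Z * theta G + fpsC l * theta Z * G) * (Y * F)); first by ring.
by rewrite oF oG !mul0r addr0.
Qed.

Lemma pow_ode_prod (I : Type) (r : seq I) (Y F : I -> fps A) l :
  (forall i, pow_ode (Y i) l (F i)) ->
  pow_ode (\prod_(i <- r) Y i) l (\prod_(i <- r) F i).
Proof.
move=> o; elim: r => [|i r IH]; first by rewrite !big_nil; exact: pow_ode1.
by rewrite !big_cons; exact: pow_odeM.
Qed.

Lemma fcoef0_prod (I : Type) (r : seq I) (F : I -> fps A) :
  (forall i, fcoef (F i) 0 = 1) -> fcoef (\prod_(i <- r) F i) 0 = 1.
Proof.
move=> F1; elim: r => [|i r IH]; first by rewrite big_nil.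
by rewrite big_cons fcoefM big_ord_recl big_ord0 addr0 F1 IH mulr1.
Qed.

Lemma fps_div (Y F : fps A) : fcoef Y 0 = 1 -> exists G, Y * G = F.
Proof.
move=> Y1; pose G := course_rec (fun m x => fcoef F m - \sum_(i < m) fcoef Y i.+1 * x (m - i.+1)%N).
exists (Fps G); apply: fpsP => m.
rewrite fcoefM big_ord_recl/= subn0 Y1 mul1r /G course_recE; first by rewrite subrK.
move=> {m} m x y xy; congr (_ - _); apply: eq_bigr => i _; rewrite xy//.
by rewrite ltn_subrL/= (leq_trans _ (ltn_ord i)).
Qed.

End NegativePower.

Section BinomialSeries.
Variables (R : realType) (lam kap : R) (k : nat) (U : nat -> R).
Hypotheses (U0 : U 0%N = 1) (k0 : (0 < k)%N).

Definition node_V (i : nat) : R := if i == k then kap else 0.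
Definition Yser : fps {poly R} := Fps (fun i => (U i)%:P - node_V i *: 'X).

(* [Fps neg_pow_poly] is [(U - V 'X) ^ (- lam)] with [V = kap s ^ k], as a series in [s]. *)
Definition neg_pow_poly : nat -> {poly R} :=
  course_rec (fun m x => if m is 0 then 1 else
   - m%:R^-1 *: \sum_(i < m) (((m - i.+1)%:R + lam * i.+1%:R) *: (fcoef Yser i.+1 * x (m - i.+1)%N))).

Lemma neg_pow_polyE m : neg_pow_poly m = if m is 0 then 1 else
   - m%:R^-1 *: \sum_(i < m) (((m - i.+1)%:R + lam * i.+1%:R) *: (fcoef Yser i.+1 * neg_pow_poly (m - i.+1)%N)).
Proof.
rewrite {1}/neg_pow_poly course_recE// => -[//|{}m] x y xy; congr (_ *: _); apply: eq_bigr => i _.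
by rewrite xy// ltn_subrL.
Qed.

Lemma neg_pow_poly0 : neg_pow_poly 0 = 1. Proof. by rewrite neg_pow_polyE. Qed.

Definition neg_pow : fps {poly R} := Fps neg_pow_poly.

Lemma Yser0 : fcoef Yser 0 = 1.
Proof. by rewrite /= U0 /node_V ltn_eqF// scale0r subr0. Qed.

Lemma polyR_char0 m : (m.+1%:R : {poly R}) != 0.
Proof. by rewrite -polyC_natr polyC_eq0 pnatr_eq0. Qed.

Lemma neg_pow_ode : pow_ode Yser lam%:P neg_pow.
Proof.
apply: fpsP => m; rewrite fcoef0 fcoefD.
rewrite -mulrA fcoefCM !fcoefM.
case: m => [|m].
  by rewrite !big_ord_recl !big_ord0/= !(mul0r, mulr0, addr0).
rewrite big_ord_recl/= subn0 [X in X * _]Yser0 mul1r [X in _ + _ * X]big_ord_recl/= !mul0r add0r.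
have -> : m.+1%:R * neg_pow_poly m.+1 = - \sum_(i < m.+1)
    (((m - i)%:R + lam * i.+1%:R) *: (fcoef Yser i.+1 * neg_pow_poly (m - i)%N)).
  rewrite neg_pow_polyE scaleNr mulrN; congr (- _).
  rewrite -polyC_natr -mul_polyC mulrA -polyCM divff ?pnatr_eq0// mul1r.
  by apply: eq_bigr => i _; rewrite subSS.
rewrite mulr_sumr -addrA -big_split/= addrC; apply/eqP; rewrite subr_eq0; apply/eqP.
apply: eq_bigr => i _; rewrite /bump/= add1n subSS.
rewrite -[(_ + _ * _) *: _]mul_polyC polyCD polyCM !polyC_natr; ring.
Qed.

(** The power with exponent - lam - 1, obtained by division so that its relation to [neg_pow] holds
    by construction. *)
Definition neg_pow_succ : fps {poly R} := projT1 (cid (fps_div neg_pow Yser0)).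

Lemma neg_pow_succE : Yser * neg_pow_succ = neg_pow.
Proof. by rewrite /neg_pow_succ; case: cid. Qed.

Definition fps_polyC (u : nat -> R) : fps {poly R} := Fps (fun i => (u i)%:P).
Definition Vser := fps_polyC node_V.
Definition neg_pow_deriv : fps {poly R} := Fps (fun m => (neg_pow_poly m)^`()).

Lemma YserE : Yser = fps_polyC U - Vser * fpsC 'X.
Proof. by apply: fpsP => m; rewrite fcoefB mulrC fcoefCM /= mulrC mul_polyC. Qed.

Lemma theta_Vser : theta Vser = fpsC k%:R * Vser.
Proof.
apply: fpsP => m; rewrite fcoef_theta fcoefCM /= /node_V.
by case: eqP => [->//|_]; rewrite polyC0 !mulr0.
Qed.

(** V is homogeneous of degree [k] in s, hence killed by k - theta. *)
Lemma theta_Yser : fpsC k%:R * Yser - theta Yser = fpsC k%:R * fps_polyC U - theta (fps_polyC U).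
Proof.
rewrite YserE thetaD thetaN thetaM thetaC mulr0 addr0 theta_Vser; ring.
Qed.

(* Both sides solve the equation obtained from [neg_pow_ode] by differentiation in ['X]. *)
Lemma neg_pow_derivE : neg_pow_deriv = fpsC lam%:P * Vser * neg_pow_succ.
Proof.
have dM (f g : fps {poly R}) : Fps (fun m => (fcoef (f * g) m)^`()) =
    Fps (fun m => (fcoef f m)^`()) * g + f * Fps (fun m => (fcoef g m)^`()).
  apply: fpsP => m; rewrite fcoefD !fcoefM/= linear_sum -big_split/=.
  by apply: eq_bigr => i _; rewrite derivM.
have dtheta (f : fps {poly R}) : Fps (fun m => (fcoef (theta f) m)^`()) =
    theta (Fps (fun m => (fcoef f m)^`())).
  by apply: fpsP => m; rewrite /= -polyC_natr derivM derivC mul0r add0r.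
have dC (a : R) : Fps (fun m => (fcoef (fpsC a%:P) m)^`()) = 0.
  by apply: fpsP => -[|m]; rewrite /= ?mulr1n ?mulr0n ?derivC ?deriv0.
have dY : Fps (fun m => (fcoef Yser m)^`()) = - Vser.
  apply: fpsP => m; rewrite /= derivB derivC derivZ derivX sub0r.
  by rewrite -mul_polyC mulr1.
have ode := neg_pow_ode.
have e : Yser * theta neg_pow_deriv + fpsC lam%:P * theta Yser * neg_pow_deriv =
   Vser * theta neg_pow + fpsC lam%:P * theta Vser * neg_pow.
  have : Fps (fun m => (fcoef (Yser * theta neg_pow + fpsC lam%:P * theta Yser * neg_pow) m)^`()) = 0.
    by rewrite ode; apply: fpsP => m /=; rewrite deriv0.
  rewrite (_ : Fps _ = Fps (fun m => (fcoef (Yser * theta neg_pow) m)^`()) +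
      Fps (fun m => (fcoef (fpsC lam%:P * theta Yser * neg_pow) m)^`())); last first.
    by apply: fpsP => m; rewrite /= derivD.
  rewrite !dM !dtheta dC dY -/neg_pow_deriv thetaN mul0r add0r => /eqP H.
  apply/eqP; rewrite -subr_eq0 -(eqP H); apply/eqP; ring.
set X := fpsC lam%:P * Vser * neg_pow_succ.
apply/eqP; rewrite -subr_eq0; apply/eqP; apply: (pow_ode_unique polyR_char0 Yser0 (l := lam%:P)).
  have X0 : fcoef X 0 = 0.
    rewrite /X -mulrA fcoefCM fcoefM big_ord_recl big_ord0 [fcoef Vser _]/= /node_V ltn_eqF//.
    by rewrite polyC0 mul0r addr0 mulr0.
  by rewrite fcoefB (_ : fcoef neg_pow_deriv 0 = (neg_pow_poly 0)^`())// neg_pow_poly0 derivC X0 subr0.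
have YX : Yser * X = fpsC lam%:P * Vser * neg_pow by rewrite /X -neg_pow_succE; ring.
have tX : theta Yser * X + Yser * theta X = fpsC lam%:P * (theta Vser * neg_pow + Vser * theta neg_pow).
  by rewrite -thetaM YX !thetaM thetaC; ring.
apply: (fps_cancel Yser0); rewrite /pow_ode thetaD thetaN.
transitivity (Yser * ((Yser * theta neg_pow_deriv + fpsC lam%:P * theta Yser * neg_pow_deriv) - (theta Yser * X + Yser * theta X))
  + (1 - fpsC lam%:P) * theta Yser * (Yser * X)); first by ring.
rewrite e tX YX.
transitivity ((1 - fpsC lam%:P) * Vser * (Yser * theta neg_pow + fpsC lam%:P * theta Yser * neg_pow)); last first.
  by rewrite ode mulr0.
by rewrite theta_Vser; ring.
Qed.

(** After multiplication by [Yser], the differential equation replaces [theta neg_pow] and leaves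
    lam (k Y - theta Y) times [neg_pow], free of V by [theta_Yser]. *)
Lemma theta_neg_pow : theta neg_pow + fpsC (k%:R * lam)%:P * neg_pow =
  fpsC lam%:P * (fpsC k%:R * fps_polyC U - theta (fps_polyC U)) * neg_pow_succ.
Proof.
apply: (fps_inj Yser0); rewrite -theta_Yser.
have CM : fpsC (k%:R * lam)%:P = fpsC k%:R * fpsC lam%:P :> fps {poly R}.
  by apply: fpsP => m; rewrite fcoefCM /= polyCM polyC_natr mulrnAr.
rewrite CM.
transitivity ((Yser * theta neg_pow + fpsC lam%:P * theta Yser * neg_pow) +
  fpsC lam%:P * (fpsC k%:R * Yser - theta Yser) * neg_pow); first by ring.
by rewrite neg_pow_ode -neg_pow_succE; ring.
Qed.

End BinomialSeries.

Section CoefPairing.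
Variable R : realType.

Lemma coef_pairing_is_linear (m : nat -> R) : linear_for *%R (coef_pairing m).
Proof.
move=> c p q; pose n := maxn (size p) (size q).
have hp : (size p <= n)%N by rewrite leq_maxl.
have hq : (size q <= n)%N by rewrite leq_maxr.
have hpq : (size (c *: p + q)%R <= n)%N.
  rewrite (leq_trans (size_polyD _ _))// geq_max hq andbT.
  by rewrite (leq_trans (size_scale_leq _ _)).
rewrite !(coef_pairingE _ (n := n))// mulr_sumr -big_split/=; apply: eq_bigr => i _.
by rewrite coefD coefZ; ring.
Qed.

HB.instance Definition _ m :=
  GRing.isLinear.Build R {poly R} R *%R (coef_pairing m) (coef_pairing_is_linear m).

Lemma coef_pairingXn (m : nat -> R) n : coef_pairing m 'X^n = m n.
Proof.
rewrite (coef_pairingE _ (n := n.+1)) ?size_polyXn// big_ord_recr/= coefXn eqxx mul1r.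
by rewrite big1 ?add0r// => i _; rewrite coefXn ltn_eqF ?mul0r.
Qed.

Lemma polyXn_ind (p : {poly R}) : p = \sum_(i < size p) p`_i *: 'X^i.
Proof. by rewrite -{1}(coefK p) poly_def. Qed.

End CoefPairing.

(** * Averages against the two measures *)

Section DoubleMoment.
Variables (R : realType) (al be : R).
Hypotheses (al0 : 0 < al) (be0 : 0 < be).

(* [double_moment S C i p q] is the integral of [p(u) q(v) (S u + C v)^i] against the two measures. *)
Fixpoint double_moment (S C : R) (i : nat) (p q : {poly R}) : R :=
  if i is i'.+1 then S * double_moment S C i' (p * 'X) q + C * double_moment S C i' p (q * 'X)
  else nu_mom al p * nu_mom be q.

Lemma double_moment_linearl S C i q : linear_for *%R (fun p => double_moment S C i p q).
Proof.
move=> c p p'; elim: i p p' q => [|i IH] p p' q /=; first by rewrite linearP mulrDl mulrA.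
by rewrite mulrDl -scalerAl !IH; ring.
Qed.

Lemma double_moment_linearr S C i p : linear_for *%R (double_moment S C i p).
Proof.
move=> c q q'; elim: i p q q' => [|i IH] p q q' /=; first by rewrite linearP/=; ring.
by rewrite mulrDl -scalerAl !IH; ring.
Qed.

Lemma double_momentDl S C i p p' q : double_moment S C i (p + p') q = double_moment S C i p q + double_moment S C i p' q.
Proof. by have := double_moment_linearl S C i q 1 p p'; rewrite scale1r mul1r. Qed.
Lemma double_momentDr S C i p q q' : double_moment S C i p (q + q') = double_moment S C i p q + double_moment S C i p q'.
Proof. by have := double_moment_linearr S C i p 1 q q'; rewrite scale1r mul1r. Qed.
Lemma double_moment0l S C i q : double_moment S C i 0 q = 0.
Proof. by apply: (@addrI _ (double_moment S C i 0 q)); rewrite -double_momentDl !addr0. Qed.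
Lemma double_moment0r S C i p : double_moment S C i p 0 = 0.
Proof. by apply: (@addrI _ (double_moment S C i p 0)); rewrite -double_momentDr !addr0. Qed.
Lemma double_momentZl S C i c p q : double_moment S C i (c *: p) q = c * double_moment S C i p q.
Proof. by have := double_moment_linearl S C i q c p 0; rewrite double_moment0l !addr0. Qed.
Lemma double_momentZr S C i c p q : double_moment S C i p (c *: q) = c * double_moment S C i p q.
Proof. by have := double_moment_linearr S C i p c q 0; rewrite double_moment0r !addr0. Qed.
Lemma double_momentNl S C i p q : double_moment S C i (- p) q = - double_moment S C i p q.
Proof. by rewrite -scaleN1r double_momentZl mulN1r. Qed.
Lemma double_momentNr S C i p q : double_moment S C i p (- q) = - double_moment S C i p q.
Proof. by rewrite -scaleN1r double_momentZr mulN1r. Qed.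

Lemma double_moment_negl S C i p q : double_moment (- S) C i p q = double_moment S C i (p \Po (- 'X)) q.
Proof.
elim: i p q => [|i IH] p q /=; first by rewrite nu_mom_compN.
by rewrite !IH comp_polyM comp_polyX mulrN double_momentNl mulrNN.
Qed.

Lemma double_moment_negr S C i p q : double_moment S (- C) i p q = double_moment S C i p (q \Po (- 'X)).
Proof.
elim: i p q => [|i IH] p q /=; first by rewrite nu_mom_compN.
by rewrite !IH comp_polyM comp_polyX mulrN double_momentNr mulrNN.
Qed.

(** Parts in u. The last term comes from differentiating (S u + C v)^i; for [i = 0] its coefficient
    vanishes, so the value of [i.-1] is immaterial. *)
Lemma double_moment_ibpl S C i p q : 2 * al * double_moment S C i ('X * p) q =
  double_moment S C i ((1 - 'X^2) * p^`()) q + S * i%:R * double_moment S C i.-1 ((1 - 'X^2) * p) q.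
Proof.
elim: i p q => [|i IH] p q /=.
  by rewrite mulr0 mul0r addr0 mulrA -nu_mom_ibp// linearZ.
rewrite mulrDr !(mulrCA (2 * al)) -mulrA !IH derivM derivX mulr1 !mulrDr !double_momentDl.
rewrite -[i.+1%:R]nat1r.
case: i {IH} => [|i] /=; rewrite ?mulr0 ?mul0r ?mulrA; ring.
Qed.

Lemma double_moment_ibpr S C i p q : 2 * be * double_moment S C i p ('X * q) =
  double_moment S C i p ((1 - 'X^2) * q^`()) + C * i%:R * double_moment S C i.-1 p ((1 - 'X^2) * q).
Proof.
elim: i p q => [|i IH] p q /=.
  by rewrite mulr0 mul0r addr0 mulrCA -mulrCA [in RHS]mulrC -nu_mom_ibp// linearZ/=; ring.
rewrite mulrDr !(mulrCA (2 * be)) -[X in C * (_ * double_moment _ _ _ _ X)]mulrA !IH derivM derivX mulr1 !mulrDr !double_momentDr.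
rewrite -[i.+1%:R]nat1r.
case: i {IH} => [|i] /=; rewrite ?mulr0 ?mul0r ?mulrA; ring.
Qed.

(** The integral of p(u) q(v) h(S u + C v) against the two measures. *)
Definition double_nu S C p q (h : {poly R}) : R := coef_pairing (fun i => double_moment S C i p q) h.

Lemma double_nuDh S C p q h h' : double_nu S C p q (h + h') = double_nu S C p q h + double_nu S C p q h'.
Proof. exact: raddfD. Qed.
Lemma double_nuNh S C p q h : double_nu S C p q (- h) = - double_nu S C p q h.
Proof. exact: raddfN. Qed.
Lemma double_nuZh S C p q c h : double_nu S C p q (c *: h) = c * double_nu S C p q h.
Proof. exact: linearZ. Qed.
Lemma double_nu_sumh S C p q I (r : seq I) P F :
  double_nu S C p q (\sum_(i <- r | P i) F i) = \sum_(i <- r | P i) double_nu S C p q (F i).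
Proof. exact: raddf_sum. Qed.

Lemma double_nuDl S C p p' q h : double_nu S C (p + p') q h = double_nu S C p q h + double_nu S C p' q h.
Proof.
by rewrite /double_nu /coef_pairing -big_split; apply: eq_bigr => i _; rewrite double_momentDl mulrDr.
Qed.
Lemma double_nuDr S C p q q' h : double_nu S C p (q + q') h = double_nu S C p q h + double_nu S C p q' h.
Proof.
by rewrite /double_nu /coef_pairing -big_split; apply: eq_bigr => i _; rewrite double_momentDr mulrDr.
Qed.
Lemma double_nuNl S C p q h : double_nu S C (- p) q h = - double_nu S C p q h.
Proof.
by rewrite /double_nu /coef_pairing -sumrN; apply: eq_bigr => i _; rewrite double_momentNl mulrN.
Qed.
Lemma double_nuNr S C p q h : double_nu S C p (- q) h = - double_nu S C p q h.
Proof.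
by rewrite /double_nu /coef_pairing -sumrN; apply: eq_bigr => i _; rewrite double_momentNr mulrN.
Qed.
Lemma double_nu_negl S C p q h : double_nu (- S) C p q h = double_nu S C (p \Po (- 'X)) q h.
Proof. by apply: eq_bigr => i _; rewrite double_moment_negl. Qed.
Lemma double_nu_negr S C p q h : double_nu S (- C) p q h = double_nu S C p (q \Po (- 'X)) h.
Proof. by apply: eq_bigr => i _; rewrite double_moment_negr. Qed.

Lemma double_nuXh S C p q h : double_nu S C p q ('X * h) = S * double_nu S C (p * 'X) q h + C * double_nu S C p (q * 'X) h.
Proof.
rewrite (polyXn_ind h) mulr_sumr !double_nu_sumh !mulr_sumr -big_split/=.
by apply: eq_bigr => i _; rewrite -scalerAr !double_nuZh -exprS /double_nu !coef_pairingXn/=; ring.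
Qed.

Lemma double_nu_ibpl S C q h : 2 * al * double_nu S C 'X q h = S * double_nu S C (1 - 'X^2) q h^`().
Proof.
rewrite (polyXn_ind h) linear_sum/= !double_nu_sumh !mulr_sumr; apply: eq_bigr => i _.
rewrite derivZ derivXn -[_ *+ i]scaler_nat !double_nuZh /double_nu !coef_pairingXn.
have := double_moment_ibpl S C i 1 q; rewrite !mulr1 derivC mulr0 double_moment0l add0r => e.
by transitivity (h`_i * (2 * al * double_moment S C i 'X q)); [ring|rewrite e; ring].
Qed.

Lemma double_nu_ibpr S C p h : 2 * be * double_nu S C p 'X h = C * double_nu S C p (1 - 'X^2) h^`().
Proof.
rewrite (polyXn_ind h) linear_sum/= !double_nu_sumh !mulr_sumr; apply: eq_bigr => i _.
rewrite derivZ derivXn -[_ *+ i]scaler_nat !double_nuZh /double_nu !coef_pairingXn.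
have := double_moment_ibpr S C i p 1; rewrite !mulr1 derivC mulr0 double_moment0r add0r => e.
by transitivity (h`_i * (2 * be * double_moment S C i p 'X)); [ring|rewrite e; ring].
Qed.

Variables (k : nat) (kap : R) (U : nat -> R).
Hypotheses (U0 : U 0%N = 1) (k0 : (0 < k)%N).
Let lam := al + be.
Let h := neg_pow_poly lam kap k U.
Let Vk := node_V kap k.

(** Up to normalization, [even_coef] is to be the sum of the kernel coefficients over the rotations
    by 2 pi j / k, and [refl_coef] their weighted sum over the reflections: those with j even change
    the sign of S, those with j odd that of C. *)
Definition even_coef S C m : R := double_nu S C (1 + 'X) (1 + 'X) (h m).
Definition refl_coef S C m : R :=
  al * double_nu S C (1 - 'X) (1 + 'X) (h m) + be * double_nu S C (1 + 'X) (1 - 'X) (h m).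

Lemma refl_coefE S C m : refl_coef S C m = al * even_coef (- S) C m + be * even_coef S (- C) m.
Proof.
by rewrite /refl_coef /even_coef double_nu_negl double_nu_negr !comp_polyD comp_polyX -!polyC1 !comp_polyC.
Qed.

Let Ps := neg_pow_succ lam kap U0 k0.
Let psi S C m : R := double_nu S C (1 + 'X) (1 + 'X) (fcoef Ps m).

(** By parts, the left side is the average of lam h - (S (1 - u) + C (1 - v)) dh against (1 + u)(1 +
    v), with dh the derivative of h. In generating functions h = (U - V xi) Ps and dh = lam V Ps;
    the variable xi = S u + C v cancels and leaves U - V (S + C). *)
Lemma refl_coef_series S C m :
  refl_coef S C m = \sum_(i < m.+1) lam * (U i - Vk i * (S + C)) * psi S C (m - i)%N.
Proof.
have E1 q : al * double_nu S C (1 - 'X) q (h m) =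
    al * double_nu S C (1 + 'X) q (h m) - S * double_nu S C (1 - 'X^2) q (h m)^`().
  rewrite -double_nu_ibpl (_ : 1 - 'X = 1 + 'X - 'X - 'X); last by ring.
  by rewrite !double_nuDl double_nuNl; ring.
have E2 p : be * double_nu S C p (1 - 'X) (h m) =
    be * double_nu S C p (1 + 'X) (h m) - C * double_nu S C p (1 - 'X^2) (h m)^`().
  rewrite -double_nu_ibpr (_ : 1 - 'X = 1 + 'X - 'X - 'X); last by ring.
  by rewrite !double_nuDr double_nuNr; ring.
have hE : h m = \sum_(i < m.+1) ((U i)%:P - Vk i *: 'X) * fcoef Ps (m - i)%N.
  by rewrite /h (_ : neg_pow_poly lam kap k U m = fcoef (neg_pow lam kap k U) m)// -(neg_pow_succE lam kap U0 k0).
have dE : (h m)^`() = \sum_(i < m.+1) (lam * Vk i) *: fcoef Ps (m - i)%N.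
  rewrite /h (_ : (neg_pow_poly lam kap k U m)^`() = fcoef (neg_pow_deriv lam kap k U) m)// (neg_pow_derivE lam kap U0 k0).
  rewrite -mulrA fcoefCM fcoefM mulr_sumr; apply: eq_bigr => i _ /=.
  by rewrite mulrA -polyCM mul_polyC.
have w2 : 1 - 'X^2 = (1 + 'X) - (1 + 'X) * 'X :> {poly R} by ring.
rewrite /refl_coef E1 E2 dE hE w2 !double_nu_sumh !mulr_sumr -!sumrN -!big_split/=.
rewrite /lam; apply: eq_bigr => i _; rewrite !double_nuZh mulrBl !double_nuDh !double_nuNh.
rewrite mul_polyC double_nuZh -scalerAl double_nuZh double_nuXh /psi !double_nuDl !double_nuDr !double_nuNl !double_nuNr.
by ring.
Qed.

Definition flin (b : R) : fps R := Fps (fun i => if i == 0%N then 1 else if i == 1%N then - b else 0).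
Definition fgeom (b : R) : fps R := Fps (fun i => b ^+ i).

Lemma fcoef_flinM b (f : fps R) m :
  fcoef (flin b * f) m = fcoef f m - (if m is m'.+1 then b * fcoef f m' else 0).
Proof.
rewrite fcoefM big_ord_recl/= mul1r subn0; congr (_ + _).
case: m => [|m]; first by rewrite big_ord0 oppr0.
rewrite big_ord_recl/= subSS subn0 big1 ?addr0 ?mulNr//.
by move=> i _; rewrite mul0r.
Qed.

Lemma flin_geom b : flin b * fgeom b = 1.
Proof.
apply: fpsP => -[|m]; rewrite fcoef_flinM fcoef1 /=; first by rewrite expr0 subr0.
by rewrite exprS subrr.
Qed.

Lemma theta_flin b : flin b - theta (flin b) = 1.
Proof.
apply: fpsP => m; rewrite fcoefB fcoef_theta fcoef1 /=.
by case: m => [|[|m]] /=; rewrite ?mul0r ?mul1r ?mulr0 ?subr0 ?subrr.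
Qed.

(** Each factor L = 1 - b s satisfies L - theta L = 1, so 1 / L is 1 minus the logarithmic
    derivative of L. *)
Lemma sum_geom_prod (bs : seq R) :
  (\sum_(b <- bs) fgeom b) * (\prod_(b <- bs) flin b) =
  fpsC (size bs)%:R * (\prod_(b <- bs) flin b) - theta (\prod_(b <- bs) flin b).
Proof.
elim: bs => [|b bs IH]; first by rewrite !big_nil theta1 mul0r (_ : fpsC _ = 0) ?mul0r ?subr0//; apply: fpsP => i; rewrite /= mul0rn.
rewrite !big_cons thetaM/=.
have -> : fpsC (size bs).+1%:R = 1 + fpsC (size bs)%:R :> fps R.
  by apply: fpsP => i; rewrite fcoefD fcoef1 /= -nat1r mulrnDl.
transitivity ((flin b * fgeom b) * (\prod_(b <- bs) flin b) +
  flin b * ((\sum_(b <- bs) fgeom b) * (\prod_(b <- bs) flin b))); first by ring.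
rewrite flin_geom IH -{1}(theta_flin b); ring.
Qed.

(* In generating functions: [refl_coef] is [lam P psi] with [P = \prod_b (1 - b s)],
   [\sum_b P / (1 - b s) = k P - theta P], and the same combination of [Yser] does not involve [V]. *)
Lemma sum_geom_refl_coef S C (bs : seq R) m : size bs = k ->
  \prod_(b <- bs) flin b = Fps (fun i => U i - Vk i * (S + C)) ->
  \sum_(b <- bs) \sum_(i < m.+1) b ^+ i * refl_coef S C (m - i)%N = (m%:R + k%:R * lam) * even_coef S C m.
Proof.
move=> sb prodE; set P : fps R := Fps _ in prodE.
pose psis : fps R := Fps (psi S C); pose Us : fps R := Fps U.
have NE : Fps (refl_coef S C) = fpsC lam * P * psis.
  apply: fpsP => i; rewrite -mulrA fcoefCM fcoefM/= refl_coef_series mulr_sumr.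
  by apply: eq_bigr => j _; rewrite mulrA.
have PU : fpsC k%:R * P - theta P = fpsC k%:R * Us - theta Us.
  apply: fpsP => i; rewrite !(fcoefB, fcoefCM, fcoef_theta)/= /Vk /node_V.
  by case: eqP => [->|_]; ring.
have GE : theta (Fps (even_coef S C)) + fpsC (k%:R * lam) * Fps (even_coef S C) =
    fpsC lam * (fpsC k%:R * Us - theta Us) * psis.
  apply: fpsP => i; rewrite fcoefD fcoefCM fcoef_theta -mulrA fcoefCM fcoefM -mulrDl [fcoef (Fps _) _]/= /even_coef -double_nuZh.
  have -> : (i%:R + k%:R * lam) *: h i = \sum_(j < i.+1) (lam * (k%:R * U j - j%:R * U j)) *: fcoef Ps (i - j)%N.
    have := congr1 (fun x => fcoef x i) (theta_neg_pow lam kap U0 k0).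
    rewrite fcoefD fcoef_theta fcoefCM -[fpsC _ * _ * neg_pow_succ _ _ _ _]mulrA fcoefCM fcoefM -/Ps => e.
    rewrite -mul_polyC polyCD mulrDl polyC_natr [LHS]e mulr_sumr; apply: eq_bigr => j _.
    rewrite -[RHS]mul_polyC fcoefB fcoefCM fcoef_theta/= mulrA; congr (_ * _).
    by rewrite -!polyC_natr -!polyCM -polyCB -polyCM.
  rewrite double_nu_sumh mulr_sumr; apply: eq_bigr => j _.
  by rewrite double_nuZh fcoefB fcoefCM fcoef_theta/= -/(psi S C (i - j)%N); ring.
have ZE := sum_geom_prod bs; rewrite sb prodE PU in ZE.
transitivity (fcoef ((\sum_(b <- bs) fgeom b) * Fps (refl_coef S C)) m).
  by rewrite mulr_suml fcoef_sum; apply: eq_bigr => b _; rewrite fcoefM.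
transitivity (fcoef (theta (Fps (even_coef S C)) + fpsC (k%:R * lam) * Fps (even_coef S C)) m); last first.
  by rewrite fcoefD fcoefCM fcoef_theta/=; ring.
congr (fcoef _ m); rewrite GE NE -ZE; ring.
Qed.

End DoubleMoment.

(** * Binomial series and evaluation of the negative powers *)

Section Poch.
Variable R : realType.
Implicit Types (a b lam : R) (bs : seq R).

Definition poch a m : R := \prod_(i < m) (a + i%:R).

Lemma pochS a m : poch a m.+1 = (a + m%:R) * poch a m.
Proof. by rewrite /poch big_ord_recr/= mulrC. Qed.

Lemma poch0 a : poch a 0 = 1. Proof. by rewrite /poch big_ord0. Qed.

Lemma poch_gt0 a m : 0 < a -> 0 < poch a m.
Proof. by move=> a0; apply: prodr_gt0 => i _; rewrite ltr_wpDr. Qed.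

Lemma Gamma_poch a m : 0 < a -> Gamma (a + m%:R) = poch a m * Gamma a.
Proof.
move=> a0; elim: m => [|m IH]; first by rewrite addr0 poch0 mul1r.
rewrite -[m.+1%:R]natr1 addrA GammaS; last by rewrite ltr_wpDr.
by rewrite IH pochS mulrA.
Qed.

Definition neg_pow_series lam b : fps R := Fps (fun m => poch lam m / m`!%:R * b ^+ m).

Lemma neg_pow_series_ode lam b : pow_ode (flin b) lam (neg_pow_series lam b).
Proof.
apply: fpsP => m; rewrite fcoefD fcoef0 fcoef_flinM.
have -> : fpsC lam * theta (flin b) * neg_pow_series lam b =
    fpsC lam * (flin b * neg_pow_series lam b - neg_pow_series lam b).
  have -> : theta (flin b) = flin b - 1 by rewrite -{1}(theta_flin b); ring.
  by ring.
rewrite fcoefCM fcoefB fcoef_flinM !fcoef_theta.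
case: m => [|m]; first by rewrite /=; ring.
rewrite /= pochS factS exprS natrM.
have f0 : (m`!%:R : R) != 0 by rewrite pnatr_eq0 -lt0n fact_gt0.
rewrite -[m.+1%:R]natr1; field.
by rewrite f0 natr1 pnatr_eq0.
Qed.

(** Evaluation at [xi] respects products and [theta], so both sides solve the equation for the power
    - lam of the same product, with constant term 1. *)
Lemma neg_pow_poly_eval lam kap k (U : nat -> R) bs (xi : R) m :
  U 0%N = 1 -> (0 < k)%N ->
  \prod_(b <- bs) flin b = Fps (fun i => U i - node_V kap k i * xi) ->
  (neg_pow_poly lam kap k U m).[xi] = fcoef (\prod_(b <- bs) neg_pow_series lam b) m.
Proof.
move=> U0 k0 prodE.
have c0 i : (i.+1%:R : R) != 0 by rewrite pnatr_eq0.
pose ev (f : fps {poly R}) : fps R := Fps (fun m => (fcoef f m).[xi]).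
have evD f g : ev (f + g) = ev f + ev g by apply: fpsP => i; rewrite fcoefD /= hornerD.
have evM f g : ev (f * g) = ev f * ev g.
  apply: fpsP => i; rewrite fcoefM /= horner_sum; apply: eq_bigr => j _.
  by rewrite hornerM.
have evT f : ev (theta f) = theta (ev f).
  by apply: fpsP => i; rewrite /= -polyC_natr hornerM hornerC.
have evC (a : R) : ev (fpsC a%:P) = fpsC a.
  by apply: fpsP => -[|i]; rewrite /= ?mulr1n ?mulr0n hornerC.
suff -> : \prod_(b <- bs) neg_pow_series lam b = ev (neg_pow lam kap k U) by [].
apply: (pow_ode_eq c0 (Y := \prod_(b <- bs) flin b) (l := lam)).
- by apply: fcoef0_prod.
- rewrite fcoef0_prod; last by move=> b; rewrite /= poch0 fact0 divr1 expr0 mulr1.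
  by rewrite (_ : fcoef (ev _) 0 = (neg_pow_poly lam kap k U 0).[xi])// neg_pow_poly0 hornerC.
- by apply: pow_ode_prod => b; exact: neg_pow_series_ode.
- have := congr1 ev (neg_pow_ode lam kap U0 k0); rewrite evD !evM !evT evC.
  have -> : ev (Yser kap k U) = \prod_(b <- bs) flin b.
    rewrite prodE; apply: fpsP => i.
    by rewrite /= hornerD hornerN hornerC hornerZ hornerX.
  by move=> e; rewrite /pow_ode e; apply: fpsP => i; rewrite /= horner0.
Qed.

Lemma gamma_exp_coefE lam b m : 0 < lam -> gamma_exp_coef lam b m = Gamma lam * fcoef (neg_pow_series lam b) m.
Proof. by move=> l0; rewrite /gamma_exp_coef Gamma_poch//=; ring. Qed.

Lemma simplex_coefE lam b0 bs m : 0 < lam ->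
  simplex_coef lam b0 bs m = Gamma lam ^+ (size bs).+1 * fcoef (\prod_(b <- b0 :: bs) neg_pow_series lam b) m.
Proof.
move=> l0; rewrite big_cons [neg_pow_series lam b0 * _]mulrC.
elim: bs m => [|b bs IH] m; first by rewrite big_nil mul1r expr1 /= gamma_exp_coefE.
rewrite big_cons -[neg_pow_series lam b * _ * _]mulrA fcoefM mulr_sumr.
rewrite (_ : simplex_coef lam b0 (b :: bs) m = cauchy_prod (gamma_exp_coef lam b) (simplex_coef lam b0 bs) m)// /cauchy_prod.
apply: eq_bigr => i _.
by rewrite gamma_exp_coefE// IH [in RHS]exprS; ring.
Qed.

Lemma neg_pow_series_ge0 lam bs m : 0 < lam -> all (fun b => 0 <= b) bs ->
  0 <= fcoef (\prod_(b <- bs) neg_pow_series lam b) m.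
Proof.
move=> l0; elim: bs m => [|b bs IH] m /=; first by rewrite big_nil fcoef1.
move=> /andP[b0 bs0]; rewrite big_cons fcoefM sumr_ge0// => i _.
by rewrite mulr_ge0 ?IH//= mulr_ge0 ?exprn_ge0// divr_ge0// ltW// poch_gt0.
Qed.

Lemma neg_pow_seriesZ lam c bs m :
  fcoef (\prod_(b <- [seq c * x | x <- bs]) neg_pow_series lam b) m = c ^+ m * fcoef (\prod_(b <- bs) neg_pow_series lam b) m.
Proof.
rewrite big_map; elim: bs m => [|b bs IH] m.
  by rewrite !big_nil fcoef1; case: m => [|m]; rewrite /= ?expr0 ?mulr1 ?mulr0.
rewrite !big_cons !fcoefM mulr_sumr; apply: eq_bigr => i _.
rewrite IH /= exprMn; have im : (i <= m)%N by rewrite -ltnS.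
by rewrite (_ : c ^+ m = c ^+ i * c ^+ (m - i)); [ring|rewrite -exprD subnKC].
Qed.

End Poch.

(** * Chebyshev factorization *)

Section Chebyshev.
Variable R : realType.

Fixpoint cheb2 (n : nat) : {poly R} * {poly R} :=
  if n is n'.+1 then let: (p, q) := cheb2 n' in (q, 2 *: ('X * q) - p) else (1, 'X).
Definition cheb n := (cheb2 n).1.

Lemma cheb2E n : cheb2 n = (cheb n, cheb n.+1).
Proof. by rewrite /cheb /=; case: (cheb2 n). Qed.

Lemma chebSS n : cheb n.+2 = 2 *: ('X * cheb n.+1) - cheb n.
Proof. by rewrite {1}/cheb /=; rewrite cheb2E. Qed.

Lemma cheb_cos n x : (cheb n).[cos x] = cos (n%:R * x).
Proof.
suff : (cheb n).[cos x] = cos (n%:R * x) /\ (cheb n.+1).[cos x] = cos (n.+1%:R * x) by case.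
elim: n => [|n [IH1 IH2]]; first by rewrite /cheb /= hornerC hornerX mul0r cos0 mul1r.
split=> //; rewrite chebSS hornerD hornerN hornerZ hornerM hornerX IH1 IH2.
rewrite (_ : n.+2%:R * x = n.+1%:R * x + x); last by rewrite -[n.+2%:R]natr1; ring.
rewrite (_ : n%:R * x = n.+1%:R * x - x); last by rewrite -[n.+1%:R]natr1; ring.
by rewrite cosB cosD; ring.
Qed.

Lemma size_cheb n : size (cheb n.+1) = n.+2 /\ lead_coef (cheb n.+1) = 2 ^+ n.
Proof.
suff : [/\ size (cheb n.+1) = n.+2, lead_coef (cheb n.+1) = 2 ^+ n & (size (cheb n) <= n.+1)%N] by case.
elim: n => [|n [s l sn]].
  by rewrite /cheb /= size_polyX lead_coefX size_poly1 expr0.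
have s2 : size (2 *: ('X * cheb n.+1)) = n.+3.
  by rewrite size_scale ?pnatr_eq0// mulrC size_mulX ?s// -size_poly_gt0 s.
split; last by rewrite s.
  by rewrite chebSS size_polyDl ?s2// size_polyN (leq_ltn_trans sn).
rewrite chebSS lead_coefDl ?size_polyN ?s2 ?(leq_ltn_trans sn)//.
by rewrite lead_coefZ lead_coefM lead_coefX mul1r l exprS.
Qed.

Lemma sin_natmul n (x : R) : sin x = 0 -> sin (n%:R * x) = 0.
Proof.
move=> sx; elim: n => [|n IH]; first by rewrite mul0r sin0.
by rewrite -natr1 mulrDl mul1r sinD IH sx mul0r mulr0 addr0.
Qed.

Lemma sin_natpi n : sin (n%:R * pi) = 0 :> R.
Proof. by apply: sin_natmul; exact: sinpi. Qed.

Lemma cos_nat2pi n (x : R) : cos (x + n%:R * (2 * pi)) = cos x.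
Proof.
elim: n => [|n IH]; first by rewrite mul0r addr0.
rewrite -[n.+1%:R]natr1 mulrDl mul1r addrA -[in RHS]IH (_ : 2 * pi = pi *+ 2); [exact: cosD2pi|by rewrite mulr_natl].
Qed.

Definition node (k : nat) (th : R) (j : nat) : R := th + 2 * pi * j%:R / k%:R.

Lemma cos_k_node k th j : (0 < k)%N -> cos (k%:R * node k th j) = cos (k%:R * th).
Proof.
move=> k0; have kn : (k%:R : R) != 0 by rewrite pnatr_eq0 -lt0n.
rewrite /node (_ : k%:R * _ = k%:R * th + j%:R * (2 * pi)); last by field.
exact: cos_nat2pi.
Qed.

(** The condition on the sine makes the [k] cosines distinct; they are then all the roots, and
    2^(k-1) is the leading coefficient. *)
Lemma cheb_factor k th : (0 < k)%N -> sin (k%:R * th) != 0 ->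
  cheb k - (cos (k%:R * th))%:P = 2 ^+ k.-1 *: \prod_(j < k) ('X - (cos (node k th j))%:P).
Proof.
move=> k0 sth; have kn : (k%:R : R) != 0 by rewrite pnatr_eq0 -lt0n.
pose rs := [seq cos (node k th j) | j <- iota 0 k].
have [szc lc] := size_cheb k.-1; rewrite prednK// in szc lc.
have sz1 : (size (- (cos (k%:R * th))%:P : {poly R}) < size (cheb k))%N.
  by rewrite size_polyN szc (leq_ltn_trans (size_polyC_leq1 _)).
have szp : size (cheb k - (cos (k%:R * th))%:P) = k.+1 by rewrite size_polyDl// szc.
have := @all_roots_prod_XsubC R (cheb k - (cos (k%:R * th))%:P) rs.
rewrite szp size_map size_iota lead_coefDl// lc => -> //.
- congr (_ *: _); rewrite big_map -[in RHS](big_mkord xpredT (fun j => 'X - (cos (node k th j))%:P)).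
  by rewrite /index_iota subn0.
- apply/allP => _ /mapP[j _ ->]; rewrite /root hornerD hornerN hornerC cheb_cos.
  by rewrite cos_k_node// subrr.
rewrite uniq_rootsE map_inj_in_uniq ?iota_uniq// => i j.
rewrite !mem_iota !add0n /= => ik jk e.
wlog ij : i j ik jk e / (i <= j)%N.
  by move=> H; case: (leqP i j) => [|/ltnW] h; [exact: H|apply/esym; exact: H].
apply/eqP; rewrite eqn_leq ij leqNgt; apply/negP => lt_ij.
have : sin ((node k th j + node k th i) / 2) * sin ((node k th j - node k th i) / 2) = 0.
  set A := (_ + _) / 2; set B := (_ - _) / 2.
  have : cos (A + B) - cos (A - B) = 0.
    rewrite (_ : A + B = node k th j); last by rewrite /A /B; field.
    rewrite (_ : A - B = node k th i); last by rewrite /A /B; field.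
    by rewrite e subrr.
  rewrite cosD cosB => H; have e2 : -2 * (sin A * sin B) = 0 by rewrite -H; ring.
  by move/eqP: e2; rewrite mulf_eq0 oppr_eq0 pnatr_eq0 => /eqP.
(* In the first case, [k] times the half-sum of the nodes is k th + (i + j) pi, against the
   hypothesis on [th]; in the second, the half-difference (j - i) pi / k lies strictly between 0 and
   pi. *)
move/eqP; rewrite mulf_eq0 => /orP[/eqP/(sin_natmul k)|/eqP sB].
  rewrite (_ : k%:R * _ = k%:R * th + (i + j)%:R * pi); last by rewrite /node natrD; field.
  rewrite sinD sin_natpi mulr0 addr0 => /eqP; rewrite mulf_eq0 (negbTE sth)/= => /eqP c0.
  have := cos2Dsin2 ((i + j)%:R * pi : R).
  by rewrite c0 sin_natpi expr0n/= addr0 => /eqP; rewrite eq_sym oner_eq0.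
have : 0 < sin ((node k th j - node k th i) / 2).
  rewrite (_ : _ / 2 = (j - i)%:R / k%:R * pi); last by rewrite /node natrB//; field.
  apply: sin_gt0_pi; rewrite mulr_gt0 ?pi_gt0 ?divr_gt0 ?ltr0n ?subn_gt0//=.
  rewrite gtr_pMl ?pi_gt0// ltr_pdivrMr ?ltr0n// mul1r ltr_nat.
  by rewrite (leq_ltn_trans (leq_subr _ _)).
by rewrite sB ltxx.
Qed.

(** Zeros of sin (n th) are isolated: just to the right of one of them f vanishes, and so does its
    limit. *)
Lemma sin_dense (n : nat) (f : R -> R) : (0 < n)%N -> continuous f ->
  (forall th, sin (n%:R * th) != 0 -> f th = 0) -> forall th, f th = 0.
Proof.
move=> n0 cf f0 th; have [/eqP s0|/f0//] := boolP (sin (n%:R * th) == 0).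
have n0' : 0 < n%:R :> R by rewrite ltr0n.
have h1 : f x @[x --> th^'+] --> f th by apply: cvg_at_right_filter; exact: cf.
have h2 : f x @[x --> th^'+] --> (0 : R).
  apply: cvg_near_cst.
  near=> x; apply: f0.
  have tx : 0 < n%:R * (x - th) < pi.
    apply/andP; split.
      by rewrite mulr_gt0// subr_gt0; near: x; exact: nbhs_right_gt.
    rewrite mulrC -ltr_pdivlMr// ltrBlDl; near: x; apply: nbhs_right_lt.
    by rewrite ltrDl divr_gt0 ?pi_gt0.
  rewrite (_ : n%:R * x = n%:R * th + n%:R * (x - th)); last by ring.
  rewrite sinD s0 mul0r add0r mulf_neq0//; last by rewrite gt_eqF// sin_gt0_pi.
  apply/eqP => c0; have := cos2Dsin2 (n%:R * th); rewrite c0 s0 expr0n/= addr0.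
  by move/eqP; rewrite eq_sym oner_eq0.
by apply: (cvg_unique _ h1 h2).
Unshelve. all: by end_near. Qed.

End Chebyshev.

Section ChebyshevProduct.
Variable R : realType.

Lemma poly_fun_eq (p q : {poly R}) : (forall x, p.[x] = q.[x]) -> p = q.
Proof.
move=> pq; apply/eqP; rewrite -subr_eq0; apply/eqP.
apply: (@roots_geq_poly_eq0 _ _ [seq i%:R | i <- iota 0 (size (p - q))]).
- by apply/allP => _ /mapP[i _ ->]; rewrite /root hornerD hornerN pq subrr.
- by rewrite map_inj_uniq ?iota_uniq// => i j /eqP; rewrite eqr_nat => /eqP.
- by rewrite size_map size_iota.
Qed.

Definition node_values (k : nat) (th : R) : seq R := [seq 1 + cos (node k th j) | j <- iota 0 k].

Definition node_kappa (k : nat) : R := 2 ^- k.-1.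

Definition linprod (bs : seq R) : {poly R} := \prod_(b <- bs) (1 - b *: 'X).

(** U = product + V cos (k th) is the same for every angle and is read off at angle 0. *)
Definition node_U (k i : nat) : R := (linprod (node_values k 0))`_i + node_V (node_kappa k) k i.

Lemma horner_linprod bs x : (linprod bs).[x] = \prod_(b <- bs) (1 - b * x).
Proof.
rewrite /linprod horner_prod; apply: eq_bigr => b _.
by rewrite hornerD hornerN hornerC hornerZ hornerX.
Qed.

Lemma continuous_addR (f g : R -> R) : continuous f -> continuous g -> continuous (fun x => f x + g x).
Proof. by move=> cf cg x; apply: cvgD; [exact: cf|exact: cg]. Qed.
Lemma continuous_subR (f g : R -> R) : continuous f -> continuous g -> continuous (fun x => f x - g x).
Proof. by move=> cf cg x; apply: cvgB; [exact: cf|exact: cg]. Qed.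
Lemma continuous_mulR (f g : R -> R) : continuous f -> continuous g -> continuous (fun x => f x * g x).
Proof. by move=> cf cg x; apply: cvgM; [exact: cf|exact: cg]. Qed.
Lemma continuous_cstR (c : R) : continuous (fun _ : R => c).
Proof. exact: cst_continuous. Qed.

Lemma continuous_prod_seq (I : Type) (r : seq I) (F : I -> R -> R) :
  (forall i, continuous (F i)) -> continuous (fun x => \prod_(i <- r) F i x).
Proof.
move=> cF; elim: r => [|i r IH].
  by under eq_fun do rewrite big_nil; exact: continuous_cstR.
by under eq_fun do rewrite big_cons; exact: continuous_mulR.
Qed.

Lemma continuous_sum_seq (I : Type) (r : seq I) (F : I -> R -> R) :
  (forall i, continuous (F i)) -> continuous (fun x => \sum_(i <- r) F i x).
Proof.
move=> cF; elim: r => [|i r IH].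
  by under eq_fun do rewrite big_nil; exact: continuous_cstR.
by under eq_fun do rewrite big_cons; exact: continuous_addR.
Qed.

Lemma continuous_affine (a b : R) : continuous (fun x => a * x + b).
Proof. by apply: continuous_addR; [apply: continuous_mulR; [exact: continuous_cstR|move=> x; exact: cvg_id]|exact: continuous_cstR]. Qed.

Lemma continuous_cos_affine (a b : R) : continuous (fun x => cos (a * x + b)).
Proof.
move=> x; apply: (@continuous_comp _ _ _ (fun x => a * x + b) cos); last exact: continuous_cos.
exact: continuous_affine.
Qed.

Lemma continuous_sin_affine (a b : R) : continuous (fun x => sin (a * x + b)).
Proof.
move=> x; apply: (@continuous_comp _ _ _ (fun x => a * x + b) sin); last exact: continuous_sin.
exact: continuous_affine.
Qed.

(** Since 1 - s (1 + c) = s ((1 - s) / s - c), this is the factorization at (1 - s) / s;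
    [node_kappa] inverts the leading coefficient. Continuity in [th] covers multiple roots. *)
Lemma linprod_node k th s : (0 < k)%N -> s != 0 ->
  (linprod (node_values k th)).[s] = s ^+ k * node_kappa k * ((cheb R k).[(1 - s) / s] - cos (k%:R * th)).
Proof.
move=> k0 s0; apply/eqP; rewrite -subr_eq0; apply/eqP; move: th.
apply: (@sin_dense R k) => //.
  under eq_fun do rewrite horner_linprod big_map.
  apply: continuous_subR.
    apply: continuous_prod_seq => j.
    apply: continuous_subR; first exact: continuous_cstR.
    apply: continuous_mulR; last exact: continuous_cstR.
    apply: continuous_addR; first exact: continuous_cstR.
    under eq_fun do rewrite /node -[X in X + _]mul1r.
    exact: continuous_cos_affine.
  apply: continuous_mulR; first exact: continuous_cstR.
  apply: continuous_subR; first exact: continuous_cstR.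
  under eq_fun do rewrite -[_ * _]addr0.
  exact: continuous_cos_affine.
move=> th sth; apply/eqP; rewrite subr_eq0; apply/eqP.
have := congr1 (horner ^~ ((1 - s) / s)) (cheb_factor k0 sth).
rewrite /= hornerD hornerN hornerC hornerZ horner_prod => ->.
rewrite /node_kappa mulrA -[s ^+ k * _ * _]mulrA mulVf ?expf_neq0 ?pnatr_eq0// mulr1.
rewrite horner_linprod big_map.
rewrite -[in RHS](big_mkord xpredT (fun j => ('X - (cos (node k th j))%:P).[(1 - s) / s])).
rewrite /index_iota subn0.
have -> : s ^+ k = \prod_(j <- iota 0 k) s.
  by rewrite big_const_seq count_predT size_iota iter_mulr_1.
rewrite -big_split/=; apply: eq_bigr => j _.
by rewrite hornerD hornerN hornerX hornerC; field.
Qed.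

Lemma linprodE k th : (0 < k)%N ->
  linprod (node_values k th) = linprod (node_values k 0) + (node_kappa k * (1 - cos (k%:R * th))) *: 'X^k.
Proof.
move=> k0; apply: poly_fun_eq => s; rewrite hornerD hornerZ hornerXn.
have [->|s0] := eqVneq s 0.
  rewrite !horner_linprod expr0n gtn_eqF// mulr0 addr0.
  by rewrite !big1// => b _; rewrite mulr0 subr0.
by rewrite !linprod_node// mulr0 cos0; ring.
Qed.

Definition fps_of_poly (p : {poly R}) : fps R := Fps (fun i => p`_i).

Lemma fps_of_linprod bs : \prod_(b <- bs) flin b = fps_of_poly (linprod bs).
Proof.
elim: bs => [|b bs IH].
  by rewrite /linprod !big_nil; apply: fpsP => i; rewrite fcoef1 /= coef1.
rewrite /linprod !big_cons -/(linprod bs) IH; apply: fpsP => m.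
rewrite fcoef_flinM /= mulrBl mul1r coefB -scalerAl coefZ ['X * _]mulrC coefMX.
by case: m => [|m] /=; rewrite ?mulr0 ?subr0.
Qed.

Lemma prod_flin_node k th : (0 < k)%N ->
  \prod_(b <- node_values k th) flin b = Fps (fun i => node_U k i - node_V (node_kappa k) k i * cos (k%:R * th)).
Proof.
move=> k0; rewrite fps_of_linprod linprodE//; apply: fpsP => i /=.
rewrite coefD coefZ coefXn /node_U /node_V; case: eqP => _ /=; ring.
Qed.

Lemma node_U0 k : (0 < k)%N -> node_U k 0 = 1.
Proof.
move=> k0; have := congr1 (fun f => fcoef f 0) (prod_flin_node 0 k0) => /=.
rewrite fcoef0_prod//.
by rewrite /node_V ltn_eqF// mul0r subr0.
Qed.

Lemma node_values_ge0 k th : all (fun b => 0 <= b) (node_values k th).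
Proof. by apply/allP => _ /mapP[j _ ->]; rewrite -lerBlDl sub0r cos_geN1. Qed.

Lemma size_node_values k th : size (node_values k th) = k.
Proof. by rewrite size_map size_iota. Qed.

End ChebyshevProduct.

(** * The expansion of the Dunkl kernel *)

Section Candidate.
Variables (R : realType) (k : nat) (al be : R).
Hypotheses (k0 : (0 < k)%N) (al0 : 0 < al) (be0 : 0 < be).
Let lam := al + be.
Let gam := k%:R * lam.
Let kn : (k%:R : R) != 0. Proof. by rewrite pnatr_eq0 -lt0n. Qed.
Let lam0 : 0 < lam. Proof. exact: addr_gt0. Qed.
Let gam0 : 0 < gam. Proof. by rewrite mulr_gt0// ltr0n. Qed.

Definition bessel_poly := neg_pow_poly lam (node_kappa R k) k (@node_U R k).
Definition dih_even_coef := even_coef al be k (node_kappa R k) (@node_U R k).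
Definition dih_refl_coef := refl_coef al be k (node_kappa R k) (@node_U R k).

(** The solution of [kernel_coef_xSC_rec]: with the reflection sum prescribed as a source, each
    degree multiplies the previous one by 1 + x and divides by m + 1 + gam. *)
Definition kernel_coef_xSC m (x S C : R) : R :=
  k%:R * (\sum_(i < m.+1) (1 + x) ^+ i * dih_refl_coef S C (m - i)%N) / poch gam m.+1.

(* The Taylor coefficients of [e ^ (|x||y|) E(x, y)] in [|x||y|], at angles [psi] and [phi];
   the exponential factor turns [cos] into [1 + cos >= 0]. *)
Definition kernel_coef m (psi phi : R) : R :=
  kernel_coef_xSC m (cos (psi - phi)) (sin (k%:R * psi) * sin (k%:R * phi))
    (cos (k%:R * psi) * cos (k%:R * phi)).

Lemma kernel_coefC m psi phi : kernel_coef m psi phi = kernel_coef m phi psi.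
Proof.
rewrite /kernel_coef -cosN opprB; congr kernel_coef_xSC; exact: mulrC.
Qed.

Lemma kernel_coef_xSC_rec m x S C :
  (m.+1%:R + gam) * kernel_coef_xSC m.+1 x S C = k%:R * dih_refl_coef S C m.+1 / poch gam m.+1 + (1 + x) * kernel_coef_xSC m x S C.
Proof.
rewrite /kernel_coef_xSC big_ord_recl/= expr0 mul1r subn0.
under eq_bigr do rewrite /bump/= add1n subSS exprS -mulrA.
rewrite -mulr_sumr (pochS _ m.+1).
have p0 : poch gam m.+1 != 0 by rewrite gt_eqF// poch_gt0.
have g0 : gam + m.+1%:R != 0 by rewrite gt_eqF// ltr_wpDr.
by field; rewrite p0 nat1r.
Qed.

Lemma sin_k_node (th : R) j : sin (k%:R * node k th j) = sin (k%:R * th).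
Proof.
rewrite /node (_ : k%:R * _ = k%:R * th + j%:R * (2 * pi)); last by field.
rewrite -(cosBpihalf (k%:R * th)) -cosBpihalf -[RHS](@cos_nat2pi R j); congr cos; ring.
Qed.

(** Rotations by 2 pi / k fix S and C and move psi - phi through the nodes, so [sum_geom_refl_coef]
    applies with S + C = cos (k (psi - phi)); its factor m + gam removes the last factor of
    [poch]. *)
Lemma kernel_coef_sum m psi phi :
  \sum_(j < k) kernel_coef m (node k psi j) phi =
  k%:R * dih_even_coef (sin (k%:R * psi) * sin (k%:R * phi)) (cos (k%:R * psi) * cos (k%:R * phi)) m / poch gam m.
Proof.
set S := _ * sin _; set C := _ * cos _.
under eq_bigr => j _.
  rewrite /kernel_coef sin_k_node cos_k_node//.
  rewrite (_ : node k psi j - phi = node k (psi - phi) j); last by rewrite /node; ring.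
  over.
rewrite -/S -/C /kernel_coef_xSC -mulr_suml -mulr_sumr.
have SC : S + C = cos (k%:R * (psi - phi)).
  by rewrite mulrBr cosB addrC.
have pE := prod_flin_node (psi - phi) k0; rewrite -SC in pE.
have := @sum_geom_refl_coef R al be al0 be0 k (node_kappa R k) (@node_U R k) (node_U0 R k0) k0 S C _ m (size_node_values k (psi - phi)) pE.
rewrite big_map -/lam -/gam => e.
have {e} -> : \sum_(j < k) \sum_(i < m.+1) (1 + cos (node k (psi - phi) j)) ^+ i * dih_refl_coef S C (m - i)%N =
    (m%:R + gam) * dih_even_coef S C m.
  rewrite -[RHS]e -(big_mkord xpredT (fun j => \sum_(i < m.+1) (1 + cos (node k (psi - phi) j)) ^+ i * dih_refl_coef S C (m - i)%N)).
  by rewrite /index_iota subn0.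
rewrite pochS; have p0 : poch gam m != 0 by rewrite gt_eqF// poch_gt0.
have g0 : gam + m%:R != 0 by rewrite gt_eqF// ltr_wpDr.
by field; rewrite p0.
Qed.

Lemma big_ord_double (F : nat -> R) n :
  \sum_(j < 2 * n) F j = \sum_(j < n) (F (2 * j)%N + F (2 * j).+1).
Proof.
elim: n => [|n IH]; first by rewrite muln0 !big_ord0.
rewrite mulnS add2n !big_ord_recr/= IH -addrA; congr (_ + (_ + _)).
Qed.

Let refl_even (psi : R) (j : nat) : (2 * j)%N%:R * pi / k%:R - psi = node k (- psi) j.
Proof. by rewrite /node natrM; ring. Qed.

Let refl_odd (psi : R) (j : nat) : (2 * j).+1%:R * pi / k%:R - psi = node k (pi / k%:R - psi) j.
Proof. by rewrite /node -natr1 natrM; ring. Qed.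

Let kpi (psi : R) : k%:R * (pi / k%:R - psi) = pi - k%:R * psi.
Proof. by field. Qed.

Let sinpiB (x : R) : sin (pi - x) = sin x.
Proof. by rewrite sinB sinpi cospi; ring. Qed.
Let cospiB (x : R) : cos (pi - x) = - cos x.
Proof. by rewrite cosB sinpi cospi; ring. Qed.

(** Consistency of the construction: the weighted reflection sum is indeed the source put into the
    recursion. *)
Lemma kernel_coef_refl_sum m psi phi :
  \sum_(j < 2 * k) dih_mult al be j * kernel_coef m (j%:R * pi / k%:R - psi) phi =
  k%:R * dih_refl_coef (sin (k%:R * psi) * sin (k%:R * phi)) (cos (k%:R * psi) * cos (k%:R * phi)) m / poch gam m.
Proof.
rewrite (big_ord_double (fun j => dih_mult al be j * kernel_coef m (j%:R * pi / k%:R - psi) phi)) big_split/=.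
rewrite (eq_bigr (fun j : 'I_k => al * kernel_coef m (node k (- psi) j) phi)); last first.
  by move=> j _; rewrite refl_even /dih_mult mul2n odd_double.
rewrite [X in _ + X](eq_bigr (fun j : 'I_k => be * kernel_coef m (node k (pi / k%:R - psi) j) phi)); last first.
  by move=> j _; rewrite refl_odd /dih_mult mul2n /= odd_double.
rewrite -!mulr_sumr !kernel_coef_sum kpi sinpiB cospiB mulrN sinN cosN !mulNr.
rewrite /dih_refl_coef refl_coefE// -/dih_even_coef; ring.
Qed.

(** The radial equation in degree m + 1; in 1 + cos the cosine is the eigenvalue and 1 comes from
    the exponential factor. *)
Lemma kernel_coef_rec m psi phi :
  (m.+1%:R + gam) * kernel_coef m.+1 psi phi -
    \sum_(j < 2 * k) dih_mult al be j * kernel_coef m.+1 (j%:R * pi / k%:R - psi) phi =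
  (1 + cos (psi - phi)) * kernel_coef m psi phi.
Proof. by rewrite kernel_coef_refl_sum /kernel_coef kernel_coef_xSC_rec addrC addKr. Qed.

Lemma double_nu_bessel_poly0 S C p q : double_nu al be S C p q (bessel_poly 0) = nu_mom al p * nu_mom be q.
Proof. by rewrite /bessel_poly neg_pow_poly0 -(expr0 'X) /double_nu coef_pairingXn. Qed.

Lemma kernel_coef0 psi phi : kernel_coef 0 psi phi = 1.
Proof.
rewrite /kernel_coef /kernel_coef_xSC big_ord_recl big_ord0 expr0 mul1r subnn addr0 pochS poch0 mulr1 addr0.
have m1X (c : R) : 0 < c -> nu_mom c (1 + 'X) = 1.
  by move=> c0; rewrite raddfD/= -(expr1 'X) nu_mom_Xodd// nu_mom1 addr0.
have m1X' (c : R) : 0 < c -> nu_mom c (1 - 'X) = 1.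
  by move=> c0; rewrite raddfB/= -(expr1 'X) nu_mom_Xodd// nu_mom1 subr0.
rewrite /dih_refl_coef /refl_coef -/lam -/bessel_poly !double_nu_bessel_poly0 !m1X// !m1X'// !mulr1 -/lam /gam divff//.
by rewrite mulf_neq0// gt_eqF.
Qed.

Lemma kernel_coef_period m psi phi : kernel_coef m (psi + 2 * pi) phi = kernel_coef m psi phi.
Proof.
have e1 : cos (psi + 2 * pi - phi) = cos (psi - phi).
  by rewrite -(cos_nat2pi 1 (psi - phi)) mul1r; congr cos; ring.
have e2 : k%:R * (psi + 2 * pi) = k%:R * node k psi k by rewrite /node; field.
by rewrite /kernel_coef e1 e2 sin_k_node cos_k_node.
Qed.

(** The group splits into four families of [k] elements, which realize the four sign choices for (S,
    C); the sum of (1 +- u)(1 +- v) is 4, which removes the weights. *)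
Lemma kernel_coef_bessel_sum m phi1 phi2 :
  \sum_(j < 2 * k) (kernel_coef m phi1 (phi2 + j%:R * pi / k%:R) + kernel_coef m phi1 (j%:R * pi / k%:R - phi2)) =
  4 * k%:R * double_nu al be (sin (k%:R * phi1) * sin (k%:R * phi2)) (cos (k%:R * phi1) * cos (k%:R * phi2)) 1 1 (bessel_poly m)
   / poch gam m.
Proof.
rewrite (big_ord_double (fun j => kernel_coef m phi1 (phi2 + j%:R * pi / k%:R) + kernel_coef m phi1 (j%:R * pi / k%:R - phi2))).
rewrite big_split/= !(big_split _ _ _ (fun j : 'I_k => kernel_coef m phi1 _))/=.
under eq_bigr => j _.
  rewrite kernel_coefC (_ : phi2 + (2 * j)%N%:R * pi / k%:R = node k phi2 j); last by rewrite /node natrM; ring.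
  over.
under [X in _ + X + _]eq_bigr => j _ do rewrite kernel_coefC refl_even.
under [X in _ + (X + _)]eq_bigr => j _.
  rewrite kernel_coefC (_ : phi2 + (2 * j).+1%:R * pi / k%:R = node k (pi / k%:R + phi2) j); last first.
    by rewrite /node -natr1 natrM; ring.
  over.
under [X in _ + (_ + X)]eq_bigr => j _ do rewrite kernel_coefC refl_odd.
rewrite !kernel_coef_sum kpi sinpiB cospiB mulrN sinN cosN.
rewrite (_ : k%:R * (pi / k%:R + phi2) = k%:R * phi2 + pi); last by field.
rewrite sinDpi cosDpi !mulNr /dih_even_coef.
rewrite ![sin (k%:R * phi2) * _]mulrC ![cos (k%:R * phi2) * _]mulrC.
rewrite /even_coef -/lam -/bessel_poly !double_nu_negl// !double_nu_negr// !comp_polyD !comp_polyX -!polyC1 !comp_polyC polyC1.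
rewrite !double_nuDl !double_nuDr !double_nuNl !double_nuNr; ring.
Qed.

Lemma continuous_double_moment i p q (S C : R -> R) : continuous S -> continuous C ->
  continuous (fun x => double_moment al be (S x) (C x) i p q).
Proof.
move=> cS cC; elim: i p q => [|i IH] p q /=; first exact: continuous_cstR.
by apply: continuous_addR; apply: continuous_mulR.
Qed.

Lemma continuous_double_nu p q h (S C : R -> R) : continuous S -> continuous C ->
  continuous (fun x => double_nu al be (S x) (C x) p q h).
Proof.
move=> cS cC; rewrite /double_nu /coef_pairing; apply: continuous_sum_seq => i.
by apply: continuous_mulR; [exact: continuous_cstR|exact: continuous_double_moment].
Qed.

Lemma continuous_kernel_coef m phi : continuous (fun psi => kernel_coef m psi phi).
Proof.
have cS : continuous (fun psi : R => sin (k%:R * psi) * sin (k%:R * phi)).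
  apply: continuous_mulR; last exact: continuous_cstR.
  under eq_fun do rewrite -[_ * _]addr0; exact: continuous_sin_affine.
have cC : continuous (fun psi : R => cos (k%:R * psi) * cos (k%:R * phi)).
  apply: continuous_mulR; last exact: continuous_cstR.
  under eq_fun do rewrite -[_ * _]addr0; exact: continuous_cos_affine.
rewrite /kernel_coef /kernel_coef_xSC; apply: continuous_mulR; last exact: continuous_cstR.
apply: continuous_mulR; first exact: continuous_cstR.
apply: continuous_sum_seq => i; apply: continuous_mulR.
  have -> : (fun x => (1 + cos (x - phi)) ^+ i) = (fun x => \prod_(j <- iota 0 i) (1 + cos (1 * x - phi))).
    by apply/funext => x; rewrite big_const_seq count_predT size_iota iter_mulr_1 mul1r.
  apply: continuous_prod_seq => j; apply: continuous_addR; first exact: continuous_cstR.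
  exact: continuous_cos_affine.
by rewrite /dih_refl_coef /refl_coef; apply: continuous_addR; apply: continuous_mulR; do ?[exact: continuous_cstR|exact: continuous_double_nu].
Qed.

End Candidate.

(** * Sums over dihedral orbits and growth of the coefficients *)

Section Orbit.
Variables (R : realType) (k : nat) (al be : R).
Hypotheses (k0 : (0 < k)%N) (al0 : 0 < al) (be0 : 0 < be).
Let lam := al + be.
Let gam := k%:R * lam.
Let kn : (k%:R : R) != 0. Proof. by rewrite pnatr_eq0 -lt0n. Qed.
Implicit Types (f : R -> R) (phi psi x : R).

Definition dih_angle (j : nat) : R := j%:R * pi / k%:R.

Definition periodic2pi f := forall x, f (x + 2 * pi) = f x.

Lemma dih_angle2k : dih_angle (2 * k) = 2 * pi.
Proof. by rewrite /dih_angle natrM; field. Qed.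

Lemma dih_angleD i j : dih_angle (i + j) = dih_angle i + dih_angle j.
Proof. by rewrite /dih_angle natrD; ring. Qed.

Lemma sum_cyclic (g : nat -> R) n j : (forall i, g (i + n)%N = g i) ->
  \sum_(i < n) g (i + j)%N = \sum_(i < n) g i.
Proof.
move=> gn; elim: j => [|j IH]; first by apply: eq_bigr => i _; rewrite addn0.
rewrite -[RHS]IH; apply: (addrI (g j)).
have e : \sum_(i < n.+1) g (i + j)%N = g j + \sum_(i < n) g (i + j.+1)%N.
  rewrite big_ord_recl; congr (_ + _).
  by apply: eq_bigr => i _ /=; rewrite /bump leq0n addnS.
by rewrite -e big_ord_recr/= addnC gn addrC.
Qed.

Lemma periodic_shift f x (j : nat) : periodic2pi f ->
  \sum_(i < 2 * k) f (x + dih_angle j + dih_angle i) = \sum_(i < 2 * k) f (x + dih_angle i).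
Proof.
move=> pf; rewrite -[RHS](@sum_cyclic (fun i => f (x + dih_angle i)) _ j).
  by apply: eq_bigr => i _; rewrite dih_angleD -addrA; congr (f (x + _)); exact: addrC.
by move=> i; rewrite dih_angleD dih_angle2k addrA pf.
Qed.

Lemma periodic_rev f x : periodic2pi f -> \sum_(i < 2 * k) f (x - dih_angle i) = \sum_(i < 2 * k) f (x + dih_angle i).
Proof.
move=> pf; rewrite -[RHS](@periodic_shift _ _ 1)// (reindex_inj rev_ord_inj)/=.
apply: eq_bigr => i _; rewrite -[LHS]pf -dih_angle2k; congr f.
have -> : dih_angle (2 * k) = dih_angle (2 * k - i.+1) + dih_angle i.+1 by rewrite -dih_angleD subnK.
by rewrite (_ : dih_angle i.+1 = dih_angle 1 + dih_angle i); [ring|rewrite -dih_angleD add1n].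
Qed.

Definition orbit_sum phi f : R := \sum_(i < 2 * k) (f (phi + dih_angle i) + f (- phi + dih_angle i)).

Lemma orbit_sum_refl phi f j : periodic2pi f -> orbit_sum phi (fun psi => f (dih_angle j - psi)) = orbit_sum phi f.
Proof.
move=> pf; rewrite /orbit_sum !big_split/= addrC; congr (_ + _).
  rewrite -[RHS](periodic_shift _ j)// -[RHS]periodic_rev//; apply: eq_bigr => i _; congr f; ring.
rewrite -[RHS](periodic_shift _ j)// -[RHS]periodic_rev//; apply: eq_bigr => i _; congr f; ring.
Qed.

Lemma orbit_sumD phi f g : orbit_sum phi (fun psi => f psi + g psi) = orbit_sum phi f + orbit_sum phi g.
Proof. by rewrite /orbit_sum -big_split/=; apply: eq_bigr => i _; ring. Qed.
Lemma orbit_sumB phi f g : orbit_sum phi (fun psi => f psi - g psi) = orbit_sum phi f - orbit_sum phi g.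
Proof. by rewrite /orbit_sum -sumrB; apply: eq_bigr => i _; ring. Qed.
Lemma orbit_sumZ phi c f : orbit_sum phi (fun psi => c * f psi) = c * orbit_sum phi f.
Proof. by rewrite /orbit_sum mulr_sumr; apply: eq_bigr => i _; ring. Qed.
Lemma orbit_sum_sum phi I (r : seq I) (F : I -> R -> R) :
  orbit_sum phi (fun psi => \sum_(j <- r) F j psi) = \sum_(j <- r) orbit_sum phi (F j).
Proof.
elim: r => [|j r IH]; last by under eq_fun do rewrite big_cons; rewrite orbit_sumD IH big_cons.
rewrite big_nil /orbit_sum big1// => i _; rewrite !big_nil; exact: addr0.
Qed.

Definition in_orbit phi psi := exists i, psi = phi + dih_angle i \/ psi = - phi + dih_angle i.

Lemma ler_orbit_sum phi f g : (forall psi, in_orbit phi psi -> f psi <= g psi) -> orbit_sum phi f <= orbit_sum phi g.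
Proof.
move=> fg; apply: ler_sum => i _; apply: lerD; apply: fg; exists i; [by left|by right].
Qed.

Lemma eq_orbit_sum phi f g : (forall psi, in_orbit phi psi -> f psi = g psi) -> orbit_sum phi f = orbit_sum phi g.
Proof.
by move=> fg; apply/eqP; rewrite eq_le !ler_orbit_sum// => psi /fg ->.
Qed.

Lemma sum_dih_mult : \sum_(j < 2 * k) dih_mult al be j = gam.
Proof.
rewrite big_ord_double (eq_bigr (fun=> lam)); last first.
  by move=> j _; rewrite /dih_mult mul2n /= odd_double.
by rewrite sumr_const card_ord /gam mulr_natl.
Qed.

Definition refl_defect f psi : R := gam * f psi - \sum_(j < 2 * k) dih_mult al be j * f (dih_angle j - psi).

(* The reflections act on the orbit by permutations, hence as symmetric contractions. *)
Lemma refl_defect_ge0 phi f : periodic2pi f -> 0 <= orbit_sum phi (fun psi => refl_defect f psi * f psi).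
Proof.
move=> pf; pose g psi := f psi ^+ 2.
have pg : periodic2pi g by move=> x; rewrite /g pf.
(* [w] sums to zero over the orbit; subtracting it completes the square: a (a - b) - (a^2 - b^2) / 2
   = (a - b)^2 / 2. *)
pose w psi := \sum_(j < 2 * k) dih_mult al be j / 2 * (g psi - g (dih_angle j - psi)).
have -> : 0 = orbit_sum phi w.
  rewrite orbit_sum_sum big1// => j _.
  by rewrite orbit_sumZ orbit_sumB orbit_sum_refl// subrr mulr0.
apply: ler_orbit_sum => psi _; rewrite -subr_ge0 /refl_defect /w -sum_dih_mult.
rewrite mulrBl !mulr_suml -!sumrB; apply: sumr_ge0 => j _.
rewrite (_ : _ - _ - _ = dih_mult al be j / 2 * (f psi - f (dih_angle j - psi)) ^+ 2); last first.
  by rewrite /g; field.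
by rewrite mulr_ge0 ?sqr_ge0// divr_ge0// /dih_mult; case: ifP => _; exact: ltW.
Qed.

Lemma kernel_coef_periodic m phi2 : periodic2pi (fun psi => kernel_coef k al be m psi phi2).
Proof. by move=> x; exact: kernel_coef_period. Qed.

Lemma kernel_coef_defect m psi phi2 : refl_defect (fun psi => kernel_coef k al be m.+1 psi phi2) psi =
  (1 + cos (psi - phi2)) * kernel_coef k al be m psi phi2 - m.+1%:R * kernel_coef k al be m.+1 psi phi2.
Proof. by rewrite -kernel_coef_rec// /refl_defect /dih_angle /gam /lam; ring. Qed.

Definition orbit_sqnorm phi1 phi2 m := orbit_sum phi1 (fun psi => kernel_coef k al be m psi phi2 ^+ 2).

Lemma orbit_sqnorm0 phi1 phi2 : orbit_sqnorm phi1 phi2 0 = 4 * k%:R.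
Proof.
rewrite /orbit_sqnorm /orbit_sum (eq_bigr (fun=> 2)); last by move=> i _; rewrite !kernel_coef0// expr1n.
by rewrite sumr_const card_ord -[_ *+ (2 * k)]mulr_natr natrM; ring.
Qed.

Lemma cosD1_ge0 psi : 0 <= 1 + cos psi.
Proof. by rewrite -lerBlDl sub0r cos_geN1. Qed.
Lemma cosD1_le2 psi : 1 + cos psi <= 2.
Proof. by rewrite -lerBrDl (le_trans (cos_le1 _))//; lra. Qed.

(** The recursion is multiplied by the coefficient of degree m + 1 and summed over the orbit: the
    defect is nonnegative and 1 + cos <= 2, so the norm grows by at most 2 / (m + 1). *)
Lemma orbit_sqnormS phi1 phi2 m : orbit_sqnorm phi1 phi2 m.+1 <= 4 / m.+1%:R ^+ 2 * orbit_sqnorm phi1 phi2 m.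
Proof.
have n0 : 0 < m.+1%:R :> R by [].
have := @refl_defect_ge0 phi1 _ (kernel_coef_periodic m.+1 phi2).
rewrite (@eq_orbit_sum _ _ (fun psi => (1 + cos (psi - phi2)) * kernel_coef k al be m psi phi2 * kernel_coef k al be m.+1 psi phi2 -
   m.+1%:R * kernel_coef k al be m.+1 psi phi2 ^+ 2)); last by move=> psi _; rewrite kernel_coef_defect; ring.
rewrite orbit_sumB orbit_sumZ -/(orbit_sqnorm _ _ _) subr_ge0 => H.
(* Young's inequality, weighted so that its first term is half of the left side of [H]. *)
have H2 : orbit_sum phi1 (fun psi => (1 + cos (psi - phi2)) * kernel_coef k al be m psi phi2 * kernel_coef k al be m.+1 psi phi2)
   <= m.+1%:R / 2 * orbit_sqnorm phi1 phi2 m.+1 + 2 / m.+1%:R * orbit_sqnorm phi1 phi2 m.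
  rewrite -!orbit_sumZ -orbit_sumD; apply: ler_orbit_sum => psi _.
  set c := 1 + cos _; set f := kernel_coef _ _ _ m _ _; set g := kernel_coef _ _ _ m.+1 _ _.
  have c0 : 0 <= c := cosD1_ge0 _; have c2 : c <= 2 := cosD1_le2 _.
  rewrite -subr_ge0 (_ : _ - _ = m.+1%:R / 2 * (g - c * f / m.+1%:R) ^+ 2 + (4 - c ^+ 2) * f ^+ 2 / (2 * m.+1%:R)); last first.
    by field; rewrite nat1r gt_eqF.
  apply: addr_ge0; first by apply: mulr_ge0; [exact: divr_ge0|exact: sqr_ge0].
  apply: mulr_ge0; last by rewrite invr_ge0 mulr_ge0.
  by apply: mulr_ge0; [rewrite subr_ge0; nra|exact: sqr_ge0].
have : m.+1%:R / 2 * orbit_sqnorm phi1 phi2 m.+1 <= 2 / m.+1%:R * orbit_sqnorm phi1 phi2 m.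
  rewrite -(lerD2l (m.+1%:R / 2 * orbit_sqnorm phi1 phi2 m.+1)); apply: le_trans H2.
  by apply: le_trans H; rewrite le_eqVlt; apply/orP; left; apply/eqP; field.
rewrite -(ler_pM2l (_ : 0 < 2 / m.+1%:R)) ?divr_gt0// !mulrA.
rewrite (_ : 2 / m.+1%:R * m.+1%:R / 2 = 1); last by field; rewrite nat1r gt_eqF.
rewrite mul1r (_ : 2 / m.+1%:R * 2 / m.+1%:R = 4 / m.+1%:R ^+ 2)//; field.
by rewrite nat1r gt_eqF.
Qed.

Lemma orbit_sqnorm_le phi1 phi2 m : orbit_sqnorm phi1 phi2 m <= 4 * k%:R * (2 ^+ m / m`!%:R) ^+ 2.
Proof.
elim: m => [|m IH]; first by rewrite orbit_sqnorm0 expr0 fact0 divr1 expr1n mulr1.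
apply: (le_trans (orbit_sqnormS _ _ _)).
have n0 : (0 : R) < m.+1%:R by [].
have f0 : (0 : R) < m`!%:R by rewrite ltr0n fact_gt0.
apply: (@le_trans _ _ (4 / m.+1%:R ^+ 2 * (4 * k%:R * (2 ^+ m / m`!%:R) ^+ 2))).
  by apply: ler_wpM2l => //; rewrite divr_ge0// exprn_ge0.
rewrite le_eqVlt; apply/orP; left; apply/eqP.
rewrite factS natrM [2 ^+ m.+1]exprS; field.
by rewrite nat1r !gt_eqF.
Qed.

End Orbit.

(** * Uniqueness along rays *)

Section DunklRay.
Variables (R : realType) (k : nat) (al be : R).
Hypothesis (k0 : (0 < k)%N).
Let kn : (k%:R : R) != 0. Proof. by rewrite pnatr_eq0 -lt0n. Qed.

Let half (j : nat) : R := j%:R * pi / (2 * k)%:R.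

Lemma dot_root_polar j (t psi : R) : dot (dih_root R k j) (polar t psi) = t * sin (psi - half j).
Proof. by rewrite /dot /dih_root /polar /= -/(half j) sinB; ring. Qed.

Lemma refl_root_polar j (t psi : R) :
  refl_root (dih_root R k j) (polar t psi) = polar t (dih_angle R k j - psi).
Proof.
have hE : dih_angle R k j - psi = half j - (psi - half j).
  by rewrite /dih_angle /half natrM; field.
have dd : dot (dih_root R k j) (dih_root R k j) = 1.
  by rewrite /dot /dih_root /= -/(half j) mulrNN -!expr2 addrC cos2Dsin2.
rewrite /refl_root dd dot_root_polar divr1 hE /polar /=.
set b := psi - half j; have pE : psi = b + half j by rewrite /b; ring.
rewrite /dih_root /= -/(half j); clearbody b; rewrite pE.
by congr pair; rewrite ?cosB ?sinB ?cosD ?sinD; ring.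
Qed.

Lemma cos_natpi_neq0 j : cos (j%:R * pi) != 0 :> R.
Proof.
apply/eqP => c0; have := cos2Dsin2 (j%:R * pi : R).
by rewrite c0 sin_natpi expr0n/= addr0 => /eqP; rewrite eq_sym oner_eq0.
Qed.

(** The walls are the lines of angle j pi / (2 k), that is, the zeros of sin (2 k psi). *)
Lemma regular_polar (t psi : R) : 0 < t -> sin ((2 * k)%:R * psi) != 0 ->
  dih_regular k (polar t psi).
Proof.
move=> t0 s0 j; rewrite dot_root_polar; apply: mulf_neq0; first by rewrite gt_eqF.
move: s0; apply: contra_neq => /(sin_natmul (2 * k)).
rewrite mulrBr (_ : (2 * k)%:R * half j = j%:R * pi); last by rewrite /half natrM; field.
rewrite sinB sin_natpi mulr0 subr0 => /eqP; rewrite mulf_eq0.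
by rewrite (negbTE (cos_natpi_neq0 _)) orbF => /eqP.
Qed.

Lemma regular_orbit (phi psi : R) : sin ((2 * k)%:R * phi) != 0 -> in_orbit k phi psi ->
  sin ((2 * k)%:R * psi) != 0.
Proof.
have aux (x : R) i : sin ((2 * k)%:R * x) != 0 -> sin ((2 * k)%:R * (x + dih_angle R k i)) != 0.
  rewrite mulrDr (_ : (2 * k)%:R * dih_angle R k i = (2 * i)%:R * pi); last first.
    by rewrite /dih_angle !natrM; field.
  by rewrite sinD sin_natpi mulr0 addr0 => h; rewrite mulf_neq0// cos_natpi_neq0.
by move=> s0 [i [->|->]]; apply: aux => //; rewrite mulrN sinN oppr_eq0.
Qed.

Variable E : R * R -> R * R -> R.
Hypothesis DE : is_dunkl_kernel k al be E.

(* Contracting the two Dunkl equations with [x] gives the radial derivative, since [<root, x>] cancels the denominators. *)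
Lemma dunkl_ray (t psi r2 phi2 : R) : 0 < t -> sin ((2 * k)%:R * psi) != 0 ->
  let y := polar r2 phi2 in
  let e psi := E (polar t psi) y in
  is_derive t 1 (fun t => E (polar t psi) y)
    (r2 * cos (psi - phi2) * e psi - t^-1 * \sum_(j < 2 * k) dih_mult al be j * (e psi - e (dih_angle R k j - psi))).
Proof.
move=> t0 s0 y e.
have [dE [_ eqE]] := DE y.
pose f := fun x => E x y; pose x := polar t psi; pose v := (cos psi, sin psi) : R * R.
have df : differentiable f x by exact: dE.
have path (h : R) : polar (h *: 1 + t) psi = h *: v + x.
  rewrite (_ : h *: 1 = h); last exact: mulr1.
  by rewrite /polar /v /x /polar /=; congr pair; rewrite mulrDl.
have dv : derivable f x v by exact: diff_derivable.
have e1 : (fun h : R => h^-1 *: (((fun t => f (polar t psi)) \o shift t) (h *: 1) - f (polar t psi)))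
   = (fun h : R => h^-1 *: ((f \o shift x) (h *: v) - f x)).
  by apply/funext => h /=; rewrite path.
have ider : is_derive t 1 (fun t => f (polar t psi)) ('D_v f x).
  by apply: DeriveDef; rewrite /derivable /derive e1.
apply: (@eq_ind _ _ (is_derive t 1 (fun t => f (polar t psi))) ider).
have -> : 'D_v f x = cos psi * 'D_(unitv R false) f x + sin psi * 'D_(unitv R true) f x.
  rewrite !deriveE// -!linearZ -linearD/=; congr ('d f x _).
  rewrite [RHS]surjective_pairing /v /unitv /=; congr pair; rewrite /GRing.scale/=.
    by rewrite mulr1 mulr0 addr0.
  by rewrite mulr1 mulr0 add0r.
have reg := regular_polar t0 s0.
have /= := eqE _ reg false; have /= := eqE _ reg true.
rewrite /dunkl -/f -/x /= => h2 h1.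
have sumE (c : nat -> R) : \sum_(j < 2 * k) dih_mult al be j * c j *
      (E x y - E (refl_root (dih_root R k j) x) y) / dot (dih_root R k j) x =
    \sum_(j < 2 * k) dih_mult al be j * c j * (f x - e (dih_angle R k j - psi)) / (t * sin (psi - half j)).
  by apply: eq_bigr => j _; rewrite refl_root_polar dot_root_polar.
rewrite (sumE (fun j => - sin (half j))) in h1; rewrite (sumE (fun j => cos (half j))) in h2.
have -> : 'D_(unitv R false) f x = r2 * cos phi2 * f x -
    \sum_(j < 2 * k) dih_mult al be j * - sin (half j) * (f x - e (dih_angle R k j - psi)) / (t * sin (psi - half j)).
  by apply/eqP; rewrite eq_sym subr_eq; apply/eqP/esym; exact: h1.
have -> : 'D_(unitv R true) f x = r2 * sin phi2 * f x -
    \sum_(j < 2 * k) dih_mult al be j * cos (half j) * (f x - e (dih_angle R k j - psi)) / (t * sin (psi - half j)).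
  by apply/eqP; rewrite eq_sym subr_eq; apply/eqP/esym; exact: h2.
rewrite (_ : e psi = f x)// !mulrBr addrACA -opprD; congr (_ - _).
  by rewrite cosB; ring.
rewrite !mulr_sumr -big_split/=; apply: eq_bigr => j _.
have := reg j; rewrite dot_root_polar mulf_eq0 negb_or => /andP[_ sj].
(* Contracting the root with the unit vector of angle [psi] gives sin (psi - half j), the
   denominator up to [t]. *)
have -> : cos psi = cos (psi - half j) * cos (half j) - sin (psi - half j) * sin (half j).
  by rewrite -cosD subrK.
have -> : sin psi = sin (psi - half j) * cos (half j) + cos (psi - half j) * sin (half j).
  by rewrite -sinD subrK.
have := cos2Dsin2 (half j); set c := cos (half j); set s := sin (half j) => cs.
set S := sin (psi - half j); set C := cos (psi - half j); set D := f x - _.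
transitivity (dih_mult al be j * D * S * (c ^+ 2 + s ^+ 2) / (t * S)).
  by field; rewrite sj gt_eqF.
by rewrite cs mulr1; field; rewrite sj gt_eqF.
Qed.

End DunklRay.

Section DeriveReal.
Variable R : realType.
Implicit Types (f g : R -> R) (x a b : R).

Lemma is_derive_addR f g x a b : is_derive x 1 f a -> is_derive x 1 g b ->
  is_derive x 1 (fun t => f t + g t) (a + b).
Proof. by move=> hf hg; exact: (is_deriveD hf hg). Qed.

Lemma is_derive_subR f g x a b : is_derive x 1 f a -> is_derive x 1 g b ->
  is_derive x 1 (fun t => f t - g t) (a - b).
Proof. by move=> hf hg; exact: (is_deriveB hf hg). Qed.

Lemma is_derive_mulR f g x a b : is_derive x 1 f a -> is_derive x 1 g b ->
  is_derive x 1 (fun t => f t * g t) (a * g x + f x * b).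
Proof.
move=> hf hg; have h := is_deriveM hf hg.
by apply: (@eq_ind _ _ (is_derive x 1 (fun t => f t * g t)) h); rewrite /GRing.scale/=; ring.
Qed.

Lemma is_derive_sumR n (h : 'I_n -> R -> R) x (dh : 'I_n -> R) : (forall i, is_derive x 1 (h i) (dh i)) ->
  is_derive x 1 (fun t => \sum_(i < n) h i t) (\sum_(i < n) dh i).
Proof.
move=> H; have := is_derive_sum H.
by rewrite (_ : \sum_(i < n) h i = fun t => \sum_(i < n) h i t)// fct_sumE.
Qed.

Lemma is_derive_expRZ a x : is_derive x 1 (fun t => expR (a * t)) (a * expR (a * x)).
Proof.
have ha : is_derive x 1 (fun t => a * t) a.
  have := is_derive_mulR (is_derive_cst a x 1) (is_derive_id x 1).
  by rewrite mul0r add0r mulr1.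
have h := @is_derive1_comp _ expR (fun t => a * t) x _ _ (is_derive_expR _) ha.
by apply: (@eq_ind _ _ (is_derive x 1 (fun t => expR (a * t))) h); rewrite mulrC.
Qed.

End DeriveReal.

Section Gronwall.
Variables (R : realType) (k : nat) (al be : R).
Hypotheses (k0 : (0 < k)%N) (al0 : 0 < al) (be0 : 0 < be).
Variable E : R * R -> R * R -> R.
Hypothesis DE : is_dunkl_kernel k al be E.
Variables (r2 phi2 : R) (M : nat).
Hypothesis (r20 : 0 <= r2).
Let y := polar r2 phi2.
Let gam := k%:R * (al + be).
Implicit Types (t psi : R).

Definition ray_kernel (t psi : R) : R := E (polar t psi) y.
Definition ray_partial_sum (psi : R) : {poly R} := \poly_(m < M.+1) (kernel_coef k al be m psi phi2 * r2 ^+ m).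
Definition ray_error (t psi : R) : R := expR (r2 * t) * ray_kernel t psi - (ray_partial_sum psi).[t].

Lemma ray_partial_sumE psi t : (ray_partial_sum psi).[t] = \sum_(m < M.+1) kernel_coef k al be m psi phi2 * (r2 * t) ^+ m.
Proof. by rewrite horner_poly; apply: eq_bigr => m _; rewrite exprMn mulrA. Qed.

Lemma ray_partial_sum_deriv psi t : t * (ray_partial_sum psi)^`().[t] =
  \sum_(m < M.+1) m%:R * kernel_coef k al be m psi phi2 * (r2 * t) ^+ m.
Proof.
rewrite /ray_partial_sum poly_def linear_sum/= horner_sum mulr_sumr; apply: eq_bigr => m _.
rewrite derivZ derivXn hornerZ hornerMn hornerXn.
case: (m : nat) => [|n]; first by rewrite mulr0n !mul0r !mulr0.
by rewrite /= -mulr_natl exprMn [t ^+ n.+1]exprS; ring.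
Qed.

Lemma periodic_ray_error t : periodic2pi (ray_error t).
Proof.
have pol x : polar t (x + 2 * pi) = polar t x.
  rewrite (_ : 2 * pi = pi *+ 2); last by rewrite mulr_natl.
  by rewrite /polar cosD2pi sinD2pi.
move=> x; rewrite /ray_error /ray_kernel pol !ray_partial_sumE; congr (_ - _).
by apply: eq_bigr => m _; rewrite kernel_coef_period.
Qed.

(** Only the last term, left by truncation at [M], is inhomogeneous; [orbit_sqnorm_le] will make it
    small. *)
Definition ray_error_deriv (t psi : R) : R :=
  - t^-1 * refl_defect k al be (ray_error t) psi + r2 * (1 + cos (psi - phi2)) * ray_error t psi
  + r2 * (1 + cos (psi - phi2)) * kernel_coef k al be M psi phi2 * (r2 * t) ^+ M.

Lemma ray_error_derive t psi : 0 < t -> sin ((2 * k)%:R * psi) != 0 ->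
  is_derive t 1 (fun t => ray_error t psi) (ray_error_deriv t psi).
Proof.
move=> t0 s0; have t_neq0 : t != 0 by rewrite gt_eqF.
have ide := dunkl_ray k0 DE r2 phi2 t0 s0.
have idp : is_derive t 1 (horner (ray_partial_sum psi)) ((ray_partial_sum psi)^`().[t]).
  by rewrite derivE; apply: DeriveDef; [exact: derivable_horner|rewrite derive1E].
have h := is_derive_subR (is_derive_mulR (is_derive_expRZ r2 t) ide) idp.
apply: (@eq_ind _ _ (is_derive t 1 (fun t => ray_error t psi)) h).
apply: (mulfI t_neq0).
have -> : t * ray_error_deriv t psi = - refl_defect k al be (ray_error t) psi + t * (r2 * (1 + cos (psi - phi2)) * ray_error t psi)
    + (1 + cos (psi - phi2)) * kernel_coef k al be M psi phi2 * (r2 * t) ^+ M.+1.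
  by rewrite /ray_error_deriv exprS; field.
rewrite /= -/y -/(ray_kernel t psi).
have -> : \sum_(j < 2 * k) dih_mult al be j * (ray_kernel t psi - E (polar t (dih_angle R k j - psi)) y)
    = refl_defect k al be (ray_kernel t) psi.
  rewrite /refl_defect -[k%:R * _]sum_dih_mult// mulr_suml -sumrB; apply: eq_bigr => j _.
  by rewrite mulrBr.
have -> : refl_defect k al be (ray_error t) psi = expR (r2 * t) * refl_defect k al be (ray_kernel t) psi -
     \sum_(m < M.+1) refl_defect k al be (fun psi => kernel_coef k al be m psi phi2) psi * (r2 * t) ^+ m.
  rewrite /refl_defect /ray_error.
  transitivity (k%:R * (al + be) * (expR (r2 * t) * ray_kernel t psi) - \sum_(j < 2 * k) dih_mult al be j * (expR (r2 * t) * ray_kernel t (dih_angle R k j - psi))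
    - (k%:R * (al + be) * (ray_partial_sum psi).[t] - \sum_(j < 2 * k) dih_mult al be j * (ray_partial_sum (dih_angle R k j - psi)).[t])).
    under [in LHS]eq_bigr do rewrite mulrBr.
    by rewrite sumrB; ring.
  congr (_ - _).
    rewrite mulrBr mulr_sumr; congr (_ - _); first by ring.
    by apply: eq_bigr => j _; ring.
  rewrite ray_partial_sumE mulr_sumr.
  under [X in _ - X]eq_bigr => j _ do rewrite ray_partial_sumE mulr_sumr.
  rewrite exchange_big/= -sumrB; apply: eq_bigr => m _.
  rewrite mulrBl mulr_suml; congr (_ - _); first by ring.
  by apply: eq_bigr => j _; ring.
rewrite /ray_error ray_partial_sumE.
set c := 1 + cos _; set e := ray_kernel t psi; set de := refl_defect _ _ _ (ray_kernel t) psi.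
(* The recursion summed over degrees: degree 0 contributes nothing on the left, and the term [M] on
   the right has no partner and is subtracted. *)
have Sum : \sum_(m < M.+1) refl_defect k al be (fun psi => kernel_coef k al be m psi phi2) psi * (r2 * t) ^+ m
  + \sum_(m < M.+1) m%:R * kernel_coef k al be m psi phi2 * (r2 * t) ^+ m
  = c * r2 * t * \sum_(m < M.+1) kernel_coef k al be m psi phi2 * (r2 * t) ^+ m
    - c * kernel_coef k al be M psi phi2 * (r2 * t) ^+ M.+1.
  rewrite -big_split/= big_ord_recl [in RHS]big_ord_recr/= mulrDr.
  have -> : refl_defect k al be (fun psi => kernel_coef k al be 0 psi phi2) psi = 0.
    rewrite /refl_defect kernel_coef0// -sum_dih_mult// mulr1 -sumrB big1// => j _.
    by rewrite kernel_coef0// mulr1 subrr.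
  rewrite mul0r add0r mul0r mul0r add0r exprS mulr_sumr.
  rewrite (_ : forall a b d : R, a + b - d = a + (b - d)); last by move=> *; ring.
  rewrite (_ : c * r2 * t * _ - _ = 0); last by ring.
  rewrite addr0; apply: eq_bigr => m _; rewrite /bump/= add1n kernel_coef_defect// -/c exprS; ring.
have pd := ray_partial_sum_deriv psi t.
move: Sum pd; set S1 := \sum_(m < M.+1) _; set S2 := \sum_(m < M.+1) _; set S3 := \sum_(m < M.+1) _.
set P := (ray_partial_sum psi)^`().[t] => Sum pd.
transitivity (t * r2 * c * expR (r2 * t) * e - expR (r2 * t) * de - t * P).
  by rewrite /c; field.
rewrite pd (_ : S2 = c * r2 * t * S3 - c * kernel_coef k al be M psi phi2 * (r2 * t) ^+ M.+1 - S1); last first.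
  by rewrite -Sum; ring.
by ring.
Qed.

Lemma continuous_ray_kernel psi : continuous (fun t => ray_kernel t psi).
Proof.
move=> t; have [dE _] := DE y.
apply: (@continuous_comp _ _ _ (fun t => polar t psi) (fun x => E x y)).
  have c1 : (fun x => x * cos psi) x @[x --> t] --> t * cos psi.
    by apply: cvgM; [exact: cvg_id|exact: cvg_cst].
  have c2 : (fun x => x * sin psi) x @[x --> t] --> t * sin psi.
    by apply: cvgM; [exact: cvg_id|exact: cvg_cst].
  exact: (cvg_pair c1 c2).
exact: differentiable_continuous.
Qed.

Lemma continuous_ray_error psi : continuous (fun t => ray_error t psi).
Proof.
apply: continuous_subR; last exact: continuous_horner.
apply: continuous_mulR; last exact: continuous_ray_kernel.
move=> t; apply: (@continuous_comp _ _ _ (fun t => r2 * t) expR); last exact: continuous_expR.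
by apply: cvgM; [exact: cvg_cst|exact: cvg_id].
Qed.

Lemma ray_error0 psi : ray_error 0 psi = 0.
Proof.
have [_ [E0 _]] := DE y.
rewrite /ray_error /ray_kernel mulr0 expR0 mul1r (_ : polar 0 psi = (0, 0)); last by rewrite /polar !mul0r.
rewrite E0 ray_partial_sumE big_ord_recl/= expr0 mulr1 kernel_coef0// big1 ?addr0 ?subrr// => i _.
by rewrite mulr0 expr0n mulr0.
Qed.

(** Gronwall constant: 2 r2 (1 + cos) is at most 4 r2, and 1 comes from splitting the product of the
    truncation term with the error. *)
Let K := 4 * r2 + 1.

Lemma orbit_ray_error_derive t phi1 : 0 < t -> sin ((2 * k)%:R * phi1) != 0 ->
  is_derive t 1 (fun t => orbit_sum k phi1 (fun psi => ray_error t psi ^+ 2))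
    (orbit_sum k phi1 (fun psi => 2 * (ray_error_deriv t psi * ray_error t psi))).
Proof.
move=> t0 s0; have id psi : in_orbit k phi1 psi ->
    is_derive t 1 (fun t => ray_error t psi ^+ 2) (2 * (ray_error_deriv t psi * ray_error t psi)).
  move=> /(regular_orbit k0 s0) sp; have h := ray_error_derive t0 sp.
  have h2 := is_derive_mulR h h; apply: (@eq_ind _ _ (is_derive t 1 (fun t => ray_error t psi ^+ 2)) h2).
  by ring.
by apply: is_derive_sumR => i; apply: is_derive_addR; apply: id; exists i; [left|right].
Qed.

(** The singular factor 1 / t multiplies minus a nonnegative orbit sum; adding that sum back cancels
    it, so the bound stays uniform down to t = 0. *)
Lemma orbit_ray_error_derive_le t phi1 : 0 < t -> sin ((2 * k)%:R * phi1) != 0 ->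
  orbit_sum k phi1 (fun psi => 2 * (ray_error_deriv t psi * ray_error t psi)) <=
  K * orbit_sum k phi1 (fun psi => ray_error t psi ^+ 2) + 4 * r2 ^+ 2 * (r2 * t) ^+ M ^+ 2 * orbit_sqnorm k al be phi1 phi2 M.
Proof.
move=> t0 s0.
have d0 := refl_defect_ge0 k0 al0 be0 phi1 (periodic_ray_error t).
rewrite -!orbit_sumZ -orbit_sumD.
apply: (@le_trans _ _ (orbit_sum k phi1 (fun psi => 2 * (ray_error_deriv t psi * ray_error t psi) +
    2 / t * (refl_defect k al be (ray_error t) psi * ray_error t psi)))).
  by rewrite orbit_sumD lerDl orbit_sumZ mulr_ge0// divr_ge0// ltW.
apply: ler_orbit_sum => psi _; rewrite /ray_error_deriv.
set c := 1 + cos _; set d := refl_defect _ _ _ _ _; set D := ray_error t psi; set f := kernel_coef _ _ _ _ _ _; set u := (r2 * t) ^+ M.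
have c0 : 0 <= c := cosD1_ge0 _; have c2 : c <= 2 := cosD1_le2 _.
rewrite (_ : _ + _ = 2 * r2 * c * D ^+ 2 + 2 * (r2 * c * f * u) * D); last first.
  by field; rewrite gt_eqF.
have h1 : 2 * r2 * c * D ^+ 2 <= 4 * r2 * D ^+ 2.
  apply: ler_wpM2r; first exact: sqr_ge0.
  by rewrite -subr_ge0 (_ : _ - _ = 2 * r2 * (2 - c)); [rewrite !mulr_ge0// subr_ge0|ring].
have h2 : 2 * (r2 * c * f * u) * D <= D ^+ 2 + 4 * r2 ^+ 2 * u ^+ 2 * f ^+ 2.
  rewrite -subr_ge0 (_ : _ - _ = (D - r2 * c * f * u) ^+ 2 + (4 - c ^+ 2) * (r2 * f * u) ^+ 2); last by ring.
  apply: addr_ge0; first exact: sqr_ge0.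
  by apply: mulr_ge0; [rewrite subr_ge0; nra|exact: sqr_ge0].
apply: (le_trans (lerD h1 h2)); rewrite le_eqVlt; apply/orP; left; apply/eqP.
by rewrite /K; ring.
Qed.

Lemma ray_error_le_regular r1 phi1 : 0 <= r1 -> sin ((2 * k)%:R * phi1) != 0 ->
  ray_error r1 phi1 ^+ 2 <= expR (K * r1) * (4 * r2 ^+ 2 * (r2 * r1) ^+ M ^+ 2 * (4 * k%:R * (2 ^+ M / M`!%:R) ^+ 2)) * r1.
Proof.
move=> r10 s0; set c := 4 * r2 ^+ 2 * _ * _.
have nn u : 0 <= 4 * r2 ^+ 2 * u ^+ 2 by rewrite -mulrA -exprMn mulr_ge0// sqr_ge0.
have c0 : 0 <= c.
  by apply: mulr_ge0; [exact: nn|apply: mulr_ge0; [exact: mulr_ge0|exact: sqr_ge0]].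
pose Q t := orbit_sum k phi1 (fun psi => ray_error t psi ^+ 2).
have Q0 t : 0 <= Q t.
  by rewrite /Q /orbit_sum sumr_ge0// => i _; rewrite addr_ge0// sqr_ge0.
(* [W] is nonincreasing because Q' <= K Q + c and the exponential is at most 1. The derivative is
   used for t > 0 and continuity at 0, where [Q] vanishes. *)
pose W t := expR (- K * t) * Q t - c * t.
have DQ : ray_error r1 phi1 ^+ 2 <= Q r1.
  have [n n2k] : exists n, (2 * k)%N = n.+1 by exists (2 * k).-1; rewrite prednK// muln_gt0.
  rewrite /Q /orbit_sum n2k big_ord_recl/= {1}(_ : phi1 = phi1 + dih_angle R k 0); last first.
    by rewrite /dih_angle !mul0r addr0.
  rewrite -addrA lerDl addr_ge0 ?sqr_ge0//; apply: sumr_ge0 => i _.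
  by rewrite addr_ge0// sqr_ge0.
have cQ : continuous Q.
  apply: continuous_sum_seq => i; apply: continuous_addR; apply: continuous_mulR; exact: continuous_ray_error.
have cW : continuous W.
  apply: continuous_subR; last by apply: continuous_mulR; [exact: continuous_cstR|move=> x; exact: cvg_id].
  apply: continuous_mulR => // t.
  apply: (@continuous_comp _ _ _ (fun t => - K * t) expR); last exact: continuous_expR.
  by apply: cvgM; [exact: cvg_cst|exact: cvg_id].
have dW t : 0 < t -> is_derive t 1 W (- K * expR (- K * t) * Q t +
    expR (- K * t) * orbit_sum k phi1 (fun psi => 2 * (ray_error_deriv t psi * ray_error t psi)) - c).
  move=> t0; apply: is_derive_subR.
    by apply: is_derive_mulR; [exact: is_derive_expRZ|exact: orbit_ray_error_derive].
  have := is_derive_mulR (is_derive_cst c t 1) (is_derive_id t 1).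
  by rewrite mul0r add0r mulr1.
have W10 : W r1 <= W 0.
  have H : {in `[0, r1]%R &, {homo W : x y /~ x <= y}}; last first.
    by apply: H; rewrite ?in_itv/= ?lexx ?r10.
  apply: ler0_derive1_le_cc.
  - by move=> t; rewrite in_itv/= => /andP[t0 _]; have [] := dW t t0.
  - move=> t; rewrite in_itv/= => /andP[t0 tr].
    have h := dW t t0; rewrite derive1E derive_val.
    have le := orbit_ray_error_derive_le t0 s0.
    have lec : 4 * r2 ^+ 2 * (r2 * t) ^+ M ^+ 2 * orbit_sqnorm k al be phi1 phi2 M <= c.
      rewrite /c; apply: ler_pM.
      + exact: nn.
      + by rewrite /orbit_sqnorm /orbit_sum sumr_ge0// => i _; rewrite addr_ge0// sqr_ge0.
      + apply: ler_wpM2l; first by rewrite mulr_ge0// sqr_ge0.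
        have rt0 : 0 <= r2 * t by rewrite mulr_ge0// ltW.
        have rr0 : 0 <= r2 * r1 by rewrite mulr_ge0.
        have rtr : r2 * t <= r2 * r1 by rewrite ler_wpM2l// ltW.
        by do !(apply: lerXn2r; rewrite ?nnegrE ?exprn_ge0//).
      + exact: orbit_sqnorm_le.
    have ex : expR (- K * t) <= 1.
      have K0 : 0 <= K by rewrite /K addr_ge0// mulr_ge0.
      by rewrite -expR0 ler_expR mulNr oppr_le0; apply: mulr_ge0 => //; exact: ltW.
    have ex0 : 0 <= expR (- K * t) := expR_ge0 _.
    move: le; rewrite -/(Q t); set o := orbit_sum _ _ _ => le.
    have : expR (- K * t) * (o - K * Q t) <= c.
      apply: (@le_trans _ _ (expR (- K * t) * c)).
        apply: ler_wpM2l => //; rewrite lerBlDl; apply: (le_trans le).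
        by rewrite lerD2l.
      by rewrite ler_piMl.
    rewrite -subr_le0; apply: le_trans; rewrite le_eqVlt; apply/orP; left; apply/eqP; ring.
  - exact: continuous_subspaceT.
move: W10; rewrite /W (_ : Q 0 = 0); last first.
  by rewrite /Q /orbit_sum big1// => i _; rewrite !ray_error0 expr0n addr0.
rewrite !mulr0 subr0 subr_le0 => h.
apply: (le_trans DQ); rewrite -mulrA (_ : expR (K * r1) = (expR (- K * r1))^-1).
  by rewrite ler_pdivlMl ?expR_gt0.
by rewrite mulNr expRN invrK.
Qed.

End Gronwall.

(** * Convergence of the series to the kernel and to the Bessel function *)

Section KernelSeries.
Variables (R : realType) (k : nat) (al be : R).
Hypotheses (k0 : (0 < k)%N) (al0 : 0 < al) (be0 : 0 < be).
Variable E : R * R -> R * R -> R.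
Hypothesis DE : is_dunkl_kernel k al be E.

Lemma cvgn_sum (I : Type) (r : seq I) (u : I -> nat -> R) (l : I -> R) :
  (forall i, u i M @[M --> \oo] --> l i) ->
  \sum_(i <- r) u i M @[M --> \oo] --> \sum_(i <- r) l i.
Proof.
move=> ul; elim: r => [|i r IH].
  by under eq_fun do rewrite big_nil; rewrite big_nil; exact: cvg_cst.
by under eq_fun do rewrite big_cons; rewrite big_cons; exact: cvgD.
Qed.

Definition ray_bound r1 r2 M : R :=
  expR ((4 * r2 + 1) * r1) * (4 * r2 ^+ 2 * (r2 * r1) ^+ M ^+ 2 * (4 * k%:R * (2 ^+ M / M`!%:R) ^+ 2)) * r1.

Lemma ray_error_le (r1 r2 phi1 phi2 : R) M : 0 <= r1 -> 0 <= r2 ->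
  ray_error k al be E r2 phi2 M r1 phi1 ^+ 2 <= ray_bound r1 r2 M.
Proof.
move=> r10 r20; pose g psi := ray_error k al be E r2 phi2 M r1 psi ^+ 2 - ray_bound r1 r2 M.
have cE : continuous (fun psi => E (polar r1 psi) (polar r2 phi2)).
  move=> psi; have [dE _] := DE (polar r2 phi2).
  apply: (@continuous_comp _ _ _ (fun psi => polar r1 psi) (fun x => E x (polar r2 phi2))).
    have c1 : (fun x => r1 * cos x) x @[x --> psi] --> r1 * cos psi.
      by apply: cvgM; [exact: cvg_cst|exact: continuous_cos].
    have c2 : (fun x => r1 * sin x) x @[x --> psi] --> r1 * sin psi.
      by apply: cvgM; [exact: cvg_cst|exact: continuous_sin].
    exact: (cvg_pair c1 c2).
  exact: differentiable_continuous.
have cD : continuous (fun psi => ray_error k al be E r2 phi2 M r1 psi).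
  apply: continuous_subR; first by apply: continuous_mulR; [exact: continuous_cstR|exact: cE].
  under eq_fun do rewrite ray_partial_sumE.
  apply: continuous_sum_seq => m; apply: continuous_mulR; last exact: continuous_cstR.
  exact: continuous_kernel_coef.
have cg : continuous g by apply: continuous_subR; [exact: continuous_mulR|exact: continuous_cstR].
have k20 : (0 < 2 * k)%N by rewrite muln_gt0.
(* |g| + g vanishes exactly where g <= 0, which turns the inequality into an equation that passes to
   the walls. *)
have := @sin_dense R (2 * k) (fun psi => `|g psi| + g psi) k20 _ _ phi1.
move=> h; have {h} : `|g phi1| + g phi1 = 0.
  apply: h => [|th sth].
    apply: continuous_addR => // x; apply: (@continuous_comp _ _ _ g Num.norm); first exact: cg.
    exact: norm_continuous.
  have : g th <= 0 by rewrite subr_le0; exact: ray_error_le_regular.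
  by move=> h; rewrite ler0_norm// addNr.
move/eqP; rewrite addr_eq0 => /eqP gE; rewrite -subr_le0 -/(g phi1).
by rewrite -oppr_ge0 -gE.
Qed.

Lemma ray_bound_cvg0 (r1 r2 : R) : ray_bound r1 r2 M @[M --> \oo] --> 0.
Proof.
pose A := expR ((4 * r2 + 1) * r1) * (4 * r2 ^+ 2 * (4 * k%:R)) * r1.
have -> : ray_bound r1 r2 = (fun M => A * (exp_coeff (r2 * r1 * 2) M * exp_coeff (r2 * r1 * 2) M)).
  by apply/funext => M; rewrite /ray_bound /A /exp_coeff /= !exprMn; ring.
rewrite -(mulr0 A); apply: cvgM; first exact: cvg_cst.
by rewrite -(mulr0 0); apply: cvgM; exact: cvg_exp_coeff.
Qed.

Lemma kernel_series (r1 r2 phi1 phi2 : R) : 0 <= r1 -> 0 <= r2 ->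
  \sum_(m < M.+1) kernel_coef k al be m phi1 phi2 * (r2 * r1) ^+ m @[M --> \oo] -->
  expR (r2 * r1) * E (polar r1 phi1) (polar r2 phi2).
Proof.
move=> r10 r20; set L := expR _ * _.
pose D M := ray_error k al be E r2 phi2 M r1 phi1.
have D2 : D M ^+ 2 @[M --> \oo] --> 0.
  apply: (squeeze_cvgr _ (cvg_cst 0) (ray_bound_cvg0 r1 r2)).
  by near=> M; rewrite sqr_ge0 ray_error_le.
have D0 : D M @[M --> \oo] --> 0.
  apply/cvgrPdist_lt => e e0.
  move/cvgrPdist_lt : D2 => /(_ (e ^+ 2)); rewrite exprn_gt0// => /(_ isT).
  apply: filterS => M; rewrite !sub0r !normrN normrX.
  by rewrite ltr_pXn2r// ?nnegrE ?ltW.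
have -> : (fun M => \sum_(m < M.+1) kernel_coef k al be m phi1 phi2 * (r2 * r1) ^+ m) = (fun M => L - D M).
  by apply/funext => M; rewrite -ray_partial_sumE /D /ray_error /L /ray_kernel opprB addrC subrK.
by rewrite -[X in _ --> X]subr0; apply: cvgB; [exact: cvg_cst|].
Unshelve. all: by end_near. Qed.

Lemma gen_bessel_series (r1 r2 phi1 phi2 : R) : 0 <= r1 -> 0 <= r2 ->
  \sum_(m < M.+1) double_nu al be (sin (k%:R * phi1) * sin (k%:R * phi2)) (cos (k%:R * phi1) * cos (k%:R * phi2))
      1 1 (bessel_poly k al be m) / poch (k%:R * (al + be)) m * (r2 * r1) ^+ m @[M --> \oo] -->
  expR (r2 * r1) * gen_bessel k E (polar r1 phi1) (polar r2 phi2).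
Proof.
move=> r10 r20.
have kn : (k%:R : R) != 0 by rewrite pnatr_eq0 -lt0n.
have rotE j : dih_rot k j (polar r2 phi2) = polar r2 (phi2 + j%:R * pi / k%:R).
  by rewrite /dih_rot /polar /= cosD sinD; congr pair; ring.
have reflE j : dih_refl k j (polar r2 phi2) = polar r2 (j%:R * pi / k%:R - phi2).
  by rewrite /dih_refl /polar /= cosB sinB; congr pair; ring.
have -> : expR (r2 * r1) * gen_bessel k E (polar r1 phi1) (polar r2 phi2) =
  (4 * k)%:R^-1 * \sum_(j < 2 * k) (expR (r2 * r1) * E (polar r1 phi1) (polar r2 (phi2 + j%:R * pi / k%:R)) +
     expR (r2 * r1) * E (polar r1 phi1) (polar r2 (j%:R * pi / k%:R - phi2))).
  rewrite /gen_bessel mulrCA mulr_sumr; congr (_ * _); apply: eq_bigr => j _.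
  by rewrite rotE reflE mulrDr.
have -> : (fun M => \sum_(m < M.+1) double_nu al be (sin (k%:R * phi1) * sin (k%:R * phi2)) (cos (k%:R * phi1) * cos (k%:R * phi2))
      1 1 (bessel_poly k al be m) / poch (k%:R * (al + be)) m * (r2 * r1) ^+ m) =
  (fun M => (4 * k)%:R^-1 * \sum_(j < 2 * k) (\sum_(m < M.+1) kernel_coef k al be m phi1 (phi2 + j%:R * pi / k%:R) * (r2 * r1) ^+ m
     + \sum_(m < M.+1) kernel_coef k al be m phi1 (j%:R * pi / k%:R - phi2) * (r2 * r1) ^+ m)).
  apply/funext => M.
  transitivity ((4 * k)%:R^-1 * \sum_(m < M.+1) \sum_(j < 2 * k) (kernel_coef k al be m phi1 (phi2 + j%:R * pi / k%:R) +
       kernel_coef k al be m phi1 (j%:R * pi / k%:R - phi2)) * (r2 * r1) ^+ m).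
    rewrite mulr_sumr; apply: eq_bigr => m _.
    rewrite -mulr_suml kernel_coef_bessel_sum// natrM; field.
    by rewrite kn gt_eqF// poch_gt0// mulr_gt0 ?ltr0n// addr_gt0.
  congr (_ * _); rewrite exchange_big/=; apply: eq_bigr => j _.
  by rewrite -big_split/=; apply: eq_bigr => m _; rewrite mulrDl.
apply: cvgM; first exact: cvg_cst.
apply: (@cvgn_sum 'I_(2 * k) _ (fun (j : 'I_(2 * k)) M => \sum_(m < M.+1) kernel_coef k al be m phi1 (phi2 + j%:R * pi / k%:R) * (r2 * r1) ^+ m
     + \sum_(m < M.+1) kernel_coef k al be m phi1 (j%:R * pi / k%:R - phi2) * (r2 * r1) ^+ m)) => j.
by apply: cvgD; exact: kernel_series.
Qed.

End KernelSeries.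

(** * The integral formula *)

Section DoubleNu.
Variables (R : realType) (al be : R).
Hypotheses (al0 : 0 < al) (be0 : 0 < be).
Notation mu := (@lebesgue_measure R).

(** Integration over u alone, with a polynomial in v as result; it links the iterated integral to
    [double_moment]. *)
Fixpoint inner_moment (S C : R) i (p : {poly R}) : {poly R} :=
  if i is i'.+1 then S *: inner_moment S C i' (p * 'X) + C *: ('X * inner_moment S C i' p) else (nu_mom al p)%:P.

Lemma inner_moment_eval S C i p v : nu_mom al (p * (S *: 'X + (v * C)%:P) ^+ i) = (inner_moment S C i p).[v].
Proof.
elim: i p => [|i IH] p /=; first by rewrite expr0 mulr1 hornerC.
rewrite hornerD !hornerZ hornerM hornerX -!IH exprS.
rewrite (_ : p * _ = S *: (p * 'X * (S *: 'X + (v * C)%:P) ^+ i) + (v * C) *: (p * (S *: 'X + (v * C)%:P) ^+ i)); last first.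
  by rewrite -!mul_polyC; ring.
by rewrite raddfD/= !linearZ/=; ring.
Qed.

Lemma inner_moment_mom S C i p q : nu_mom be (q * inner_moment S C i p) = double_moment al be S C i p q.
Proof.
elim: i p q => [|i IH] p q /=; first by rewrite mulrC mul_polyC linearZ.
rewrite -!IH (_ : q * _ = S *: (q * inner_moment S C i (p * 'X)) + C *: (q * 'X * inner_moment S C i p)); last first.
  by rewrite -!mul_polyC; ring.
by rewrite raddfD/= !linearZ.
Qed.

Definition inner_nu S C (h : {poly R}) : {poly R} := \sum_(i < size h) h`_i *: inner_moment S C i 1.

Lemma inner_nu_eval S C (h : {poly R}) v :
  nu_mom al (h \Po (S *: 'X + (v * C)%:P)) = (inner_nu S C h).[v].
Proof.
rewrite comp_polyE linear_sum /inner_nu horner_sum; apply: eq_bigr => i _.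
by rewrite linearZ/= hornerZ -inner_moment_eval mul1r.
Qed.

Lemma inner_nu_mom S C (h : {poly R}) : nu_mom be (inner_nu S C h) = double_nu al be S C 1 1 h.
Proof.
rewrite /inner_nu linear_sum /double_nu /coef_pairing; apply: eq_bigr => i _.
by rewrite linearZ/= -inner_moment_mom mul1r.
Qed.

Lemma double_moment_neg2 S C i p q : double_moment al be (- S) (- C) i p q = (-1) ^+ i * double_moment al be S C i p q.
Proof.
elim: i p q => [|i IH] p q /=; first by rewrite expr0 mul1r.
by rewrite !IH exprS; ring.
Qed.

(** Changing the signs of u and v together changes that of S u + C v. Hence the two exponentials of
    the theorem contribute equally. *)
Lemma double_nu_compN S C (h : {poly R}) :
  double_nu al be S C 1 1 (h \Po (- 'X)) = double_nu al be S C 1 1 h.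
Proof.
transitivity (double_nu al be (- S) (- C) 1 1 h); last first.
  by rewrite double_nu_negl// double_nu_negr// -!polyC1 !comp_polyC.
rewrite comp_polyE double_nu_sumh {2}/double_nu /coef_pairing; apply: eq_bigr => i _.
rewrite double_nuZh double_moment_neg2 [(- 'X) ^+ i]exprNn; congr (_ * _).
rewrite -signr_odd -[in RHS]signr_odd; case: (odd i) => /=.
  by rewrite !expr1 !mulN1r double_nuNh /double_nu coef_pairingXn.
by rewrite !expr0 !mul1r /double_nu coef_pairingXn.
Qed.

Lemma eq_nu_int a (f g : R -> \bar R) : (forall u, -1 <= u <= 1 -> f u = g u) ->
  nu_int a f = nu_int a g.
Proof.
move=> fg; apply: eq_integral => u; rewrite inE/= in_itv/= => u1.
by rewrite fg.
Qed.

Lemma nu_int_ge0 a (f : R -> \bar R) : 0 < a ->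
  (forall u, (-1 <= u <= 1)%R -> (0 <= f u)%E) -> (0 <= nu_int a f)%E.
Proof.
move=> a0 f0; apply: integral_ge0 => u; rewrite /= in_itv/= => u1.
by rewrite mule_ge0 ?f0// lee_fin mulr_ge0 ?powR_ge0//; exact: nu_cst_ge0.
Qed.

Lemma nu_int_nneseries a (f : nat -> R -> R) : 0 < a ->
  (forall m, measurable_fun setT (f m)) -> (forall m u, -1 <= u <= 1 -> 0 <= f m u) ->
  nu_int a (fun u => (\sum_(m <oo) (f m u)%:E)%E) = (\sum_(m <oo) nu_int a (fun u => (f m u)%:E))%E.
Proof.
move=> a0 mf f0.
have w0 (u : R) : 0 <= nu_cst a * (1 - u ^+ 2) `^ (a - 1).
  by rewrite mulr_ge0 ?powR_ge0 ?nu_cst_ge0.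
have mw : measurable_fun setT (fun u : R => nu_cst a * (1 - u ^+ 2) `^ (a - 1)).
  apply: measurable_funM => //.
  apply: (measurableT_comp (measurable_powR (a - 1))).
  by apply: measurable_funB => //; exact: measurable_funX.
rewrite /nu_int -/(nu_cst a) -integral_nneseries//; last 2 first.
- move=> m; apply: measurable_funTS; rewrite (_ : (fun x => _) =
    (fun x => (nu_cst a * (1 - x ^+ 2) `^ (a - 1) * f m x)%:E)); last first.
    by apply/funext => x; rewrite -EFinM.
  by apply/measurable_EFinP; apply: measurable_funM; [exact: mw|exact: mf].
- by move=> m u; rewrite /= in_itv/= => u1; rewrite -EFinM lee_fin mulr_ge0// f0.
apply: eq_integral => u; rewrite inE/= in_itv/= => u1.
by rewrite nneseriesZl// => m _; rewrite lee_fin f0.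
Qed.

Lemma nu2_nneseries S C (h : nat -> {poly R}) :
  (forall m u v, -1 <= u <= 1 -> -1 <= v <= 1 -> 0 <= (h m).[u * S + v * C]) ->
  nu_int be (fun v => nu_int al (fun u => (\sum_(m <oo) ((h m).[u * S + v * C])%:E)%E)) =
  (\sum_(m <oo) (double_nu al be S C 1 1 (h m))%:E)%E.
Proof.
move=> h0.
have innerE m v : nu_int al (fun u => ((h m).[u * S + v * C])%:E) = ((inner_nu S C (h m)).[v])%:E.
  rewrite (_ : (fun u => _) = (fun u => ((h m \Po (S *: 'X + (v * C)%:P)).[u])%:E)); last first.
    apply/funext => u; congr EFin.
    by rewrite horner_comp hornerD hornerZ hornerX hornerC mulrC.
  by rewrite nu_int_poly// inner_nu_eval.
rewrite (@eq_nu_int be _ (fun v => (\sum_(m <oo) ((inner_nu S C (h m)).[v])%:E)%E)).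
  rewrite nu_int_nneseries//.
  - by apply: eq_eseriesr => m _; rewrite nu_int_poly// inner_nu_mom.
  - by move=> m; apply: continuous_measurable_fun; exact: continuous_horner.
  - move=> m v v1; rewrite -lee_fin -innerE; apply: nu_int_ge0 => // u u1.
    by rewrite lee_fin h0.
move=> v v1; rewrite nu_int_nneseries//.
- by apply: eq_eseriesr => m _; exact: innerE.
- move=> m; apply: (measurableT_comp (f := horner (h m))).
    by apply: continuous_measurable_fun; exact: continuous_horner.
  by apply: measurable_funD => //; apply: measurable_funM.
- by move=> m u u1; exact: h0.
Qed.

End DoubleNu.

Section Assembly.
Variable R : realType.

Lemma simplex_prodE (lam b0 : R) (bs : seq R) (c : R) (s : seq R) : size s = size bs ->
  simplex_prod lam b0 bs c s =
  (\prod_(i < size bs) (pos_powR lam (nth 0 s i) * expR (nth 0 bs i * nth 0 s i))) *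
  (pos_powR lam (c - \sum_(t <- s) t) * expR (b0 * (c - \sum_(t <- s) t))).
Proof.
elim: bs c s => [|b bs IH] c [|t s]//=; first by rewrite big_ord0 mul1r big_nil subr0.
move=> [ss]; rewrite IH// big_ord_recl/= big_cons opprD addrA; ring.
Qed.

(** The coordinates sum to 1, so adding [rho] to every exponent costs exp (- rho); this is what
    makes all the expansions nonnegative. *)
Lemma simplex_integrand (lam rho : R) (a : nat -> R) n (s : seq R) :
  size s = n -> all (fun t => 0 < t) s -> \sum_(t <- s) t < 1 ->
  let t := (1 - \sum_(x <- s) x) :: s in
  expR (\sum_(j < n.+1) a j * nth 0 t j) * \prod_(j < n.+1) (nth 0 t j) `^ (lam - 1) =
  expR (- rho) * simplex_prod lam (a 0%N + rho) [seq a j + rho | j <- iota 1 n] 1 s.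
Proof.
move=> sn s0 s1 t.
have szb : size [seq a j + rho | j <- iota 1 n] = n by rewrite size_map size_iota.
pose w := 1 - \sum_(x <- s) x.
have L1 : \prod_(j < n.+1) (nth 0 t j) `^ (lam - 1) = pos_powR lam w * \prod_(i < n) pos_powR lam (nth 0 s i).
  rewrite big_ord_recl /= pos_powR_gt0E ?subr_gt0//; congr (_ * _); apply: eq_bigr => i _.
  have si : nth 0 s i \in s by apply: mem_nth; rewrite sn.
  by rewrite pos_powR_gt0E//; exact: (allP s0 _ si).
have L2 : \sum_(j < n.+1) a j * nth 0 t j =
    - rho + \sum_(i < n) (a i.+1 + rho) * nth 0 s i + (a 0%N + rho) * w.
  have -> : \sum_(i < n) (a i.+1 + rho) * nth 0 s i =
     \sum_(i < n) a i.+1 * nth 0 s i + rho * \sum_(t <- s) t.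
    rewrite (big_nth 0) sn big_mkord mulr_sumr -big_split/=; apply: eq_bigr => i _.
    by rewrite mulrDl.
  rewrite big_ord_recl/= -/w (eq_bigr (fun i : 'I_n => a i.+1 * nth 0 s i))//.
  by rewrite /w; ring.
rewrite L1 L2 simplex_prodE; last by rewrite szb.
rewrite szb [in RHS]big_split/= -/w.
have -> : \prod_(i < n) expR (nth 0 [seq a j + rho | j <- iota 1 n] i * nth 0 s i) =
    expR (\sum_(i < n) (a i.+1 + rho) * nth 0 s i).
  rewrite expR_sum; apply: eq_bigr => i _.
  by rewrite (nth_map 0%N) ?size_iota// nth_iota.
by rewrite !expRD; ring.
Qed.

Section Bessel.
Variables (k : nat) (al be : R).
Hypotheses (k0 : (0 < k)%N) (al0 : 0 < al) (be0 : 0 < be).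
Let lam := al + be.
Let gam := k%:R * lam.
Let kn : (k%:R : R) != 0. Proof. by rewrite pnatr_eq0 -lt0n. Qed.
Let lam0 : 0 < lam. Proof. exact: addr_gt0. Qed.
Let gam0 : 0 < gam. Proof. by rewrite mulr_gt0// ltr0n. Qed.

Lemma bessel_poly_eval (th : R) m :
  (bessel_poly k al be m).[cos (k%:R * th)] = fcoef (\prod_(b <- node_values k th) neg_pow_series lam b) m.
Proof. exact: (neg_pow_poly_eval _ _ (node_U0 R k0) k0 (prod_flin_node th k0)). Qed.

(** At x = cos (k th) the value is a coefficient of a product of binomial series with nonnegative
    parameters 1 + cos. *)
Lemma bessel_poly_ge0 m (x : R) : -1 <= x <= 1 -> 0 <= (bessel_poly k al be m).[x].
Proof.
move=> x1; have -> : x = cos (k%:R * (acos x / k%:R)).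
  by rewrite mulrCA divff// mulr1 acosK// in_itv.
by rewrite bessel_poly_eval neg_pow_series_ge0// node_values_ge0.
Qed.

(** The expression is affine in u and in v, and at the corners of the square it is plus or minus a
    cosine of th1 - th2 or th1 + th2. *)
Lemma xi_bound (th1 th2 u v : R) : -1 <= u <= 1 -> -1 <= v <= 1 ->
  -1 <= u * (sin th1 * sin th2) + v * (cos th1 * cos th2) <= 1.
Proof.
move=> /andP[u1 u2] /andP[v1 v2]; set S := sin _ * _; set C := cos _ * _.
have aE : S + C = cos (th1 - th2) by rewrite cosB addrC.
have bE : C - S = cos (th1 + th2) by rewrite cosD.
have := cos_geN1 (th1 - th2); have := cos_le1 (th1 - th2).
have := cos_geN1 (th1 + th2); have := cos_le1 (th1 + th2).
rewrite -aE -bE => b2 b1 a2 a1.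
have p1 : 0 <= (1 + u) * (1 + v) by apply: mulr_ge0; lra.
have p2 : 0 <= (1 + u) * (1 - v) by apply: mulr_ge0; lra.
have p3 : 0 <= (1 - u) * (1 + v) by apply: mulr_ge0; lra.
have p4 : 0 <= (1 - u) * (1 - v) by apply: mulr_ge0; lra.
apply/andP; split; rewrite -subr_ge0.
  rewrite (_ : _ - _ = ((1 + u) * (1 + v) * (1 + (S + C)) + (1 + u) * (1 - v) * (1 - (C - S))
    + (1 - u) * (1 + v) * (1 + (C - S)) + (1 - u) * (1 - v) * (1 - (S + C))) / 4); last by field.
  by rewrite divr_ge0// !addr_ge0// mulr_ge0//; lra.
rewrite (_ : _ - _ = ((1 + u) * (1 + v) * (1 - (S + C)) + (1 + u) * (1 - v) * (1 + (C - S))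
  + (1 - u) * (1 + v) * (1 - (C - S)) + (1 - u) * (1 - v) * (1 + (S + C))) / 4); last by field.
by rewrite divr_ge0// !addr_ge0// mulr_ge0//; lra.
Qed.

Lemma gamma_series_node (rho th : R) : 0 <= rho ->
  let b j := rho * cos (node k th j) + rho in
  gamma_series gam (simplex_coef lam (b 0%N) [seq b j | j <- iota 1 k.-1]) 1 =
  (\sum_(m <oo) (Gamma lam ^+ k * rho ^+ m * (bessel_poly k al be m).[cos (k%:R * th)] / Gamma (gam + m%:R))%:E)%E.
Proof.
move=> rho0 b; rewrite /gamma_series; apply: eq_eseriesr => m _; congr EFin.
rewrite pos_powR_gt0E// powR1 mulr1 simplex_coefE// size_map size_iota prednK//.
have -> : b 0%N :: [seq b j | j <- iota 1 k.-1] = [seq rho * x | x <- node_values k th].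
  rewrite -[LHS]/(map b (iota 0 k.-1.+1)) prednK// /node_values -map_comp.
  by apply: eq_map => j /=; rewrite /b; ring.
by rewrite neg_pow_seriesZ bessel_poly_eval; ring.
Qed.

Lemma node_ge0 (rho th : R) (s : seq nat) : 0 <= rho ->
  all (fun b => 0 <= b) [seq rho * cos (node k th j) + rho | j <- s].
Proof.
move=> r0; apply/allP => _ /mapP[j _ ->].
rewrite (_ : _ + _ = rho * (1 + cos (node k th j))); last by ring.
by rewrite mulr_ge0// -lerBlDl sub0r cos_geN1.
Qed.

(** The reflected summand accounts for the exponents with pi - q, as cos (pi - q) = - cos q. *)
Definition bessel_term rho m : {poly R} :=
  (expR (- rho) * Gamma lam ^+ k * rho ^+ m / Gamma (gam + m%:R)) *:
    (bessel_poly k al be m + (bessel_poly k al be m \Po (- 'X))).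

Lemma simplex_bessel rho (x : R) : 0 <= rho -> -1 <= x <= 1 ->
  let ap (j : nat) := rho * cos ((acos x - 2 * j%:R * pi) / k%:R) in
  let am (j : nat) := rho * cos ((pi - acos x - 2 * j%:R * pi) / k%:R) in
  simplex_int k.-1 1 (fun s =>
       let t := ((1 - \sum_(x <- s) x) :: s) in
       ((expR (\sum_(j < k) ap j * nth 0 t j) +
         expR (\sum_(j < k) am j * nth 0 t j)) *
        \prod_(j < k) (nth 0 t j) `^ (lam - 1))%:E) =
  (\sum_(m <oo) ((bessel_term rho m).[x])%:E)%E.
Proof.
move=> rho0 x1 ap am.
(* [node] adds 2 pi j / k where the statement subtracts it; evenness of the cosine allows the change
   of sign. *)
pose thp := - (acos x / k%:R); pose thm := - ((pi - acos x) / k%:R).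
have apE j : ap j = rho * cos (node k thp j).
  rewrite /ap -cosN /node /thp; congr (_ * cos _); field.
  exact: kn.
have amE j : am j = rho * cos (node k thm j).
  rewrite /am -cosN /node /thm; congr (_ * cos _); field.
  exact: kn.
have cp : cos (k%:R * thp) = x.
  by rewrite /thp mulrN cosN mulrCA divff// mulr1 acosK// in_itv.
have cm : cos (k%:R * thm) = - x.
  rewrite /thm mulrN cosN mulrCA divff// mulr1 cosB cospi sinpi acosK ?in_itv//; ring.
pose bp j := rho * cos (node k thp j) + rho; pose bm j := rho * cos (node k thm j) + rho.
rewrite (@eq_simplex_int _ _ _ _ (fun s => (expR (- rho) * simplex_prod lam (bp 0%N) [seq bp j | j <- iota 1 k.-1] 1 s +
     expR (- rho) * simplex_prod lam (bm 0%N) [seq bm j | j <- iota 1 k.-1] 1 s)%:E))//; last first.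
  move=> s sn s0 s1 /=; congr EFin; rewrite mulrDl; congr (_ + _).
    under eq_bigr do rewrite apE.
    have := @simplex_integrand lam rho (fun j => rho * cos (node k thp j)) k.-1 s sn s0 s1.
    by rewrite prednK.
  under eq_bigr do rewrite amE.
  have := @simplex_integrand lam rho (fun j => rho * cos (node k thm j)) k.-1 s sn s0 s1.
  by rewrite prednK.
have szp : size [seq bp j | j <- iota 1 k.-1] = k.-1 by rewrite size_map size_iota.
have szm : size [seq bm j | j <- iota 1 k.-1] = k.-1 by rewrite size_map size_iota.
have bp0 : 0 <= bp 0%N by have := node_ge0 thp [:: 0%N] rho0 => /= /andP[].
have bm0 : 0 <= bm 0%N by have := node_ge0 thm [:: 0%N] rho0 => /= /andP[].
have bpa := node_ge0 thp (iota 1 k.-1) rho0; have bma := node_ge0 thm (iota 1 k.-1) rho0.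
have ex0 := expR_ge0 (- rho).
have := simplex_int_prod lam0 bp0 bm0 bpa bma (etrans szp (esym szm)) ltr01 ex0 ex0.
rewrite szp => ->.
rewrite prednK// -/gam !gamma_series_node// cp cm.
have hx : -1 <= - x <= 1 by move: x1 => /andP[h1 h2]; rewrite lerN2 h2 lerNl h1.
have pos m z : -1 <= z <= 1 -> 0 <= Gamma lam ^+ k * rho ^+ m * (bessel_poly k al be m).[z] / Gamma (gam + m%:R).
  move=> z1; apply: divr_ge0; last exact/ltW/Gamma_addn_gt0.
  apply: mulr_ge0; last exact: bessel_poly_ge0.
  by apply: mulr_ge0; apply: exprn_ge0 => //; exact/ltW/Gamma_gt0.
rewrite -!nneseriesZl; last 2 first.
- by move=> m _; rewrite lee_fin pos.
- by move=> m _; rewrite lee_fin pos.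
rewrite -nneseriesD; last 2 first.
- by move=> m _ _; rewrite -EFinM lee_fin mulr_ge0 ?expR_ge0// pos.
- by move=> m _ _; rewrite -EFinM lee_fin mulr_ge0 ?expR_ge0// pos.
apply: eq_eseriesr => m _; rewrite -!EFinM -EFinD; congr EFin.
by rewrite /bessel_term hornerZ hornerD horner_comp hornerN hornerX; ring.
Qed.

Lemma bessel_term_ge0 rho m (x : R) : 0 <= rho -> -1 <= x <= 1 -> 0 <= (bessel_term rho m).[x].
Proof.
move=> rho0 x1; rewrite /bessel_term hornerZ hornerD horner_comp hornerN hornerX.
apply: mulr_ge0; last first.
  apply: addr_ge0; apply: bessel_poly_ge0 => //.
  by move: x1 => /andP[h1 h2]; rewrite lerN2 h2 lerNl h1.
apply: divr_ge0; last exact/ltW/Gamma_addn_gt0.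
apply: mulr_ge0; last exact: exprn_ge0.
by apply: mulr_ge0; [exact: expR_ge0|apply: exprn_ge0; exact/ltW/Gamma_gt0].
Qed.

End Bessel.

End Assembly.

Theorem mainTheorem7 (R : realType) (k : nat) (al be : R)
    (E : R * R -> R * R -> R) :
  (2 <= k)%N -> 0 < al -> 0 < be -> is_dunkl_kernel k al be E ->
  forall r1 r2 phi1 phi2 : R, 0 <= r1 -> 0 <= r2 ->
  let q u v := q_uv u v (k%:R * phi1) (k%:R * phi2) in
  let ap u v (j : nat) := r1 * r2 * cos ((q u v - 2 * j%:R * pi) / k%:R) in
  let am u v (j : nat) := r1 * r2 * cos ((pi - q u v - 2 * j%:R * pi) / k%:R) in
  ((gen_bessel k E (polar r1 phi1) (polar r2 phi2))%:E =
   (Gamma (k%:R * (al + be)) / (2 * Gamma (al + be) ^+ k))%:E *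
   nu_int be (fun v => nu_int al (fun u =>
     simplex_int (k.-1) 1 (fun s =>
       let t := ((1 - \sum_(x <- s) x) :: s)%R in
       ((expR (\sum_(j < k) ap u v j * nth 0 t j) +
         expR (\sum_(j < k) am u v j * nth 0 t j)) *
        \prod_(j < k) (nth 0 t j) `^ (al + be - 1))%R%:E))))%E.
Proof.
move=> k2 al0 be0 DE r1 r2 phi1 phi2 r10 r20 q ap am.
have k0 : (0 < k)%N by exact: leq_trans k2.
have lam0 : 0 < al + be by exact: addr_gt0.
have gam0 : 0 < k%:R * (al + be) by rewrite mulr_gt0// ltr0n.
pose rho := r1 * r2; have rho0 : 0 <= rho by rewrite mulr_ge0.
pose S := sin (k%:R * phi1) * sin (k%:R * phi2).
pose C := cos (k%:R * phi1) * cos (k%:R * phi2).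
have xiE u v : xi_uv u v (k%:R * phi1) (k%:R * phi2) = u * S + v * C.
  by rewrite /xi_uv /S /C; ring.
have xi1 u v : -1 <= u <= 1 -> -1 <= v <= 1 -> -1 <= u * S + v * C <= 1 by exact: xi_bound.
rewrite (@eq_nu_int _ be _ (fun v => nu_int al (fun u =>
    (\sum_(m <oo) ((bessel_term k al be rho m).[u * S + v * C])%:E)%E))); last first.
  move=> v v1; apply: eq_nu_int => u u1.
  have := simplex_bessel k0 al0 be0 rho0 (xi1 u v u1 v1).
  by rewrite /= /ap /am /q /q_uv xiE.
rewrite nu2_nneseries//; last by move=> m u v u1 v1; apply: bessel_term_ge0 => //; exact: xi1.
(* The inverse of the constant in the statement, times the exponential introduced by the shift; the
   2 counts the two equal contributions. *)
pose cst0 := 2 * Gamma (al + be) ^+ k / Gamma (k%:R * (al + be)) * expR (- rho).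
have G0 := Gamma_gt0 gam0; have L0 := Gamma_gt0 lam0.
have termE m : double_nu al be S C 1 1 (bessel_term k al be rho m) =
    cst0 * (double_nu al be S C 1 1 (bessel_poly k al be m) / poch (k%:R * (al + be)) m * (r2 * r1) ^+ m).
  rewrite /bessel_term double_nuZh double_nuDh double_nu_compN// Gamma_poch// /cst0 /rho (mulrC r1).
  by field; rewrite !gt_eqF// poch_gt0.
have cv := @gen_bessel_series R k al be k0 al0 be0 E DE r1 r2 phi1 phi2 r10 r20.
have {}cv : \sum_(m < M.+1) double_nu al be S C 1 1 (bessel_term k al be rho m) @[M --> \oo] -->
    cst0 * (expR (r2 * r1) * gen_bessel k E (polar r1 phi1) (polar r2 phi2)).
  rewrite (_ : (fun M : nat => _) = (fun M : nat => cst0 * \sum_(m < M.+1) (double_nu al be S C 1 1 (bessel_poly k al be m) /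
      poch (k%:R * (al + be)) m * (r2 * r1) ^+ m))); last first.
    by apply/funext => M; rewrite mulr_sumr; apply: eq_bigr => m _; exact: termE.
  by apply: cvgM; [exact: cvg_cst|exact: cv].
have -> : (\sum_(m <oo) (double_nu al be S C 1 1 (bessel_term k al be rho m))%:E)%E =
    (cst0 * (expR (r2 * r1) * gen_bessel k E (polar r1 phi1) (polar r2 phi2)))%:E.
  apply/cvg_lim => //.
  under eq_fun do rewrite big_mkord sumEFin.
  apply: cvg_EFin; first by near=> n.
  by rewrite -cvg_shiftS.
rewrite -EFinM; congr EFin.
have ee : expR (- rho) * expR (r2 * r1) = 1.
  by rewrite -expRD /rho mulrC addNr expR0.
rewrite /cst0; set g := gen_bessel _ _ _ _.
transitivity ((expR (- rho) * expR (r2 * r1)) * g); first by rewrite ee mul1r.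
by field; rewrite expf_neq0 ?andbT gt_eqF.
Unshelve. all: by end_near. Qed.
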